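(* Let $\mathfrak g=D(2,1;\alpha)$ with $\alpha\ne0,-1$, and let $\lambda=m_1\varpi^1_1+m_2\varpi^2_1+m_3\varpi^3_1\in P^+$ be a typical weight with $m_1\ge|R^+_{\bar 1}|-1=3$. Set $$S(\lambda)=\Big\{\mathbf s=(s_\tau)_{\tau\in R^+}\in\mathbb Z_{\ge 0}^{R^+}:\ \sum_{\beta\in R^+_{\bar 1}}s_\beta+s_{2\epsilon_1}\le m_1,\ s_{2\epsilon_2}\le m_2,\ s_{2\epsilon_3}\le m_3,\ s_\beta\le1\ \ \forall\beta\in R^+_{\bar 1}\Big\}.$$ Then the set $\{x^{\mathbf s}v_\lambda:\mathbf s\in S(\lambda)\}$, where $x^{\mathbf s}=\prod_{\tau\in R^+}x_{-\tau}^{s_\tau}$, is a basis of $\operatorname{gr}V(\lambda)$.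
   Context: All vector spaces are over $\mathbb C$. $\mathfrak g=D(2,1;\alpha)$ is the basic classical Lie superalgebra with $\mathfrak g_{\bar 0}\cong\mathfrak{sl}_2\oplus\mathfrak{sl}_2\oplus\mathfrak{sl}_2$, with Cartan subalgebra $\mathfrak h$, distinguished simple system $\epsilon_1-\epsilon_2-\epsilon_3,\ 2\epsilon_2,\ 2\epsilon_3$, where $\epsilon_1,\epsilon_2,\epsilon_3$ is an orthogonal basis with $(\epsilon_1,\epsilon_1)=-\frac{1+\alpha}2$, $(\epsilon_2,\epsilon_2)=\frac12$, $(\epsilon_3,\epsilon_3)=\frac\alpha2$. The positive even roots are $R^+_{\bar 0}=\{2\epsilon_1,2\epsilon_2,2\epsilon_3\}$ and the positive odd roots are $R^+_{\bar 1}=\{\epsilon_1\pm\epsilon_2\pm\epsilon_3\}$ (four roots); $R^+=R^+_{\bar 0}\cup R^+_{\bar 1}$. $\varpi^i_1$ is the fundamental weight of the $i$-th copy of $\mathfrak{sl}_2$, whose positive root is $2\epsilon_i$ (so $\varpi_1^i=\epsilon_i$). $x_{-\tau}$ is a non-zero root vector in $\mathfrak g_{-\tau}$, $\mathfrak n^\pm=\bigoplus_{\tau\in R^+}\mathfrak g_{\pm\tau}$, $\mathfrak n^\pm_{\bar i}=\mathfrak n^\pm\cap\mathfrak g_{\bar i}$. $V(\lambda)$ is the irreducible highest weight module of highest weight $\lambda\in\mathfrak h^*$ with respect to $\mathfrak h\oplus\mathfrak n^+$, with highest weight vector $v_\lambda$; $P^+=\{\lambda:\dim V(\lambda)<\infty\}$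 (for such $\lambda$, $m_1,m_2,m_3\in\mathbb Z_{\ge0}$). $\lambda$ is typical if $(\lambda+\rho,\beta)\ne0$ for all $\beta\in R^+_{\bar 1}$, with $\rho=\rho_{\bar 0}-\rho_{\bar 1}$ and $\rho_{\bar i}$ the half-sum of the roots in $R^+_{\bar i}$. Let $\mathbf U(\mathfrak n^-)_k$ be the span of products of at most $k$ elements of $\mathfrak n^-$; $\operatorname{gr}V(\lambda)$ is the associated graded space of the filtration $\mathbf U(\mathfrak n^-)_kv_\lambda$ of $V(\lambda)$, a cyclic module over $S(\mathfrak n^-_{\bar 0})\otimes\Lambda(\mathfrak n^-_{\bar 1})$ generated by the image of $v_\lambda$ (again written $v_\lambda$). Monomials $x^{\mathbf s}$ are taken in this algebra, with odd root vectors in any fixed order. *)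

(* Defs.v *)
From HB Require Import structures.
From mathcomp Require Import all_boot all_order all_algebra.
From mathcomp Require Import boolp functions.
From mathcomp Require Import generic_quotient ring_quotient ring.

Set Implicit Arguments.
Unset Strict Implicit.
Unset Printing Implicit Defensive.

Import GRing.Theory.
Local Open Scope ring_scope.
Local Open Scope quotient_scope.

Section LinearAlgebra.
Variables (K : fieldType) (M : lmodType K).

Definition lspan (A : M -> Prop) : {pred M} := fun w =>
  `[< exists n (c : 'I_n -> K) (u : 'I_n -> M),
        (forall i, A (u i)) /\ w = \sum_i c i *: u i >].

Lemma lspan_submod (A : M -> Prop) : submod_closed (lspan A).
Proof.
split=> [|a x y /asboolP[m [c [u [uA ->]]]] /asboolP[n [d [w [wA ->]]]]].
  apply/asboolP; exists 0%N, (fun=> 0), (fun=> 0).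
  by split=> [[]//|]; rewrite big_ord0.
apply/asboolP; exists (m + n)%N.
exists (fun i => match fintype.split i with inl j => a * c j | inr j => d j end).
exists (fun i => match fintype.split i with inl j => u j | inr j => w j end).
split=> [i|]; first by case: (fintype.split i).
rewrite big_split_ord /= scaler_sumr; congr (_ + _); apply: eq_bigr => i _.
  by rewrite (unsplitK (inl i)) scalerA.
by rewrite (unsplitK (inr i)).
Qed.

HB.instance Definition _ (A : M -> Prop) :=
  GRing.isSubmodClosed.Build K M (lspan A) (lspan_submod A).

(* The family (b i)_(i in S) is a basis; in particular b is injective on S.   *)
Definition is_basis (I : eqType) (S : {pred I}) (b : I -> M) : Prop :=
  (forall (r : seq I) (c : I -> K), uniq r -> {subset r <= S} ->
     \sum_(i <- r) c i *: b i = 0 -> {in r, forall i, c i = 0}) /\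
  (forall w, exists (r : seq I) (c : I -> K),
     {subset r <= S} /\ w = \sum_(i <- r) c i *: b i).

End LinearAlgebra.

Section QuotientModule.
Variables (K : fieldType) (M : lmodType K) (N : submodClosed M).

(* A submodClosed predicate is not canonically a zmodClosed one. *)
Definition lquot_sub : {pred M} := [pred x in N].

Lemma lquot_sub_submod : submod_closed lquot_sub.
Proof. exact: GRing.submodClosedP N. Qed.

HB.instance Definition _ :=
  GRing.isSubmodClosed.Build K M lquot_sub lquot_sub_submod.

Definition lquot := {ideal_quot lquot_sub}.
HB.instance Definition _ := GRing.Zmodule.on lquot.


Definition lquot_scale (a : K) (q : lquot) : lquot := \pi_lquot (a *: repr q).

Lemma lquot_scale_pi a x : lquot_scale a (\pi_lquot x) = \pi_lquot (a *: x).
Proof.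
have xN : repr (\pi_lquot x) - x \in lquot_sub.
  apply: etrans (Quotient.idealrBE _ _ _) _; apply/eqP.
  exact: (@reprK _ lquot).
apply/eqP; rewrite -Quotient.idealrBE -scalerBr; exact: rpredZ.
Qed.

Lemma lquot_piD x y : \pi_lquot (x + y) = \pi_lquot x + \pi_lquot y :> lquot.
Proof. exact: (Quotient.pi_add lquot_sub). Qed.

Lemma lquot_pi_eq x y :
  \pi_lquot x = \pi_lquot y :> lquot <-> x - y \in N.
Proof.
have -> : (x - y \in N) = (x - y \in lquot_sub) by [].
split=> [/eqP|xyN]; first by rewrite -Quotient.idealrBE.
by apply/eqP; rewrite -Quotient.idealrBE.
Qed.

Lemma lquot_pi0 : \pi_lquot 0 = 0 :> lquot.
Proof. by apply: (addrI (\pi_lquot 0)); rewrite -lquot_piD !addr0. Qed.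

Lemma lquot_scalerA a b q :
  lquot_scale a (lquot_scale b q) = lquot_scale (a * b) q.
Proof.
by elim/quotW: q => x; rewrite (lquot_scale_pi b) !lquot_scale_pi scalerA.
Qed.

Lemma lquot_scale1r : left_id 1 lquot_scale.
Proof. by elim/quotW => x; rewrite lquot_scale_pi scale1r. Qed.

Lemma lquot_scalerDr : right_distributive lquot_scale +%R.
Proof.
move=> a; elim/quotW=> x; elim/quotW=> y.
rewrite -lquot_piD !lquot_scale_pi.
by rewrite scalerDr lquot_piD.
Qed.

Lemma lquot_scalerDl q : {morph lquot_scale^~ q : a b / a + b}.
Proof.
by elim/quotW: q => x a b; rewrite !lquot_scale_pi scalerDl lquot_piD.
Qed.

HB.instance Definition _ := GRing.Zmodule_isLmodule.Build K lquot
  lquot_scalerA lquot_scale1r lquot_scalerDr lquot_scalerDl.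

End QuotientModule.

(* The space gr F is \bigoplus_k F_k / F_(k-1), with F_(-1) = 0, realized as  *)
(* the quotient of \bigoplus_k F_k by \bigoplus_k F_(k-1).                    *)
Section AssociatedGraded.
Variables (K : fieldType) (V : lmodType K) (F : nat -> submodClosed V).

Definition fil_dsum_pred : {pred nat -> V} := fun f =>
  `[< (exists n, forall k, (n <= k)%N -> f k = 0) /\
      (forall k, f k \in F k) >].

Lemma fil_dsum_submod : submod_closed fil_dsum_pred.
Proof.
split=> [|a f g /asboolP[[m fm] fF] /asboolP[[n gn] gF]]; apply/asboolP; split.
- by exists 0%N.
- by move=> k; rewrite rpred0.
- exists (maxn m n) => k; rewrite geq_max => /andP[mk nk].
  by rewrite addrfctE scalrfctE fm ?gn// scaler0 addr0.
- by move=> k; rewrite addrfctE scalrfctE rpredD ?rpredZ.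
Qed.

HB.instance Definition _ :=
  GRing.isSubmodClosed.Build K (nat -> V) fil_dsum_pred fil_dsum_submod.

Record fil_dsum :=
  FilDsum { fil_dsum_val :> nat -> V; _ : fil_dsum_val \in fil_dsum_pred }.

HB.instance Definition _ := [isSub for fil_dsum_val].
HB.instance Definition _ := [Choice of fil_dsum by <:].
HB.instance Definition _ := [SubChoice_isSubZmodule of fil_dsum by <:].
HB.instance Definition _ := [SubZmodule_isSubLmodule of fil_dsum by <:].

Definition fil_prev (k : nat) : {pred V} :=
  if k is k'.+1 then mem (F k') else pred1 0.

Definition fil_null : {pred fil_dsum} := fun f =>
  `[< forall k, f k \in fil_prev k >].

Lemma fil_null_submod : submod_closed fil_null.
Proof.
split=> [|a f g /asboolP fN /asboolP gN]; apply/asboolP => -[|k] /=.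
- exact: eqxx.
- exact: rpred0.
- have := gN 0%N; have := fN 0%N; rewrite !inE => /eqP f0 /eqP g0.
  by rewrite addrfctE scalrfctE f0 g0 scaler0 addr0.
- by have fk := fN k.+1; have gk := gN k.+1; rewrite rpredD ?rpredZ.
Qed.

HB.instance Definition _ :=
  GRing.isSubmodClosed.Build K fil_dsum fil_null fil_null_submod.

Definition gr : lmodType K := lquot fil_null.

(* The class of w in F_k / F_(k-1), if w \in F k. *)
Definition gr_class (k : nat) (w : V) : gr :=
  \pi_(lquot fil_null) (insubd 0 (fun j => if j == k then w else 0)).

(* If T maps each F_k to F_(k+1), the operator of degree one induced by T,    *)
(* sending the class of w in F_k / F_(k-1) to that of T w in F_(k+1) / F_k.   *)
Definition gr_op (T : V -> V) (q : gr) : gr :=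
  \pi_(lquot fil_null)
    (insubd 0 (fun j => if j is k.+1 then T ((repr q : fil_dsum) k) else 0)).


Lemma gr_class_val k w : w \in F k ->
  insubd (0 : fil_dsum) (fun j => if j == k then w else 0) =1
  (fun j => if j == k then w else 0).
Proof.
move=> wF j; rewrite -[LHS]/(\val _ j) val_insubd ifT//.
apply/asboolP; split=> [|i]; last by case: eqP => [->|_]; rewrite ?rpred0.
by exists k.+1 => i ki; rewrite gtn_eqF.
Qed.

Lemma gr_class_eq0 k w : w \in F k ->
  gr_class k w = 0 <-> w \in fil_prev k.
Proof.
move=> wF; rewrite -lquot_pi0 /gr_class; split=> [/lquot_pi_eq|wk].
  by rewrite subr0 => /asboolP/(_ k); rewrite gr_class_val// eqxx.
apply/lquot_pi_eq; rewrite subr0; apply/asboolP => j; rewrite gr_class_val//.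
case: eqP => [->//|_]; case: j => [|j]; [exact: eqxx|exact: rpred0].
Qed.

Lemma gr_opE (T : {linear V -> V}) :
  (forall k w, w \in F k -> T w \in F k.+1) ->
  forall k w, w \in F k -> gr_op T (gr_class k w) = gr_class k.+1 (T w).
Proof.
move=> TF k w wF; set q := gr_class k w; set f := repr q : fil_dsum.
have fF j : (f : nat -> V) j \in F j by have /asboolP[_ /(_ j)] := valP f.
have fq : \pi_(lquot fil_null) f = q by exact: (@reprK _ (lquot fil_null)).
have TfP : (fun j => if j is i.+1 then T ((f : nat -> V) i) else 0)
    \in fil_dsum_pred.
  apply/asboolP; have /asboolP[[n fn] _] := valP f; split.
    by exists n.+1 => -[|j]// nj; rewrite fn ?linear0.
  by case=> [|j]; [exact: rpred0|exact: TF].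
have /asboolP fk : f - insubd 0 (fun j => if j == k then w else 0) \in fil_null.
  exact/lquot_pi_eq.
apply/lquot_pi_eq/asboolP => j; rewrite -[fil_dsum_val _]/(\val _).
rewrite raddfB /= addrfctE opprfctE gr_class_val ?TF//.
rewrite -[fil_dsum_val _]/(\val _) val_insubd TfP.
case: j => [|j]; first by rewrite /= subr0 inE.
have := fk j; rewrite -[fil_dsum_val _]/(\val _) raddfB /=.
rewrite addrfctE opprfctE gr_class_val// eqSS => fj.
rewrite [X in _ - X](_ : _ = T (if j == k then w else 0)); last first.
  by case: eqP => // _; rewrite linear0.
rewrite -linearB; case: j fj => [|j]; last exact: TF.
by rewrite inE => /eqP ->; rewrite linear0 /= rpred0.
Qed.

End AssociatedGraded.

Section LieSuperalgebra.
Variable K : fieldType.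

Record is_lie_superalgebra (g : lmodType K) (par : bool -> {pred g})
    (br : g -> g -> g) : Prop := IsLieSuperalgebra {
  lsa_submod : forall i, submod_closed (par i);
  lsa_direct : forall x, exists! p : g * g,
    [/\ p.1 \in par false, p.2 \in par true & x = p.1 + p.2];
  lsa_linear_l : forall y, linear (br^~ y);
  lsa_linear_r : forall x, linear (br x);
  lsa_graded : forall i j x y, x \in par i -> y \in par j ->
    br x y \in par (i (+) j);
  lsa_skew : forall i j x y, x \in par i -> y \in par j ->
    br x y = - ((-1) ^+ (i && j) *: br y x);
  lsa_jacobi : forall i j x y z, x \in par i -> y \in par j ->
    br x (br y z) = br (br x y) z + (-1) ^+ (i && j) *: br y (br x z)
}.

Record is_supermodule (g : vectType K) (par : bool -> {pred g})
    (br : g -> g -> g) (V : vectType K) (Vpar : bool -> {vspace V})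
    (act : 'Hom(g, 'End(V))) : Prop := IsSupermodule {
  smod_sum : (Vpar false + Vpar true)%VS = fullv;
  smod_direct : (Vpar false :&: Vpar true)%VS = 0%VS;
  smod_graded : forall i j x w, x \in par i -> w \in Vpar j ->
    act x w \in Vpar (i (+) j);
  smod_br : forall i j x y w, x \in par i -> y \in par j ->
    act (br x y) w = act x (act y w) - (-1) ^+ (i && j) *: act y (act x w)
}.

Definition is_irreducible (g V : vectType K) (Vpar : bool -> {vspace V})
    (act : 'Hom(g, 'End(V))) : Prop :=
  fullv <> 0%VS :> {vspace V} /\
  forall W : {vspace V},
    (W :&: Vpar false + W :&: Vpar true)%VS = W ->
    (forall x w, w \in W -> act x w \in W) ->
    W = 0%VS \/ W = fullv.

End LieSuperalgebra.

(* D(2,1;alpha) is sl_2^3 \oplus (K^2)^{\otimes 3}. The copies of sl_2 are    *)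
(* numbered 0, 1, 2, and an odd element is given by the family of its         *)
(* coordinates on the tensors e_(b 0) \otimes e_(b 1) \otimes e_(b 2), for b  *)
(* in {ffun 'I_3 -> 'I_2}. The weight of this tensor is the sum of the        *)
(* +- epsilon_(i+1), with the sign + if b i = 0.                              *)
Section D21.
Variable K : fieldType.

Definition sl2 : {vspace 'M[K]_2} := lker (linfun (mxtrace : 'M[K]_2 -> K^o)).

Lemma mem_sl2 A : (A \in sl2) = (\tr A == 0).
Proof. by rewrite memv_ker lfunE. Qed.

Definition sl2_br (X Y : subvs_of sl2) : subvs_of sl2 :=
  vsproj sl2 (vsval X *m vsval Y - vsval Y *m vsval X).

Definition odd_index := {ffun 'I_3 -> 'I_2}.
Definition even_part : vectType K := {ffun 'I_3 -> subvs_of sl2}.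
Definition odd_part : vectType K := {ffun odd_index -> K^o}.
Definition D21 : vectType K := (even_part * odd_part)%type.

Definition D21_par (i : bool) : {pred D21} :=
  fun x => if i then x.1 == 0 else x.2 == 0.

Definition tensor_act (X : even_part) (u : odd_part) : odd_part :=
  [ffun b : odd_index => \sum_i \sum_c
     vsval (X i) (b i) c * u [ffun j => if j == i then c else b j]].

(* psi is the symplectic form of C^2 with psi(e_0, e_1) = 1, and psi_mx a b   *)
(* the endomorphism z |-> psi(e_b, z) e_a - psi(z, e_a) e_b of C^2.           *)
Definition psi (a b : 'I_2) : K := (a < b)%:R - (b < a)%:R.

Definition psi_mx (a b : 'I_2) : 'M[K]_2 :=
  \matrix_(r, c) (psi b c * (r == a)%:R - psi c a * (r == b)%:R).

Variable alpha : K.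

(* (epsilon_1, epsilon_1), (epsilon_2, epsilon_2), (epsilon_3, epsilon_3) *)
Definition eps_norm (i : 'I_3) : K :=
  [:: - (1 + alpha) / 2; 2^-1; alpha / 2]`_i.

(* For x = \bigotimes_j x_j and y = \bigotimes_j y_j, the component of [x, y] *)
(* in the i-th copy of sl_2 is                                                *)
(*   sigma_i (\prod_(j != i) psi(x_j, y_j)) P_i, where                        *)
(*   P_i z = psi(y_i, z) x_i - psi(z, x_i) y_i                                *)
(*   and sigma = (- 1 - alpha, 1, alpha).                                     *)
(* Up to a common factor, the invariant form is the trace form divided by     *)
(* sigma_i on the i-th copy of sl_2, so sigma_i = 2 (epsilon_i, epsilon_i).   *)
Definition odd_br (u w : odd_part) : even_part :=
  [ffun i => vsproj sl2 ((2 * eps_norm i) *: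
     \sum_(b : odd_index) \sum_(c : odd_index)
       (u b * w c * \prod_(j | j != i) psi (b j) (c j)) *: psi_mx (b i) (c i))].

Definition D21_br (x y : D21) : D21 :=
  ([ffun i => sl2_br (x.1 i) (y.1 i)] + odd_br x.2 y.2,
   tensor_act x.1 y.2 - tensor_act y.1 x.2).

Definition cartan : {pred D21} := fun H =>
  (H.2 == 0) && [forall i, is_diag_mx (vsval (H.1 i))].

(* The elements of h^* are given by their coordinates on epsilon_1,           *)
(* epsilon_2, epsilon_3, which form the basis of h^* dual to the basis of h   *)
(* made of the matrices diag(1, -1) of the three copies of sl_2; hence the    *)
(* fundamental weights are epsilon_1, epsilon_2, epsilon_3 as well.           *)
Definition weight := 'rV[K]_3.
Definition eps (i : 'I_3) : weight := delta_mx 0 i.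
Definition wt_eval (l : weight) (H : D21) : K :=
  \sum_i l 0 i * vsval (H.1 i) 0 0.
Definition wt_form (l l' : weight) : K := \sum_i eps_norm i * l 0 i * l' 0 i.

(* The positive roots: inl i is 2 epsilon_(i+1), and inr (s, t) is            *)
(* epsilon_1 + (-1)^s epsilon_2 + (-1)^t epsilon_3.                           *)
Definition proot := ('I_3 + bool * bool)%type.
Definition root_wt (t : proot) : weight :=
  match t with
  | inl i => 2 *: eps i
  | inr p => eps 0 + (-1) ^+ p.1 *: eps 1 + (-1) ^+ p.2 *: eps 2%:R
  end.

Definition root_space (l : weight) (x : D21) : Prop :=
  forall H, H \in cartan -> D21_br H x = wt_eval l H *: x.

Definition nplus (x : D21) : Prop := exists y : proot -> D21,
  (forall t, root_space (root_wt t) (y t)) /\ x = \sum_t y t.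
Definition nminus (x : D21) : Prop := exists y : proot -> D21,
  (forall t, root_space (- root_wt t) (y t)) /\ x = \sum_t y t.

Definition rho : weight :=
  2^-1 *: (\sum_i root_wt (inl i)) - 2^-1 *: (\sum_p root_wt (inr p)).

Definition typical (l : weight) : Prop :=
  forall p, wt_form (l + rho) (root_wt (inr p)) <> 0.

(* V is V(l), with highest weight vector v; as V is a vectType, it is finite  *)
(* dimensional, so that l is in P^+.                                          *)
Record is_irr_hw_module (l : weight) (V : vectType K)
    (Vpar : bool -> {vspace V}) (act : 'Hom(D21, 'End(V))) (v : V) : Prop :=
  IsIrrHwModule {
  hw_module : is_supermodule D21_par D21_br Vpar act;
  hw_irr : is_irreducible Vpar act;
  hw_neq0 : v <> 0;
  hw_par : exists i, v \in Vpar i;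
  hw_nplus : forall x, nplus x -> act x v = 0;
  hw_weight : forall H, H \in cartan -> act H v = wt_eval l H *: v
}.

(* pbw_fil act v k is U(n^-)_k v. *)
Definition pbw_fil (V : vectType K) (act : 'Hom(D21, 'End(V))) (v : V)
    (k : nat) : submodClosed V :=
  lspan (fun w => exists xs : seq D21,
    [/\ (size xs <= k)%N, forall x, x \in xs -> nminus x
      & w = foldr (fun x u => act x u) v xs]).

(* The action of prod_(t <- r) (x t) ^ (s t), in this order, on the image of  *)
(* v in gr V.                                                                 *)
Definition gr_monomial (V : vectType K) (act : 'Hom(D21, 'End(V))) (v : V)
    (x : proot -> D21) (r : seq proot) (s : {ffun proot -> nat}) :
    gr (pbw_fil act v) :=
  foldr (fun t => iter (s t) (gr_op (act (x t)))) (gr_class _ 0 v) r.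

Lemma pbw_filS (V : vectType K) (act : 'Hom(D21, 'End(V))) (v : V)
    (x : D21) : nminus x ->
  forall k w, w \in pbw_fil act v k -> act x w \in pbw_fil act v k.+1.
Proof.
move=> xN k w /asboolP[n [c [u [uP ->]]]]; apply/asboolP; exists n, c.
exists (fun i => act x (u i)); split=> [i|]; last first.
  by rewrite linear_sum; apply: eq_bigr => i _; rewrite linearZ.
have [xs [xsk xsN ->]] := uP i; exists (x :: xs); split=> // y.
by rewrite inE => /orP[/eqP->//|/xsN].
Qed.

End D21.

Section D21Theory.
Variables (K : fieldType) (alpha : K).
Local Notation sl2 := (sl2 K).

Definition odd_mk (a b c : 'I_2) : odd_index :=
  [ffun j : 'I_3 => if j == 0 then a else if j == 1 then b else c].

Lemma ord3P (P : 'I_3 -> Prop) : P 0 -> P 1 -> P 2%:R -> forall i, P i.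
Proof.
move=> P0 P1 P2 [[|[|[|//]]] h].
- by rewrite (_ : Ordinal h = 0)//; exact: val_inj.
- by rewrite (_ : Ordinal h = 1)//; exact: val_inj.
- by rewrite (_ : Ordinal h = 2%:R)//; exact: val_inj.
Qed.

Lemma ord2P (P : 'I_2 -> Prop) : P 0 -> P 1 -> forall i, P i.
Proof.
move=> P0 P1 [[|[|//]] h].
- by rewrite (_ : Ordinal h = 0)//; exact: val_inj.
- by rewrite (_ : Ordinal h = 1)//; exact: val_inj.
Qed.

Lemma sum2 (W : nmodType) (F : 'I_2 -> W) : \sum_i F i = F 0 + F 1.
Proof.
by rewrite big_ord_recl big_ord1; congr (_ + F _); exact: val_inj.
Qed.

Lemma sum3 (W : nmodType) (F : 'I_3 -> W) : \sum_i F i = F 0 + F 1 + F 2%:R.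
Proof.
by rewrite !big_ord_recl big_ord0 addr0 addrA; congr (_ + F _ + F _); exact: val_inj.
Qed.

Lemma odd_eqP (b c : odd_index) : b 0 = c 0 -> b 1 = c 1 -> b 2%:R = c 2%:R -> b = c.
Proof. by move=> h0 h1 h2; apply/(@ffunP _ (fun=> 'I_2)); apply: ord3P. Qed.

Lemma odd_mkE (b : odd_index) : b = odd_mk (b 0) (b 1) (b 2%:R).
Proof. by apply: odd_eqP; rewrite ffunE. Qed.

Lemma sum_odd (W : nmodType) (F : odd_index -> W) :
  \sum_b F b = \sum_a \sum_b \sum_c F (odd_mk a b c).
Proof.
under [RHS]eq_bigr do rewrite pair_big.
rewrite pair_big /=.
rewrite (reindex (fun p : 'I_2 * ('I_2 * 'I_2) => odd_mk p.1 p.2.1 p.2.2))//.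
exists (fun b : odd_index => (b 0, (b 1, b 2%:R))) => [[a [b c]] _|b _] /=.
  by rewrite !ffunE.
by rewrite -odd_mkE.
Qed.

Lemma upd0 a b c d :
  [ffun j => if j == 0 then d else odd_mk a b c j] = odd_mk d b c.
Proof. by apply: odd_eqP; rewrite !ffunE. Qed.
Lemma upd1 a b c d :
  [ffun j => if j == 1 then d else odd_mk a b c j] = odd_mk a d c.
Proof. by apply: odd_eqP; rewrite !ffunE. Qed.
Lemma upd2 a b c d :
  [ffun j => if j == 2%:R then d else odd_mk a b c j] = odd_mk a b d.
Proof. by apply: odd_eqP; rewrite !ffunE. Qed.

Lemma tensor_actE X (u : odd_part K) a b c :
  tensor_act X u (odd_mk a b c) =
  vsval (X 0) a 0 * u (odd_mk 0 b c) + vsval (X 0) a 1 * u (odd_mk 1 b c) +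
  (vsval (X 1) b 0 * u (odd_mk a 0 c) + vsval (X 1) b 1 * u (odd_mk a 1 c)) +
  (vsval (X 2%:R) c 0 * u (odd_mk a b 0) + vsval (X 2%:R) c 1 * u (odd_mk a b 1)).
Proof.
by rewrite ffunE sum3 !sum2 !upd0 !upd1 !upd2 !ffunE.
Qed.

Lemma sl2_tr (X : subvs_of sl2) : vsval X 1 1 = - vsval X 0 0.
Proof.
have := subvsP X; rewrite mem_sl2 /mxtrace sum2 addrC addr_eq0 => /eqP//.
Qed.

Lemma sl2_brE (X Y : subvs_of sl2) :
  vsval (sl2_br X Y) = vsval X *m vsval Y - vsval Y *m vsval X.
Proof.
by rewrite vsprojK// mem_sl2 linearB /= mxtrace_mulC subrr.
Qed.

Lemma psiE : (psi K 0 0 = 0) * (psi K 0 1 = 1) * (psi K 1 0 = -1) * (psi K 1 1 = 0).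
Proof. by rewrite /psi /= !subr0 sub0r. Qed.

Lemma odd_brE (u w : odd_part K) i :
  vsval (odd_br alpha u w i) = (2 * eps_norm alpha i) *:
     \sum_(b : odd_index) \sum_(c : odd_index)
       (u b * w c * \prod_(j | j != i) psi K (b j) (c j)) *: psi_mx K (b i) (c i).
Proof.
rewrite ffunE vsprojK//; apply: memvZ; apply: memv_suml => b _.
apply: memv_suml => c _; apply: memvZ; rewrite mem_sl2 /mxtrace sum2 !mxE.
by elim/ord2P: (b i); elim/ord2P: (c i); rewrite !psiE /= ?mulr0 ?mulr1 ?subrr ?subr0 ?addr0 ?add0r ?sub0r ?opprK ?addrN ?addNr.
Qed.

Lemma prod3 (F : 'I_3 -> K) :
  (\prod_(j | j != 0) F j = F 1 * F 2%:R) *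
  (\prod_(j | j != 1) F j = F 0 * F 2%:R) *
  (\prod_(j | j != 2%:R) F j = F 0 * F 1).
Proof.
have e1 : lift ord0 ord0 = 1 :> 'I_3 by exact: val_inj.
have e2 : lift ord0 (lift ord0 ord0) = 2%:R :> 'I_3 by exact: val_inj.
do ![split]; rewrite big_mkcond 3!big_ord_recl big_ord0 e1 e2 /=.
- by rewrite mul1r mulr1.
- by rewrite mul1r mulr1.
- by rewrite !mulr1.
Qed.


Lemma odd_br_entry (u w : odd_part K) i r s :
  vsval (odd_br alpha u w i) r s = 2 * eps_norm alpha i *
    (\sum_(b : odd_index) \sum_(c : odd_index)
      (u b * w c * \prod_(j | j != i) psi K (b j) (c j)) *
      (psi K (c i) s * (r == b i)%:R - psi K s (b i) * (r == c i)%:R)).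
Proof.
rewrite odd_brE mxE; congr (_ * _); rewrite summxE; apply: eq_bigr => b _.
by rewrite summxE; apply: eq_bigr => c _; rewrite !mxE.
Qed.

Lemma odd_mk_val a b c :
  (odd_mk a b c 0 = a) * (odd_mk a b c 1 = b) * (odd_mk a b c 2%:R = c).
Proof. by rewrite !ffunE. Qed.

Definition flip2 (a : 'I_2) : 'I_2 := if a == 0 then 1 else 0.
Definition sgn2 (a : 'I_2) : K := if a == 0 then 1 else -1.

Lemma psi_contract a (F : 'I_2 -> K) :
  \sum_c psi K a c * F c = sgn2 a * F (flip2 a).
Proof.
rewrite sum2; elim/ord2P: a; rewrite !psiE /sgn2 /flip2 /=.
- by rewrite mul0r add0r.
- by rewrite mul0r addr0.
Qed.


Lemma odd_contract0 (w : odd_part K) (G : 'I_2 -> K) a b c :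
  \sum_(d : odd_index) w d * \prod_(j | j != 0) psi K (odd_mk a b c j) (d j)
     * G (d 0) =
  sgn2 b * sgn2 c * \sum_a' w (odd_mk a' (flip2 b) (flip2 c)) * G a'.
Proof.
rewrite sum_odd.
rewrite (eq_bigr (fun a' => \sum_b' \sum_c' psi K b b' * (psi K c c' * (w (odd_mk a' b' c') * G a')))); last first.
  move=> a' _; apply: eq_bigr => b' _; apply: eq_bigr => c' _.
  by rewrite prod3 !odd_mk_val; ring.
rewrite mulr_sumr; apply: eq_bigr => a' _.
under eq_bigr do rewrite -mulr_sumr psi_contract.
by rewrite psi_contract; ring.
Qed.

Lemma odd_br0 (u w : odd_part K) : let X := odd_br alpha u w 0 in
  let s := 2 * eps_norm alpha 0 in
  (vsval X 0 1 = s * (2 * (u (odd_mk 0 0 0) * w (odd_mk 0 1 1) - u (odd_mk 0 0 1) * w (odd_mk 0 1 0) - u (odd_mk 0 1 0) * w (odd_mk 0 0 1) + u (odd_mk 0 1 1) * w (odd_mk 0 0 0)))) *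
  (vsval X 1 0 = s * (- 2 * (u (odd_mk 1 0 0) * w (odd_mk 1 1 1) - u (odd_mk 1 0 1) * w (odd_mk 1 1 0) - u (odd_mk 1 1 0) * w (odd_mk 1 0 1) + u (odd_mk 1 1 1) * w (odd_mk 1 0 0)))) *
  (vsval X 0 0 = s * (- ((u (odd_mk 0 0 0) * w (odd_mk 1 1 1) - u (odd_mk 0 0 1) * w (odd_mk 1 1 0) - u (odd_mk 0 1 0) * w (odd_mk 1 0 1) + u (odd_mk 0 1 1) * w (odd_mk 1 0 0)) + (u (odd_mk 1 0 0) * w (odd_mk 0 1 1) - u (odd_mk 1 0 1) * w (odd_mk 0 1 0) - u (odd_mk 1 1 0) * w (odd_mk 0 0 1) + u (odd_mk 1 1 1) * w (odd_mk 0 0 0))))) *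
  (vsval X 1 1 = s * (- (- ((u (odd_mk 0 0 0) * w (odd_mk 1 1 1) - u (odd_mk 0 0 1) * w (odd_mk 1 1 0) - u (odd_mk 0 1 0) * w (odd_mk 1 0 1) + u (odd_mk 0 1 1) * w (odd_mk 1 0 0)) + (u (odd_mk 1 0 0) * w (odd_mk 0 1 1) - u (odd_mk 1 0 1) * w (odd_mk 0 1 0) - u (odd_mk 1 1 0) * w (odd_mk 0 0 1) + u (odd_mk 1 1 1) * w (odd_mk 0 0 0)))))).
Proof.
have h r s : vsval (odd_br alpha u w 0) r s = 2 * eps_norm alpha 0 *
  \sum_a \sum_b \sum_c u (odd_mk a b c) * (sgn2 b * sgn2 c * \sum_a'
     w (odd_mk a' (flip2 b) (flip2 c)) * (psi K a' s * (r == a)%:R - psi K s a * (r == a')%:R)).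
  rewrite odd_br_entry; congr (_ * _); rewrite sum_odd.
  apply: eq_bigr => a _; apply: eq_bigr => b _; apply: eq_bigr => c _.
  rewrite -(odd_contract0 w (fun d => psi K d s * (r == a)%:R - psi K s a * (r == d)%:R) a b c) mulr_sumr; apply: eq_bigr => d _.
  by rewrite odd_mk_val !mulrA.
by do ![split]; rewrite h !sum2 !psiE /sgn2 /flip2 /=; congr (_ * _); ring.
Qed.

Lemma odd_contract1 (w : odd_part K) (G : 'I_2 -> K) a b c :
  \sum_(d : odd_index) w d * \prod_(j | j != 1) psi K (odd_mk a b c j) (d j)
     * G (d 1) =
  sgn2 a * sgn2 c * \sum_b' w (odd_mk (flip2 a) b' (flip2 c)) * G b'.
Proof.
rewrite sum_odd.
rewrite (eq_bigr (fun a' => \sum_b' \sum_c' psi K a a' * (psi K c c' * (w (odd_mk a' b' c') * G b')))); last first.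
  move=> a' _; apply: eq_bigr => b' _; apply: eq_bigr => c' _.
  by rewrite prod3 !odd_mk_val; ring.
rewrite exchange_big mulr_sumr /=; apply: eq_bigr => b' _.
under eq_bigr do rewrite -mulr_sumr psi_contract.
by rewrite psi_contract; ring.
Qed.

Lemma odd_br1 (u w : odd_part K) : let X := odd_br alpha u w 1 in
  let s := 2 * eps_norm alpha 1 in
  (vsval X 0 1 = s * (2 * (u (odd_mk 0 0 0) * w (odd_mk 1 0 1) - u (odd_mk 0 0 1) * w (odd_mk 1 0 0) - u (odd_mk 1 0 0) * w (odd_mk 0 0 1) + u (odd_mk 1 0 1) * w (odd_mk 0 0 0)))) *
  (vsval X 1 0 = s * (- 2 * (u (odd_mk 0 1 0) * w (odd_mk 1 1 1) - u (odd_mk 0 1 1) * w (odd_mk 1 1 0) - u (odd_mk 1 1 0) * w (odd_mk 0 1 1) + u (odd_mk 1 1 1) * w (odd_mk 0 1 0)))) *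
  (vsval X 0 0 = s * (- ((u (odd_mk 0 0 0) * w (odd_mk 1 1 1) - u (odd_mk 0 0 1) * w (odd_mk 1 1 0) - u (odd_mk 1 0 0) * w (odd_mk 0 1 1) + u (odd_mk 1 0 1) * w (odd_mk 0 1 0)) + (u (odd_mk 0 1 0) * w (odd_mk 1 0 1) - u (odd_mk 0 1 1) * w (odd_mk 1 0 0) - u (odd_mk 1 1 0) * w (odd_mk 0 0 1) + u (odd_mk 1 1 1) * w (odd_mk 0 0 0))))) *
  (vsval X 1 1 = s * (- (- ((u (odd_mk 0 0 0) * w (odd_mk 1 1 1) - u (odd_mk 0 0 1) * w (odd_mk 1 1 0) - u (odd_mk 1 0 0) * w (odd_mk 0 1 1) + u (odd_mk 1 0 1) * w (odd_mk 0 1 0)) + (u (odd_mk 0 1 0) * w (odd_mk 1 0 1) - u (odd_mk 0 1 1) * w (odd_mk 1 0 0) - u (odd_mk 1 1 0) * w (odd_mk 0 0 1) + u (odd_mk 1 1 1) * w (odd_mk 0 0 0)))))).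
Proof.
have h r s : vsval (odd_br alpha u w 1) r s = 2 * eps_norm alpha 1 *
  \sum_a \sum_b \sum_c u (odd_mk a b c) * (sgn2 a * sgn2 c * \sum_b'
     w (odd_mk (flip2 a) b' (flip2 c)) * (psi K b' s * (r == b)%:R - psi K s b * (r == b')%:R)).
  rewrite odd_br_entry; congr (_ * _); rewrite sum_odd.
  apply: eq_bigr => a _; apply: eq_bigr => b _; apply: eq_bigr => c _.
  rewrite -(odd_contract1 w (fun d => psi K d s * (r == b)%:R - psi K s b * (r == d)%:R) a b c) mulr_sumr; apply: eq_bigr => d _.
  by rewrite odd_mk_val !mulrA.
by do ![split]; rewrite h !sum2 !psiE /sgn2 /flip2 /=; congr (_ * _); ring.
Qed.

Lemma odd_contract2 (w : odd_part K) (G : 'I_2 -> K) a b c :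
  \sum_(d : odd_index) w d * \prod_(j | j != 2%:R) psi K (odd_mk a b c j) (d j)
     * G (d 2%:R) =
  sgn2 a * sgn2 b * \sum_c' w (odd_mk (flip2 a) (flip2 b) c') * G c'.
Proof.
rewrite sum_odd.
rewrite (eq_bigr (fun a' => \sum_b' \sum_c' psi K a a' * (psi K b b' * (w (odd_mk a' b' c') * G c')))); last first.
  move=> a' _; apply: eq_bigr => b' _; apply: eq_bigr => c' _.
  by rewrite prod3 !odd_mk_val; ring.
under eq_bigr do rewrite exchange_big /=.
rewrite exchange_big mulr_sumr /=; apply: eq_bigr => c' _.
under eq_bigr do rewrite -mulr_sumr psi_contract.
by rewrite psi_contract; ring.
Qed.

Lemma odd_br2 (u w : odd_part K) : let X := odd_br alpha u w 2%:R in
  let s := 2 * eps_norm alpha 2%:R in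
  (vsval X 0 1 = s * (2 * (u (odd_mk 0 0 0) * w (odd_mk 1 1 0) - u (odd_mk 0 1 0) * w (odd_mk 1 0 0) - u (odd_mk 1 0 0) * w (odd_mk 0 1 0) + u (odd_mk 1 1 0) * w (odd_mk 0 0 0)))) *
  (vsval X 1 0 = s * (- 2 * (u (odd_mk 0 0 1) * w (odd_mk 1 1 1) - u (odd_mk 0 1 1) * w (odd_mk 1 0 1) - u (odd_mk 1 0 1) * w (odd_mk 0 1 1) + u (odd_mk 1 1 1) * w (odd_mk 0 0 1)))) *
  (vsval X 0 0 = s * (- ((u (odd_mk 0 0 0) * w (odd_mk 1 1 1) - u (odd_mk 0 1 0) * w (odd_mk 1 0 1) - u (odd_mk 1 0 0) * w (odd_mk 0 1 1) + u (odd_mk 1 1 0) * w (odd_mk 0 0 1)) + (u (odd_mk 0 0 1) * w (odd_mk 1 1 0) - u (odd_mk 0 1 1) * w (odd_mk 1 0 0) - u (odd_mk 1 0 1) * w (odd_mk 0 1 0) + u (odd_mk 1 1 1) * w (odd_mk 0 0 0))))) *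
  (vsval X 1 1 = s * (- (- ((u (odd_mk 0 0 0) * w (odd_mk 1 1 1) - u (odd_mk 0 1 0) * w (odd_mk 1 0 1) - u (odd_mk 1 0 0) * w (odd_mk 0 1 1) + u (odd_mk 1 1 0) * w (odd_mk 0 0 1)) + (u (odd_mk 0 0 1) * w (odd_mk 1 1 0) - u (odd_mk 0 1 1) * w (odd_mk 1 0 0) - u (odd_mk 1 0 1) * w (odd_mk 0 1 0) + u (odd_mk 1 1 1) * w (odd_mk 0 0 0)))))).
Proof.
have h r s : vsval (odd_br alpha u w 2%:R) r s = 2 * eps_norm alpha 2%:R *
  \sum_a \sum_b \sum_c u (odd_mk a b c) * (sgn2 a * sgn2 b * \sum_c'
     w (odd_mk (flip2 a) (flip2 b) c') * (psi K c' s * (r == c)%:R - psi K s c * (r == c')%:R)).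
  rewrite odd_br_entry; congr (_ * _); rewrite sum_odd.
  apply: eq_bigr => a _; apply: eq_bigr => b _; apply: eq_bigr => c _.
  rewrite -(odd_contract2 w (fun d => psi K d s * (r == c)%:R - psi K s c * (r == d)%:R) a b c) mulr_sumr; apply: eq_bigr => d _.
  by rewrite odd_mk_val !mulrA.
by do ![split]; rewrite h !sum2 !psiE /sgn2 /flip2 /=; congr (_ * _); ring.
Qed.


Lemma even_eqP (X Y : even_part K) :
  (forall i, vsval (X i) 0 1 = vsval (Y i) 0 1) ->
  (forall i, vsval (X i) 1 0 = vsval (Y i) 1 0) ->
  (forall i, vsval (X i) 0 0 = vsval (Y i) 0 0) -> X = Y.
Proof.
move=> h01 h10 h00; apply/ffunP => i; apply/val_inj/matrixP => r c /=.
by elim/ord2P: r; elim/ord2P: c; rewrite // !sl2_tr h00.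
Qed.

Lemma odd_part_eqP (u w : odd_part K) :
  (forall a b c, u (odd_mk a b c) = w (odd_mk a b c)) -> u = w.
Proof. by move=> h; apply/ffunP => b; rewrite (odd_mkE b). Qed.

Lemma eps_norm0E : eps_norm alpha 0 = - eps_norm alpha 1 - eps_norm alpha 2%:R.
Proof. by rewrite /eps_norm /=; ring. Qed.

Lemma sl2_br_entry (X Y : subvs_of sl2) : let Z := sl2_br X Y in
  (vsval Z 0 1 = 2 * (vsval X 0 0 * vsval Y 0 1 - vsval Y 0 0 * vsval X 0 1)) *
  (vsval Z 1 0 = 2 * (vsval X 1 0 * vsval Y 0 0 - vsval Y 1 0 * vsval X 0 0)) *
  (vsval Z 0 0 = vsval X 0 1 * vsval Y 1 0 - vsval Y 0 1 * vsval X 1 0).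
Proof.
by do ![split]; rewrite sl2_brE !mxE !sum2 ?sl2_tr; ring.
Qed.

Definition evbr (X Y : even_part K) : even_part K :=
  [ffun i => sl2_br (X i) (Y i)].

Lemma evenD (X Y : even_part K) i r s :
  vsval ((X + Y) i) r s = vsval (X i) r s + vsval (Y i) r s.
Proof. by rewrite ffunE linearD /= mxE. Qed.

Lemma evbrE X Y i : evbr X Y i = sl2_br (X i) (Y i).
Proof. by rewrite ffunE. Qed.

Lemma oddD (u w : odd_part K) b : (u + w) b = u b + w b.
Proof. by rewrite ffunE. Qed.

Lemma oddN (u : odd_part K) b : (- u) b = - u b.
Proof. by rewrite ffunE. Qed.

Lemma evbr_jac X Y Z : evbr X (evbr Y Z) = evbr (evbr X Y) Z + evbr Y (evbr X Z).
Proof.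
by apply: even_eqP => i; rewrite evenD !evbrE !sl2_br_entry; ring.
Qed.

Lemma tensor_rep X Y u :
  tensor_act (evbr X Y) u =
  tensor_act X (tensor_act Y u) - tensor_act Y (tensor_act X u).
Proof.
apply: odd_part_eqP => a b c; rewrite oddD oddN !tensor_actE !evbrE !sl2_brE !mxE !sum2; ring.
Qed.

Lemma odd_br_equiv X u w :
  evbr X (odd_br alpha u w) =
  odd_br alpha (tensor_act X u) w + odd_br alpha u (tensor_act X w).
Proof.
apply: even_eqP; apply: ord3P; rewrite evenD evbrE !sl2_br_entry.
all: rewrite ?odd_br0 ?odd_br1 ?odd_br2 !tensor_actE !sl2_tr.
all: ring.
Qed.

Lemma odd_jac u w z :
  tensor_act (odd_br alpha u w) z + tensor_act (odd_br alpha u z) w +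
  tensor_act (odd_br alpha w z) u = 0.
Proof.
apply: odd_part_eqP => a b c.
rewrite !oddD [RHS]ffunE !tensor_actE.
elim/ord2P: a; elim/ord2P: b; elim/ord2P: c.
all: rewrite ?odd_br0 ?odd_br1 ?odd_br2 eps_norm0E.
all: ring.
Qed.


Lemma evenZ a (X : even_part K) i r s :
  vsval ((a *: X) i) r s = a * vsval (X i) r s.
Proof. by rewrite ffunE linearZ /= mxE. Qed.

Lemma oddZ a (u : odd_part K) b : (a *: u) b = a * u b.
Proof. by rewrite ffunE. Qed.

Lemma tensor_act_lin a (X Y : even_part K) u :
  tensor_act (a *: X + Y) u = a *: tensor_act X u + tensor_act Y u.
Proof.
apply: odd_part_eqP => b c d.
by rewrite oddD oddZ !tensor_actE !evenD !evenZ; ring.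
Qed.

Lemma tensor_act_linr a (X : even_part K) u w :
  tensor_act X (a *: u + w) = a *: tensor_act X u + tensor_act X w.
Proof.
apply: odd_part_eqP => b c d.
by rewrite oddD oddZ !tensor_actE !oddD !oddZ; ring.
Qed.

Lemma evbrC (X Y : even_part K) : evbr X Y = - evbr Y X.
Proof.
rewrite -scaleN1r; apply: even_eqP => i;
  by rewrite evenZ !evbrE !sl2_br_entry; ring.
Qed.

Lemma evbr_lin a (X Y Z : even_part K) : evbr (a *: X + Y) Z = a *: evbr X Z + evbr Y Z.
Proof.
apply: even_eqP => i;
  by rewrite evenD evenZ !evbrE !sl2_br_entry !evenD !evenZ; ring.
Qed.

Lemma odd_brC u w : odd_br alpha u w = odd_br alpha w u.
Proof.
by apply: even_eqP; apply: ord3P; rewrite ?odd_br0 ?odd_br1 ?odd_br2; ring.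
Qed.

Lemma odd_br_lin a u u' w :
  odd_br alpha (a *: u + u') w = a *: odd_br alpha u w + odd_br alpha u' w.
Proof.
apply: even_eqP; apply: ord3P;
  by rewrite evenD evenZ ?odd_br0 ?odd_br1 ?odd_br2 !oddD !oddZ; ring.
Qed.

Lemma D21_brE (x y : D21 K) : D21_br alpha x y =
  (evbr x.1 y.1 + odd_br alpha x.2 y.2, tensor_act x.1 y.2 - tensor_act y.1 x.2).
Proof. by []. Qed.

Lemma D21_br_linl y : linear (fun x => D21_br alpha x y).
Proof.
move=> a x x'; rewrite !D21_brE /= evbr_lin odd_br_lin tensor_act_lin.
rewrite tensor_act_linr; congr (_, _) => /=.
  by rewrite scalerDr addrACA.
by rewrite scalerBr opprD addrACA.
Qed.

Lemma D21_br_linr x : linear (D21_br alpha x).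
Proof.
move=> a y y'; rewrite !D21_brE /= ![evbr x.1 _]evbrC evbr_lin.
rewrite ![odd_br _ x.2 _]odd_brC odd_br_lin tensor_act_lin tensor_act_linr.
congr (_, _) => /=.
  by rewrite scalerDr opprD scalerN addrACA.
by rewrite scalerBr opprD addrACA.
Qed.

Lemma tensor_act0 (X : even_part K) : tensor_act X 0 = 0.
Proof. by have := tensor_act_linr (-1) X 0 0; rewrite scaler0 addr0 scaleN1r addNr. Qed.
Lemma tensor_act0l (u : odd_part K) : tensor_act 0 u = 0.
Proof. by have := tensor_act_lin (-1) 0 0 u; rewrite scaler0 addr0 scaleN1r addNr. Qed.
Lemma evbr0l (X : even_part K) : evbr 0 X = 0.
Proof. by have := evbr_lin (-1) 0 0 X; rewrite scaler0 addr0 scaleN1r addNr. Qed.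
Lemma evbr0 (X : even_part K) : evbr X 0 = 0.
Proof. by rewrite evbrC evbr0l oppr0. Qed.
Lemma odd_br0l (u : odd_part K) : odd_br alpha 0 u = 0.
Proof. by have := odd_br_lin (-1) 0 0 u; rewrite scaler0 addr0 scaleN1r addNr. Qed.
Lemma odd_br0r u : odd_br alpha u 0 = 0.
Proof. by rewrite odd_brC odd_br0l. Qed.
Lemma tensor_actN (X : even_part K) u : tensor_act X (- u) = - tensor_act X u.
Proof. by have := tensor_act_linr (-1) X u 0; rewrite tensor_act0 !addr0 !scaleN1r. Qed.
Lemma odd_brNl u w : odd_br alpha (- u) w = - odd_br alpha u w.
Proof. by have := odd_br_lin (-1) u 0 w; rewrite odd_br0l !addr0 !scaleN1r. Qed.
Lemma odd_brN u w : odd_br alpha w (- u) = - odd_br alpha w u.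
Proof. by rewrite ![odd_br _ w _]odd_brC odd_brNl. Qed.

Definition D21z := (tensor_act0, tensor_act0l, evbr0, evbr0l, odd_br0l, odd_br0r, subr0, sub0r, add0r, addr0).

Lemma pairD (a c : even_part K) (b d : odd_part K) :
  (a, b) + (c, d) = (a + c, b + d) :> D21 K.
Proof. by []. Qed.
Lemma pairN (a : even_part K) (b : odd_part K) : - (a, b) = (- a, - b) :> D21 K.
Proof. by []. Qed.

Lemma D21_par0 (x : D21 K) : (x \in D21_par (K:=K) false) = (x.2 == 0).
Proof. by []. Qed.
Lemma D21_par1 (x : D21 K) : (x \in D21_par (K:=K) true) = (x.1 == 0).
Proof. by []. Qed.

Lemma D21_lie_superalgebra :
  is_lie_superalgebra (D21_par (K := K)) (D21_br alpha).
Proof.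
split.
- case; split=> [|a x y]; rewrite ?D21_par0 ?D21_par1 //=;
    by move=> /eqP -> /eqP ->; rewrite scaler0 addr0.
- case=> X u; exists ((X, 0), (0, u)); split=> /=.
    split; rewrite ?D21_par0 ?D21_par1 //=.
    by congr (_, _) => /=; rewrite ?addr0 ?add0r.
  case=> [[Y w] [Z t]] []; rewrite D21_par0 D21_par1 /=.
  by move=> /eqP -> /eqP -> [-> ->]; rewrite addr0 add0r.
- exact: D21_br_linl.
- exact: D21_br_linr.
- case; case=> -[X u] [Y w]; rewrite ?D21_par0 ?D21_par1 /=;
    by move=> /eqP -> /eqP ->; apply/eqP; rewrite -/(evbr _ _) !D21z ?oppr0.
- case; case=> -[X u] [Y w]; rewrite ?D21_par0 ?D21_par1 /=;
    move=> /eqP -> /eqP ->;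
    rewrite !D21_brE /= !D21z ?expr0 ?expr1 ?scale1r ?scaleN1r ?opprK.
  + by rewrite odd_brC.
  + by rewrite pairN oppr0.
  + by rewrite pairN oppr0 opprK.
  + by rewrite pairN oppr0 -evbrC.
- case; case=> -[X u] [Y w] [Z t]; rewrite ?D21_par0 ?D21_par1 /=;
    move=> /eqP -> /eqP ->;
    rewrite !D21_brE /= !D21z ?expr0 ?expr1 ?scale1r ?scaleN1r ?pairN pairD;
    congr (_, _).
  + rewrite !odd_brN opprK evbrC odd_br_equiv opprD addrAC.
    by rewrite [odd_br _ w _]odd_brC addNr add0r.
  + rewrite opprK; apply/esym/eqP.
    by rewrite -addr_eq0 odd_jac.
  + by rewrite odd_brNl odd_br_equiv addrA addNr add0r.
  + by rewrite tensor_rep !tensor_actN opprK opprB.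
  + by rewrite odd_br_equiv.
  + by rewrite tensor_rep tensor_actN opprB addrA addNr add0r.
  + exact: evbr_jac.
  + by rewrite tensor_rep subrK.
Qed.

End D21Theory.

Definition Slambda (m1 m2 m3 : nat) : {pred {ffun proot -> nat}} := fun s =>
  [&& (\sum_(p : bool * bool) s (inr p) + s (inl 0%R) <= m1)%N,
      (s (inl 1%R) <= m2)%N, (s (inl 2%:R) <= m3)%N
    & [forall p : bool * bool, (s (inr p) <= 1)%N]].

(* Main.v *)
(* Let F be the negative root vector of the first copy of sl_2, y_p the negative odd and z_p the
   positive odd root vectors, and L the span of the f_2^i f_3^j v_lambda.

   Independence. Some operator P in U(g) kills the vectors F y_p l and three of the four cubic
   monomials y_p y_q y_r l (l in L), and acts on the fourth one as m_1 - 2 times the product of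
   the (lambda + rho, beta), up to a nonzero constant. Applying P after e_2 and e_3, one sees that
   the cubic monomials are independent modulo F y_p L. Relations of the other degrees reduce to
   this one: multiply by some y_p, and cancel powers of F, which are injective on a weight space
   whose weight is at least the exponent. Relations between monomials with different powers of F
   are separated by their h_1-weight. Here m_1 >= 3 is used.

   Spanning. Permuting the factors of a product of negative root vectors changes it by a nonzero
   scalar modulo shorter products, so it suffices to rewrite F^(m_1 + 1 - k) y_(p_1) ... y_(p_k) v
   by monomials with fewer factors among F and the y_p. For k = 0 it vanishes; the step from k to
   k + 1 applies z_p to such a relation.

   Finally, a basis of V(lambda) such that every term of the filtration is spanned by basis
   vectors induces a basis of gr V(lambda). *)

Require Import Defs.
From HB Require Import structures.
From mathcomp Require Import all_boot all_order all_algebra.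
From mathcomp Require Import ring zify boolp functions generic_quotient.
From mathcomp Require Import reals complex.

Set Implicit Arguments.
Unset Strict Implicit.
Unset Printing Implicit Defensive.

Import GRing.Theory.
Local Open Scope ring_scope.

(** * The cubic pairing *)

(** The obstacle is that the y_p do not anticommute: [y false false] and [y true true], and likewise
    [y true false] and [y false true], anticommute only up to a multiple of F. Hence F y_p l has the
    same H-weight as a cubic monomial, and multiplying a relation by some y_p creates such vectors.
    This is why P has to ignore them: it first projects to the kernel of E, where they disappear,
    and then returns to L by three positive odd vectors, with corrections from the even part. Degree
    three is the right place to test: shorter products can be completed to cubic ones, and
    multiplying the quartic monomial by a y_p gives F times a cubic one. The inequality in S(lambda)
    also has a meaning for F. A product of k of the y_p applied to L has H-weight m_1 - k, so the
    condition that F^n times this product is allowed says that n is at most that weight, which is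
    what makes F^n injective there. *)

Section TopPairing.
Variables (K : fieldType) (V : vectType K) (al m1 m2 m3 : K).
Variables (F E H h2 e2 f2 h3 e3 f3 : 'End(V)) (y z : bool -> bool -> 'End(V)).
(* b i j stands for f2^i f3^j v / (i! j!), and for 0 if i or j is negative, so that the
   hypotheses on e2, e3, f2, f3 below need no case distinction. *)
Variable b : int -> int -> V.

Definition om (c d : bool) : K := (~~ c && d)%:R - (c && ~~ d)%:R.
Definition sl2_vec (e f h : 'End(V)) (c d : bool) : 'End(V) :=
  if c == d then if c then (- 2) *: f else 2 *: e else - h.

Hypothesis zy : forall c d c' d' x, z c d (y c' d' x) =
  ((1 + al) * (om c c' * om d d')) *: H x
  + om d d' *: sl2_vec e2 f2 h2 c c' x
  + (al * om c c') *: sl2_vec e3 f3 h3 d d' x - y c' d' (z c d x).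
Hypothesis yy : forall c d c' d' x, y c d (y c' d' x) =
  (2 * (1 + al) * (om c c' * om d d')) *: F x - y c' d' (y c d x).
Hypothesis two_neq0 : 2 != 0 :> K.
Hypothesis zF : forall c d x, z c d (F x) = F (z c d x) - y c d x.
Hypothesis EF : forall x, E (F x) = F (E x) + H x.
Hypothesis Ey : forall c d x, E (y c d x) = y c d (E x) + z c d x.
Hypothesis Hy : forall c d x, H (y c d x) = y c d (H x) - y c d x.
Hypothesis h2y : forall c d x, h2 (y c d x) = y c d (h2 x) + (-1) ^+ c *: y c d x.
Hypothesis h3y : forall c d x, h3 (y c d x) = y c d (h3 x) + (-1) ^+ d *: y c d x.
Hypothesis e2y : forall c d x, e2 (y c d x) = y c d (e2 x) + c%:R *: y false d x.
Hypothesis e3y : forall c d x, e3 (y c d x) = y c d (e3 x) + d%:R *: y c false x.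
Hypothesis f2y : forall c d x, f2 (y c d x) = y c d (f2 x) + (~~ c)%:R *: y true d x.
Hypothesis f3y : forall c d x, f3 (y c d x) = y c d (f3 x) + (~~ d)%:R *: y c true x.
Hypothesis zb : forall c d i j, z c d (b i j) = 0.
Hypothesis Eb : forall i j, E (b i j) = 0.
Hypothesis Hb : forall i j, H (b i j) = m1 *: b i j.
Hypothesis h2b : forall i j, h2 (b i j) = (m2 - 2 * i%:~R) *: b i j.
Hypothesis h3b : forall i j, h3 (b i j) = (m3 - 2 * j%:~R) *: b i j.
Hypothesis e2b : forall i j, e2 (b i j) = (m2 - i%:~R + 1) *: b (i - 1) j.
Hypothesis e3b : forall i j, e3 (b i j) = (m3 - j%:~R + 1) *: b i (j - 1).
Hypothesis f2b : forall i j, f2 (b i j) = (i%:~R + 1) *: b (i + 1) j.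
Hypothesis f3b : forall i j, f3 (b i j) = (j%:~R + 1) *: b i (j + 1).

Local Notation z00 := (z false false).
Local Notation z01 := (z false true).
Local Notation z10 := (z true false).
Local Notation z11 := (z true true).
Local Notation y00 := (y false false).
Local Notation y01 := (y false true).
Local Notation y10 := (y true false).
Local Notation y11 := (y true true).

Lemma zyE x :
  (z00 (y00 x) = - y00 (z00 x)) * (z01 (y01 x) = - y01 (z01 x)) *
  (z10 (y10 x) = - y10 (z10 x)) * (z11 (y11 x) = - y11 (z11 x)) *
  (z00 (y01 x) = 2 *: e2 x - y01 (z00 x)) *
  (z00 (y10 x) = (2 * al) *: e3 x - y10 (z00 x)) *
  (z00 (y11 x) = (1 + al) *: H x - h2 x - al *: h3 x - y11 (z00 x)) *
  (z01 (y00 x) = - 2 *: e2 x - y00 (z01 x)) *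
  (z01 (y10 x) = - (1 + al) *: H x + h2 x - al *: h3 x - y10 (z01 x)) *
  (z01 (y11 x) = - (2 * al) *: f3 x - y11 (z01 x)) *
  (z10 (y00 x) = - (2 * al) *: e3 x - y00 (z10 x)) *
  (z10 (y01 x) = - (1 + al) *: H x - h2 x + al *: h3 x - y01 (z10 x)) *
  (z10 (y11 x) = - 2 *: f2 x - y11 (z10 x)) *
  (z11 (y00 x) = (1 + al) *: H x + h2 x + al *: h3 x - y00 (z11 x)) *
  (z11 (y01 x) = (2 * al) *: f3 x - y01 (z11 x)) *
  (z11 (y10 x) = 2 *: f2 x - y10 (z11 x)).
Proof.
do ![split]; rewrite zy /sl2_vec /om /= ?mulr0n ?mulr1n ?lfunE /= ?lfunE /=
  ?(subr0, sub0r, mulr0, mul0r, mulr1, mul1r, mulrN, mulNr, opprK, scale0r, add0r, addr0, scale1r, scaleNr, scalerN, oppr0);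
  by rewrite ?(subr0, sub0r, oppr0, scalerA, mulrC al).
Qed.

Lemma weight_y x d :
  (h2 (y false d x) = y false d (h2 x) + y false d x) *
  (h2 (y true d x) = y true d (h2 x) - y true d x) *
  (h3 (y d false x) = y d false (h3 x) + y d false x) *
  (h3 (y d true x) = y d true (h3 x) - y d true x) *
  (e2 (y false d x) = y false d (e2 x)) *
  (e2 (y true d x) = y true d (e2 x) + y false d x) *
  (e3 (y d false x) = y d false (e3 x)) *
  (e3 (y d true x) = y d true (e3 x) + y d false x) *
  (f2 (y true d x) = y true d (f2 x)) *
  (f2 (y false d x) = y false d (f2 x) + y true d x) *
  (f3 (y d true x) = y d true (f3 x)) *
  (f3 (y d false x) = y d false (f3 x) + y d true x).
Proof.
by do ![split]; rewrite (h2y, h3y, e2y, e3y, f2y, f3y) ?expr0 ?expr1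
  ?(scale1r, scaleN1r, scale0r, addr0).
Qed.

Lemma lfunD (f : 'End(V)) : {morph f : x w / x + w}. Proof. exact: linearD. Qed.
Lemma lfunN (f : 'End(V)) : {morph f : x / - x}. Proof. exact: linearN. Qed.
Lemma lfunZ (f : 'End(V)) k : {morph f : x / k *: x}. Proof. by move=> x; exact: linearZ. Qed.
Lemma lfun0 (f : 'End(V)) : f 0 = 0. Proof. exact: linear0. Qed.

Lemma intrD1 (i : int) : ((i + 1)%:~R = i%:~R + 1 :> K) * ((i - 1)%:~R = i%:~R - 1 :> K).
Proof. by rewrite intrD intrB. Qed.

(* On the cubic monomials in the y applied to b, this is a multiple of the projection onto the
   kernel of E along the vectors F (y c d (b i j)). *)
Definition esing : 'End(V) := (m1 - 1) *: \1%VF - (F \o E)%VF.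

(* The coefficients are chosen so that pairing3 below vanishes on all but one of the four cubic
   monomials. *)
Definition pairing2 : 'End(V) :=
  (((1 + al) * (m1 - 2)) *: (z01 \o z10) - (h2 \o (z01 \o z10)) - al *: (h3 \o (z01 \o z10))
   - 2 *: (f2 \o (z00 \o z01)) + (2 * al) *: (f3 \o (z00 \o z10)))%VF.

Lemma esingE x : esing x = (m1 - 1) *: x - F (E x).
Proof. by do 4! rewrite ?lfunE /=. Qed.

Lemma pairing2E u : pairing2 u =
  ((1 + al) * (m1 - 2)) *: z01 (z10 u) - h2 (z01 (z10 u)) - al *: h3 (z01 (z10 u))
   - 2 *: f2 (z00 (z01 u)) + (2 * al) *: f3 (z00 (z10 u)).
Proof. by do 8! rewrite ?lfunE /=. Qed.

Local Ltac gather := rewrite ?(addrK, subrK) ?(scalerDr, scalerN, opprD, opprK, scalerA) -?scaleNr -?scalerDl.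
Lemma zyb i j :
  (z00 (y00 (b i j)) = 0) * (z01 (y01 (b i j)) = 0) *
  (z10 (y10 (b i j)) = 0) * (z11 (y11 (b i j)) = 0) *
  (z00 (y01 (b i j)) = (2 * (m2 - i%:~R + 1)) *: b (i - 1) j) *
  (z00 (y10 (b i j)) = (2 * al * (m3 - j%:~R + 1)) *: b i (j - 1)) *
  (z00 (y11 (b i j)) = ((1 + al) * m1 - (m2 - 2 * i%:~R) - al * (m3 - 2 * j%:~R)) *: b i j) *
  (z01 (y00 (b i j)) = (- 2 * (m2 - i%:~R + 1)) *: b (i - 1) j) *
  (z01 (y10 (b i j)) = (- (1 + al) * m1 + (m2 - 2 * i%:~R) - al * (m3 - 2 * j%:~R)) *: b i j) *
  (z01 (y11 (b i j)) = (- (2 * al) * (j%:~R + 1)) *: b i (j + 1)) *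
  (z10 (y00 (b i j)) = (- (2 * al) * (m3 - j%:~R + 1)) *: b i (j - 1)) *
  (z10 (y01 (b i j)) = (- (1 + al) * m1 - (m2 - 2 * i%:~R) + al * (m3 - 2 * j%:~R)) *: b i j) *
  (z10 (y11 (b i j)) = (- 2 * (i%:~R + 1)) *: b (i + 1) j) *
  (z11 (y00 (b i j)) = ((1 + al) * m1 + (m2 - 2 * i%:~R) + al * (m3 - 2 * j%:~R)) *: b i j) *
  (z11 (y01 (b i j)) = (2 * al * (j%:~R + 1)) *: b i (j + 1)) *
  (z11 (y10 (b i j)) = (2 * (i%:~R + 1)) *: b (i + 1) j).
Proof.
do ![split]; rewrite zyE zb lfun0 ?oppr0 ?subr0 //;
  rewrite ?(Hb, h2b, h3b, e2b, e3b, f2b, f3b) addr0; gather; congr (_ *: _); ring.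
Qed.
Local Ltac step :=
  rewrite ?(zyb, zyE, weight_y, EF, Ey, Hy, zF, lfunD, lfunZ, lfunN, zb, Eb, Hb, h2b, h3b, e2b, e3b, f2b, f3b);
  rewrite ?(lfun0, scaler0, oppr0, addr0, add0r, subr0, sub0r).
(** Each z (z u) is first evaluated to a single collected multiple of a [b], and only then do the
    surrounding h and f act on it. This keeps the expressions small. *)
Local Ltac crunch := match goal with |- context [fun_of_lfun (z ?a ?b) (fun_of_lfun (z ?c ?d) ?u)] =>
  let E := fresh in eassert (E : z a b (z c d u) = _); [do ! step; gather; reflexivity | rewrite !E; clear E] end.
Local Ltac pair2 := rewrite pairing2E; repeat crunch; (do ! step); gather; congr (_ *: _); rewrite ?intrD1; ring.

(** As rho is - epsilon_1 + epsilon_2 + epsilon_3, the scalars p, q, r are -2, 2 and 2 times (lambda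
    + rho, epsilon_i) for i = 1, 2, 3; in these coordinates [typ] factors. The scalar a i is the
    h2-weight of [b i j], and c j is al times its h3-weight. *)
Local Notation p := ((1 + al) * (m1 - 1)).
Local Notation q := (m2 + 1).
Local Notation r := (al * (m3 + 1)).
Local Notation a i := (m2 - 2 * i%:~R).
Local Notation c j := (al * (m3 - 2 * j%:~R)).
Definition coef1011 (i j : int) : K := 4 * (i%:~R + 1) * (a i + c j - p + al - 1).
Definition coef0111 (i j : int) : K := 4 * al * (j%:~R + 1) * (a i + c j - p - al + 1).
Definition coef0010 (i j : int) : K := 2 * al * (m3 - j%:~R + 1)
  * (p ^+ 2 - 2 * p * a i + q ^+ 2 - r ^+ 2 - 2 * (a i + c j + 1 + 3 * al)).
Definition coef0001 (i j : int) : K := - 2 * (m2 - i%:~R + 1)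
  * (p ^+ 2 - 2 * p * (c j + 1 + al) - q ^+ 2 + r ^+ 2 + 2 * (a i + c j + 3 + al)).
Definition coef0011 (i j : int) : K := 2 * ((a i + c j) ^+ 2 - (1 + al) ^+ 2 + p ^+ 2 * al
  + (1 + al) * (q ^+ 2 - 2 * p * a i - r ^+ 2)).
Definition coef0110 (i j : int) : K := p ^+ 3 - p ^+ 2 * (1 + al + a i + c j)
  + 2 * p * (a i * (2 + al + c j) - al - c j) + r ^+ 2 * (1 + al + c j - a i - p)
  - q ^+ 2 * (1 + al + c j - a i + p) + 2 * ((1 + al + c j) ^+ 2 - a i ^+ 2).
Definition coefF (i j : int) : K := p ^+ 2 - 2 * p * a i + q ^+ 2 - r ^+ 2 - 2 * (a i + c j + 1 + al).

Lemma pairing2_1011 i j : pairing2 (y10 (y11 (b i j))) = coef1011 i j *: b (i + 1) j.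
Proof. rewrite /coef1011; pair2. Qed.
Lemma pairing2_0111 i j : pairing2 (y01 (y11 (b i j))) = coef0111 i j *: b i (j + 1).
Proof. rewrite /coef0111; pair2. Qed.
Lemma pairing2_0010 i j : pairing2 (y00 (y10 (b i j))) = coef0010 i j *: b i (j - 1).
Proof. rewrite /coef0010; pair2. Qed.
Lemma pairing2_0001 i j : pairing2 (y00 (y01 (b i j))) = coef0001 i j *: b (i - 1) j.
Proof. rewrite /coef0001; pair2. Qed.
Lemma pairing2_0011 i j : pairing2 (y00 (y11 (b i j))) = coef0011 i j *: b i j.
Proof. rewrite /coef0011; pair2. Qed.
Lemma pairing2_0110 i j : pairing2 (y01 (y10 (b i j))) = coef0110 i j *: b i j.
Proof. rewrite /coef0110; pair2. Qed.
Lemma pairing2_F i j : pairing2 (F (b i j)) = coefF i j *: b i j.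
Proof. rewrite /coefF; pair2. Qed.

Lemma y_sq c d x : y c d (y c d x) = 0.
Proof.
have om0 k : om k k = 0 by rewrite /om andNb andbN subrr.
have /eqP := yy c d c d x; rewrite !om0 !mulr0 scale0r sub0r -addr_eq0.
by rewrite -mulr2n -scaler_nat scaler_eq0 (negPf two_neq0) => /eqP.
Qed.

Lemma yyE x :
  (y01 (y00 x) = - y00 (y01 x)) * (y10 (y00 x) = - y00 (y10 x)) *
  (y11 (y01 x) = - y01 (y11 x)) * (y11 (y10 x) = - y10 (y11 x)) *
  (y11 (y00 x) = (2 * (1 + al)) *: F x - y00 (y11 x)) *
  (y10 (y01 x) = (- (2 * (1 + al))) *: F x - y01 (y10 x)).
Proof.
by do ![split]; rewrite yy /om /= ?mulr0n ?mulr1n ?(subr0, sub0r, mulr0, mul0r, mulr1, mul1r, mulrN, mulNr, opprK, scale0r, oppr0, scaleNr).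
Qed.

(** The h2- and h3-weights of y00 y01 y10 are (1, 1), those of z11 are (-1, -1), and [pairing2] has
    weight 0. So this monomial on [b i j] returns to a multiple of [b i j], while the three others
    would land on shifted indices. *)
Definition pairing3 : 'End(V) := (pairing2 \o (z11 \o esing))%VF.

Lemma pairing3E u : pairing3 u = pairing2 (z11 (esing u)).
Proof. by do ![rewrite lfunE /=]. Qed.

Local Ltac expand t := let E := fresh in
  eassert (E : t = _); [do ! step; reflexivity | rewrite !E; clear E].
Local Ltac pair3 := rewrite pairing3E esingE;
  match goal with |- context [fun_of_lfun E ?u] => expand (E u) end;
  rewrite ?(lfunD, lfunZ, lfunN);
  repeat match goal with |- context [fun_of_lfun (z true true) ?u] => expand (z11 u); rewrite ?(y_sq, yyE) end;
  rewrite ?(lfun0, scaler0, oppr0, addr0, add0r, subr0, sub0r);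
  rewrite ?(lfunD, lfunZ, lfunN, pairing2_1011, pairing2_0111, pairing2_0010, pairing2_0001, pairing2_0011, pairing2_0110, pairing2_F); gather;
  rewrite /coef1011 /coef0111 /coef0010 /coef0001 /coef0011 /coef0110 /coefF.

(* This is 16 times the product of the (lambda + rho, beta), beta an odd positive root. *)
Definition typ : K :=
  let p := (1 + al) * (m1 - 1) in let q := m2 + 1 in let r := al * (m3 + 1) in
  (p + q + r) * (p + q - r) * (p - q + r) * (p - q - r).

Lemma pairing3_F c d i j : pairing3 (F (y c d (b i j))) = 0.
Proof.
rewrite pairing3E esingE EF Ey zb addr0 Eb lfun0 lfun0 add0r Hy Hb lfunZ.
by rewrite -[X in _ *: _ - F (_ - X)]scale1r -scalerBl lfunZ subrr !lfun0.
Qed.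

Lemma pairing3_000110 i j : pairing3 (y00 (y01 (y10 (b i j)))) = ((m1 - 2) * typ) *: b i j.
Proof.
pair3.
by congr (_ *: _); rewrite ?intrD1 /typ; ring.
Qed.
Lemma pairing3_000111 i j : pairing3 (y00 (y01 (y11 (b i j)))) = 0.
Proof.
pair3.
rewrite -[RHS](scale0r (b i (j+1))).
by congr (_ *: _); rewrite ?intrD1; ring.
Qed.
Lemma pairing3_001011 i j : pairing3 (y00 (y10 (y11 (b i j)))) = 0.
Proof.
pair3.
rewrite -[RHS](scale0r (b (i+1) j)).
by congr (_ *: _); rewrite ?intrD1; ring.
Qed.
Lemma pairing3_011011 i j : pairing3 (y01 (y10 (y11 (b i j)))) = 0.
Proof.
pair3.
rewrite -[RHS](scale0r (b (i+1) (j+1))).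
by congr (_ *: _); rewrite ?intrD1; ring.
Qed.

Lemma core_top_pairing : exists P : 'End(V), forall i j,
  [/\ P (y00 (y01 (y10 (b i j)))) = ((m1 - 2) * typ) *: b i j,
      P (y00 (y01 (y11 (b i j)))) = 0, P (y00 (y10 (y11 (b i j)))) = 0,
      P (y01 (y10 (y11 (b i j)))) = 0 & forall k l, P (F (y k l (b i j))) = 0].
Proof.
exists pairing3 => i j; split; first exact: pairing3_000110.
- exact: pairing3_000111.
- exact: pairing3_001011.
- exact: pairing3_011011.
- by move=> k l; exact: pairing3_F.
Qed.
End TopPairing.

(** * Representations of sl_2 *)

Section Eigenvectors.
Variables (K : fieldType) (V : vectType K) (h : 'End(V)).

(** Applying h - mu k to the relation removes the k-th term and multiplies each other term by the
    nonzero scalar mu i - mu k. *)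
Lemma eigen_sum_eq0 (I : eqType) (r : seq I) (w : I -> V) (mu : I -> K) :
  uniq r -> {in r &, injective mu} -> (forall i, h (w i) = mu i *: w i) ->
  \sum_(i <- r) w i = 0 -> {in r, forall i, w i = 0}.
Proof.
elim: r w => [//|k r IH] w /= /andP[kr ur] mu_inj hw.
rewrite big_cons => w0.
have rw0 : {in r, forall i, w i = 0}.
  have mu_neq i : i \in r -> mu i - mu k != 0.
    move=> ir; rewrite subr_eq0; apply/eqP => /mu_inj ik.
    by move: kr; rewrite -ik ?ir// inE ?eqxx ?ir ?orbT.
  move=> i ir; apply/eqP.
  have /(_ i ir)/eqP : {in r, forall i, (mu i - mu k) *: w i = 0}.
    apply: IH => // [x z xr zr|x|]; first by apply: mu_inj; rewrite inE ?xr ?zr orbT.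
      by rewrite linearZ /= hw !scalerA mulrC.
    have : h (w k + \sum_(j <- r) w j) - mu k *: (w k + \sum_(j <- r) w j) = 0.
      by rewrite w0 linear0 scaler0 subr0.
    rewrite linearD /= hw scalerDr opprD addrACA subrr add0r linear_sum scaler_sumr.
    by rewrite -sumrB => {2}<-; apply: eq_bigr => j _ /=; rewrite hw scalerBl.
  by rewrite scaler_eq0 (negPf (mu_neq i ir)).
move=> i; rewrite inE => /predU1P[->|/rw0//].
by move: w0; rewrite big_seq big1 ?addr0// => j /rw0.
Qed.

Lemma eigen_sum_part (I : eqType) (r : seq I) (w : I -> V) (mu : I -> K) :
  {in r, forall i, h (w i) = mu i *: w i} -> \sum_(i <- r) w i = 0 ->
  forall a, \sum_(i <- r | mu i == a) w i = 0.
Proof.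
move=> hw w0 a; have [ar|ar] := boolP (a \in undup (map mu r)); last first.
  rewrite big_seq_cond big1// => i /andP[ir /eqP mua].
  by case/negP: ar; rewrite mem_undup -mua map_f.
apply: (eigen_sum_eq0 (r := undup (map mu r)) (mu := id)
  (w := fun a => \sum_(i <- r | mu i == a) w i)) => //.
- exact: undup_uniq.
- move=> c; rewrite linear_sum scaler_sumr big_seq_cond [RHS]big_seq_cond.
  by apply: eq_bigr => i /andP[ir /eqP <-] /=; rewrite hw.
rewrite (exchange_big_dep predT) //= -[RHS]w0 big_seq [RHS]big_seq; apply: eq_bigr => i ir.
under eq_bigl => c do rewrite eq_sym.
by rewrite -big_filter filter_pred1_uniq ?undup_uniq ?mem_undup ?map_f// big_seq1.
Qed.

(** Otherwise dim V + 1 of the vectors would form a free family. This is how finite dimension makes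
    e and f nilpotent on weight vectors. *)
Lemma eigen_chain_eq0 (u : nat -> V) (mu : nat -> K) :
  injective mu -> (forall n, h (u n) = mu n *: u n) -> exists n, u n = 0.
Proof.
move=> mu_inj hu; pose N := (\dim {:V}).+1.
have [/existsP[i /eqP ui0]|/existsPn u_neq0] := boolP [exists i : 'I_N, u i == 0].
  by exists i.
have /eqP freeX : free [tuple u i | i < N].
  apply/freeP => k k0 i; apply/eqP.
  have : k i *: u i = 0.
    apply: (@eigen_sum_eq0 _ (enum 'I_N) (fun i => k i *: u i) (mu \o val)).
    - exact: enum_uniq.
    - by move=> x z _ _ /mu_inj /val_inj.
    - by move=> j; rewrite linearZ /= hu !scalerA mulrC.
    - rewrite big_enum -[RHS]k0; apply: eq_bigr => j _.
      by rewrite (nth_map j) ?size_enum_ord// nth_ord_enum.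
    - by rewrite mem_enum.
  by move/eqP; rewrite scaler_eq0 (negPf (u_neq0 i)) orbF.
have := dimvS (subvf <<[tuple u i | i < N]>>).
by rewrite freeX size_tuple ltnn.
Qed.
End Eigenvectors.

Section Sl2.
Variables (K : fieldType) (V : vectType K) (e f h : 'End(V)).
Hypothesis K_char0 : [pchar K] =i pred0.
Hypothesis ef : forall x, e (f x) = f (e x) + h x.
Hypothesis he : forall x, h (e x) = e (h x) + 2 *: e x.
Hypothesis hf : forall x, h (f x) = f (h x) - 2 *: f x.

Let natr0E n : ((n%:R : K) == 0) = (n == 0%N).
Proof. by move/pcharf0P: K_char0 => ->. Qed.

Lemma natr_neq0 n : (n.+1%:R : K) != 0.
Proof. by rewrite natr0E. Qed.

Lemma natr_inj : injective (fun n => n%:R : K).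
Proof.
suff h' m n : (m <= n)%N -> (m%:R : K) = n%:R -> m = n.
  by move=> m n mn; have [/h'->//|/ltnW/h' <-] := leqP m n.
move=> mn /eqP; rewrite eq_sym -subr_eq0 -natrB// natr0E subn_eq0 => nm.
by apply/eqP; rewrite eqn_leq mn.
Qed.

Lemma weight_iter_f c x n : h x = c *: x -> h (iter n f x) = (c - 2 * n%:R) *: iter n f x.
Proof.
move=> hx; elim: n => [|n IH] /=; first by rewrite mulr0 subr0.
by rewrite hf IH linearZ /= -scalerBl -addrA -opprD -natr1; congr (_ *: _); ring.
Qed.

Lemma weight_iter_e c x n : h x = c *: x -> h (iter n e x) = (c + 2 * n%:R) *: iter n e x.
Proof.
move=> hx; elim: n => [|n IH] /=; first by rewrite mulr0 addr0.
by rewrite he IH linearZ /= -scalerDl -addrA -natr1; congr (_ *: _); ring.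
Qed.

Lemma iter_f_nilp c x : h x = c *: x -> exists n, iter n f x = 0.
Proof.
move=> hx; apply: (@eigen_chain_eq0 _ _ h (fun n => iter n f x) (fun n => c - 2 * n%:R)).
  by move=> m n /addrI /oppr_inj /(mulfI (natr_neq0 1)) /natr_inj.
by move=> n; apply: weight_iter_f.
Qed.

Lemma iter_e_nilp c x : h x = c *: x -> exists n, iter n e x = 0.
Proof.
move=> hx; apply: (@eigen_chain_eq0 _ _ h (fun n => iter n e x) (fun n => c + 2 * n%:R)).
  by move=> m n /addrI /(mulfI (natr_neq0 1)) /natr_inj.
by move=> n; apply: weight_iter_e.
Qed.

Lemma e_iter_f c x n : h x = c *: x ->
  e (iter n.+1 f x) = iter n.+1 f (e x) + (n.+1%:R * (c - n%:R)) *: iter n f x.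
Proof.
move=> hx; elim: n => [|n IH]; first by rewrite /= ef hx subr0 mul1r.
rewrite iterS ef IH linearD linearZ /= (weight_iter_f n.+1 hx) -addrA -scalerDl.
by congr (_ + _ *: _); rewrite -!natr1; ring.
Qed.

Lemma iter_f0 n : iter n f 0 = 0.
Proof. by elim: n => //= n ->; rewrite linear0. Qed.

(** The vector w = f^(m+1) x is again killed by e, and has weight - m - 2. Some power of f kills w,
    and applying e to f^(n+1) w = 0 gives back f^n w with the coefficient - (n + 1) (m + n + 2),
    which never vanishes, so the power can be lowered to 0. *)
Lemma iter_f_top m x : e x = 0 -> h x = m%:R *: x -> iter m.+1 f x = 0.
Proof.
move=> ex hx; set w := iter m.+1 f x.
have ew : e w = 0 by rewrite (e_iter_f _ hx) ex iter_f0 subrr mulr0 scale0r addr0.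
have hw : h w = (m%:R - 2 * m.+1%:R) *: w by exact: weight_iter_f.
have [n] := iter_f_nilp hw; elim: n => [//|n IH] /(congr1 e).
rewrite (e_iter_f _ hw) ew iter_f0 linear0 add0r => /eqP.
rewrite scaler_eq0 => /orP[|/eqP//]; rewrite mulf_eq0 (negPf (natr_neq0 n)) /=.
rewrite [X in X == 0](_ : _ = - (m + n.+2)%:R); last by rewrite natrD -!natr1; ring.
by rewrite oppr_eq0 natr0E addnS.
Qed.

(* For [f^c x = 0] and [x] of weight [c], also [f^(c+2) (e x) = 0]; as [e x] has weight
   [c + 2], one can induct on the nilpotency index of [e]. *)
Lemma iter_f_inj c x : h x = c%:R *: x -> iter c f x = 0 -> x = 0.
Proof.
move=> hx; have [n] := iter_e_nilp hx.
elim: n c x hx => [//|n IH] c x hx enx fx.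
have ex : e x = 0.
  apply: (IH c.+2); [|by rewrite -iterSr|].
    by rewrite he hx linearZ /= -scalerDl; congr (_ *: _); rewrite -!natr1; ring.
  have fx1 : iter c.+1 f x = 0 by rewrite iterS fx linear0.
  have fx2 : iter c.+2 f x = 0 by rewrite iterS fx1 linear0.
  by have := e_iter_f c.+1 hx; rewrite fx2 fx1 linear0 scaler0 addr0.
suff fk_inj k : (k <= c)%N -> iter k f x = 0 -> x = 0 by exact: fk_inj fx.
elim: k => [//|k IHk] kc /(congr1 e).
rewrite (e_iter_f k hx) ex iter_f0 add0r linear0 => /eqP.
rewrite scaler_eq0 mulf_eq0 (negPf (natr_neq0 k)) /= subr_eq0.
move=> /orP[/eqP/natr_inj ck|/eqP]; first by rewrite ck ltnn in kc.
by apply: IHk; exact: ltnW.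
Qed.

Lemma iter_f_inj_le c n x : (n <= c)%N -> h x = c%:R *: x -> iter n f x = 0 -> x = 0.
Proof.
move=> nc hx fx; apply: (iter_f_inj hx).
by rewrite -(subnK nc) iterD fx iter_f0.
Qed.
End Sl2.

Section LspanTheory.
Variables (K : fieldType) (M : lmodType K).
Implicit Types A B : M -> Prop.

Lemma lspan_gen A x : A x -> x \in lspan A.
Proof.
move=> Ax; apply/asboolP; exists 1%N, (fun=> 1), (fun=> x); split=> //.
by rewrite big_ord1 scale1r.
Qed.

Lemma lspan_sub (N : submodClosed M) (g : {linear M -> M}) A :
  (forall x, A x -> g x \in N) -> {in lspan A, forall x, g x \in N}.
Proof.
move=> AN x /asboolP[n [c [u [uA ->]]]]; rewrite linear_sum rpred_sum// => i _.
by rewrite linearZ rpredZ//= AN.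
Qed.

Lemma lspan_le (N : submodClosed M) A : (forall x, A x -> x \in N) -> {subset lspan A <= N}.
Proof. exact: (@lspan_sub N idfun). Qed.
End LspanTheory.

(** * Linear independence *)

(* o a b c is a root vector for (-1)^a epsilon_1 + (-1)^b epsilon_2 + (-1)^c epsilon_3. *)
Record d21_rep (K : fieldType) (al : K) (V : vectType K)
    (e f h : 'I_3 -> 'End(V)) (o : bool -> bool -> bool -> 'End(V)) : Prop := D21Rep {
  rep_ef : forall i j x, e i (f j x) = f j (e i x) + (i == j)%:R *: h i x;
  rep_he : forall i j x, h i (e j x) = e j (h i x) + (2 * (i == j)%:R) *: e j x;
  rep_hf : forall i j x, h i (f j x) = f j (h i x) - (2 * (i == j)%:R) *: f j x;
  rep_ff : forall i j x, f i (f j x) = f j (f i x);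
  rep_eo0 : forall a b c x, e 0 (o a b c x) = o a b c (e 0 x) + a%:R *: o false b c x;
  rep_eo1 : forall a b c x, e 1 (o a b c x) = o a b c (e 1 x) + b%:R *: o a false c x;
  rep_eo2 : forall a b c x, e 2%:R (o a b c x) = o a b c (e 2%:R x) + c%:R *: o a b false x;
  rep_fo0 : forall a b c x, f 0 (o a b c x) = o a b c (f 0 x) + (~~ a)%:R *: o true b c x;
  rep_fo1 : forall a b c x, f 1 (o a b c x) = o a b c (f 1 x) + (~~ b)%:R *: o a true c x;
  rep_fo2 : forall a b c x, f 2%:R (o a b c x) = o a b c (f 2%:R x) + (~~ c)%:R *: o a b true x;
  rep_ho0 : forall a b c x, h 0 (o a b c x) = o a b c (h 0 x) + (-1) ^+ a *: o a b c x;
  rep_ho1 : forall a b c x, h 1 (o a b c x) = o a b c (h 1 x) + (-1) ^+ b *: o a b c x;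
  rep_ho2 : forall a b c x, h 2%:R (o a b c x) = o a b c (h 2%:R x) + (-1) ^+ c *: o a b c x;
  rep_oo : forall a b c a' b' c' x, o a b c (o a' b' c' x) =
    (- (1 + al) * (om K b b' * om K c c')) *: sl2_vec (e 0) (f 0) (h 0) a a' x
    + (om K a a' * om K c c') *: sl2_vec (e 1) (f 1) (h 1) b b' x
    + (al * (om K a a' * om K b b')) *: sl2_vec (e 2%:R) (f 2%:R) (h 2%:R) c c' x
    - o a' b' c' (o a b c x)
}.

Section HighestWeight.
Variables (K : fieldType) (al : K) (V : vectType K).
Variables (e f h : 'I_3 -> 'End(V)) (o : bool -> bool -> bool -> 'End(V)) (v : V).
Variables (m : 'I_3 -> nat).
Hypothesis K_char0 : [pchar K] =i pred0.
Hypothesis rep : d21_rep al e f h o.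
Hypothesis v_neq0 : v <> 0.
Hypothesis ev : forall i, e i v = 0.
Hypothesis zv : forall b c, o false b c v = 0.
Hypothesis hv : forall i, h i v = (m i)%:R *: v.

Local Notation F := (f 0).
Local Notation E := (e 0).
Local Notation H := (h 0).
Local Notation y := (o true).
Local Notation z := (o false).
Local Notation y00 := (o true false false).
Local Notation y01 := (o true false true).
Local Notation y10 := (o true true false).
Local Notation y11 := (o true true true).

Let natr0E n : ((n%:R : K) == 0) = (n == 0%N).
Proof. by move/pcharf0P: K_char0 => ->. Qed.

Let neq : ((0 == 1 :> 'I_3) = false) * ((1 == 0 :> 'I_3) = false) * ((0 == 2%:R :> 'I_3) = false) *
  ((2%:R == 0 :> 'I_3) = false) * ((1 == 2%:R :> 'I_3) = false) * ((2%:R == 1 :> 'I_3) = false).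
Proof. by []. Qed.

Lemma ef_same i x : e i (f i x) = f i (e i x) + h i x.
Proof. by rewrite (rep_ef rep) eqxx scale1r. Qed.
Lemma he_same i x : h i (e i x) = e i (h i x) + 2 *: e i x.
Proof. by rewrite (rep_he rep) eqxx mulr1. Qed.
Lemma hf_same i x : h i (f i x) = f i (h i x) - 2 *: f i x.
Proof. by rewrite (rep_hf rep) eqxx mulr1. Qed.
Lemma ef_diff i j x : (i == j) = false -> e i (f j x) = f j (e i x).
Proof. by move=> ij; rewrite (rep_ef rep) ij scale0r addr0. Qed.
Lemma hf_diff i j x : (i == j) = false -> h i (f j x) = f j (h i x).
Proof. by move=> ij; rewrite (rep_hf rep) ij mulr0 scale0r subr0. Qed.

Lemma sl2_commute_iter (g k : 'End(V)) n x : (forall x, g (k x) = k (g x)) ->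
  g (iter n k x) = iter n k (g x).
Proof. by move=> gk; elim: n => //= n IH; rewrite gk IH. Qed.

Definition fvec (i j : nat) : V := iter i (f 1) (iter j (f 2%:R) v).

(** With the factorials divided out, f multiplies by i + 1 and e by m - i + 1. The first factor
    vanishes at i = -1, where f would otherwise leave the zero region, so the formulas hold for all
    integers. *)
Definition bvec (i j : int) : V :=
  if (i, j) is (Posz i', Posz j') then (i'`!%:R * j'`!%:R)^-1 *: fvec i' j' else 0.

Lemma fact_neq0 n : (n`!%:R : K) != 0.
Proof. by rewrite natr0E -lt0n fact_gt0. Qed.

Lemma fvec_e0 i j : E (fvec i j) = 0.
Proof.
rewrite /fvec !sl2_commute_iter ?ev => [|x|x]; last 2 first.
- by rewrite ef_diff// neq.
- by rewrite ef_diff// neq.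
by rewrite !iter_f0.
Qed.

Lemma fvec_h0 i j : H (fvec i j) = (m 0)%:R *: fvec i j.
Proof.
rewrite /fvec !sl2_commute_iter ?hv => [|x|x]; last 2 first.
- by rewrite hf_diff// neq.
- by rewrite hf_diff// neq.
elim: i => [|i IH] /=; last by rewrite IH linearZ.
by elim: j => [//|j IH] /=; rewrite IH linearZ.
Qed.

Lemma fvec_z b c i j : z b c (fvec i j) = 0.
Proof.
have zf1 b' c' x : z b' c' (f 1 x) = f 1 (z b' c' x) - (~~ b')%:R *: z true c' x.
  by rewrite (rep_fo1 rep) addrK.
have zf2 b' c' x : z b' c' (f 2%:R x) = f 2%:R (z b' c' x) - (~~ c')%:R *: z b' true x.
  by rewrite (rep_fo2 rep) addrK.
rewrite /fvec; elim: i b c => [|i IH] b c /=; last by rewrite zf1 !IH linear0 scaler0 subrr.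
by elim: j b c => [|j IH] b c /=; rewrite ?zv// zf2 !IH linear0 scaler0 subrr.
Qed.

Lemma fvec_h1 i j : h 1 (fvec i j) = ((m 1)%:R - 2 * i%:R) *: fvec i j.
Proof.
apply: (weight_iter_f (f := f 1)) => [x|]; first exact: hf_same.
rewrite sl2_commute_iter ?hv => [|x]; last by rewrite hf_diff// neq.
by elim: j => [//|j IH] /=; rewrite IH linearZ.
Qed.

Lemma fvec_h2 i j : h 2%:R (fvec i j) = ((m 2%:R)%:R - 2 * j%:R) *: fvec i j.
Proof.
rewrite /fvec sl2_commute_iter => [|x]; last by rewrite hf_diff// neq.
rewrite (weight_iter_f (@hf_same 2%:R) j (hv 2%:R)).
by elim: i => [//|i IH] /=; rewrite IH linearZ.
Qed.

Lemma fvecS1 i j : f 1 (fvec i j) = fvec i.+1 j. Proof. by []. Qed.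
Lemma fvecS2 i j : f 2%:R (fvec i j) = fvec i j.+1.
Proof.
by rewrite /fvec sl2_commute_iter// => x; rewrite (rep_ff rep).
Qed.

Lemma fvec_e1S i j : e 1 (fvec i.+1 j) = (i.+1%:R * ((m 1)%:R - i%:R)) *: fvec i j.
Proof.
have hj : h 1 (iter j (f 2%:R) v) = (m 1)%:R *: iter j (f 2%:R) v by rewrite (fvec_h1 0 j) mulr0 subr0.
rewrite /fvec (e_iter_f (h := h 1) (@ef_same 1) (@hf_same 1) _ hj).
rewrite sl2_commute_iter ?ev ?iter_f0 ?add0r// => x.
by rewrite ef_diff// neq.
Qed.

Lemma fvec_e1 j : e 1 (fvec 0 j) = 0.
Proof.
rewrite /fvec/= sl2_commute_iter ?ev ?iter_f0// => x.
by rewrite ef_diff// neq.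
Qed.

Lemma fvec_e2S i j : e 2%:R (fvec i j.+1) = (j.+1%:R * ((m 2%:R)%:R - j%:R)) *: fvec i j.
Proof.
rewrite /fvec sl2_commute_iter => [|x]; last by rewrite ef_diff// neq.
rewrite (e_iter_f (h := h 2%:R) (@ef_same 2%:R) (@hf_same 2%:R) _ (hv _)) ev iter_f0 add0r.
by elim: i => [//|i IH] /=; rewrite IH linearZ.
Qed.

Lemma fvec_e2 i : e 2%:R (fvec i 0) = 0.
Proof.
rewrite /fvec/= sl2_commute_iter ?ev ?iter_f0// => x.
by rewrite ef_diff// neq.
Qed.

Lemma fvec_top1 i j : (m 1%R < i)%N -> fvec i j = 0.
Proof.
move=> mi; have := iter_f_top K_char0 (@ef_same 1) (@hf_same 1) (fvec_e1 j).
rewrite fvec_h1 mulr0 subr0 => /(_ (m 1) erefl) f0.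
by rewrite /fvec -(subnK mi) iterD f0 iter_f0.
Qed.

Lemma fvec_top2 i j : (m 2%:R%R < j)%N -> fvec i j = 0.
Proof.
move=> mj; have := iter_f_top K_char0 (@ef_same 2%:R) (@hf_same 2%:R) (ev 2%:R) (hv 2%:R) => f0.
by rewrite /fvec -(subnK mj) iterD f0 !iter_f0.
Qed.

Lemma fvec_neq0 i j : (i <= m 1%R)%N -> (j <= m 2%:R%R)%N -> fvec i j != 0.
Proof.
move=> im jm; apply/eqP => fij0; apply: v_neq0.
have hj : h 1 (iter j (f 2%:R) v) = (m 1)%:R *: iter j (f 2%:R) v by rewrite (fvec_h1 0 j) mulr0 subr0.
have := iter_f_inj_le K_char0 (@ef_same 1) (@he_same 1) (@hf_same 1) im hj fij0.
exact: (iter_f_inj_le K_char0 (@ef_same 2%:R) (@he_same 2%:R) (@hf_same 2%:R) jm (hv _)).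
Qed.

Ltac bcases := case=> [i|i] [j|j]; rewrite /bvec ?linear0 ?scaler0//.

Lemma bvec_E i j : E (bvec i j) = 0.
Proof. by move: i j; bcases; rewrite linearZ /= fvec_e0 scaler0. Qed.
Lemma bvec_z b c i j : z b c (bvec i j) = 0.
Proof. by move: i j; bcases; rewrite linearZ /= fvec_z scaler0. Qed.
Lemma bvec_H i j : H (bvec i j) = (m 0)%:R *: bvec i j.
Proof. by move: i j; bcases; rewrite linearZ /= fvec_h0 !scalerA mulrC. Qed.
Lemma bvec_h1 i j : h 1 (bvec i j) = ((m 1)%:R - 2 * i%:~R) *: bvec i j.
Proof. by move: i j; bcases; rewrite linearZ /= fvec_h1 !scalerA mulrC. Qed.
Lemma bvec_h2 i j : h 2%:R (bvec i j) = ((m 2%:R)%:R - 2 * j%:~R) *: bvec i j.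
Proof. by move: i j; bcases; rewrite linearZ /= fvec_h2 !scalerA mulrC. Qed.

Lemma NegzD1 n : (Negz n + 1 = if n is n'.+1 then Negz n' else 0) * (Negz n - 1 = Negz n.+1).
Proof. by split; case: n => [|n]; lia. Qed.

Lemma PoszD1 n : (Posz n + 1 = Posz n.+1) * (Posz n.+1 - 1 = Posz n) * (Posz 0 - 1 = Negz 0).
Proof. by do ![split]; lia. Qed.

Lemma bvec_Negz1 n j : bvec (Negz n) j = 0. Proof. by []. Qed.
Lemma bvec_Negz2 i n : bvec i (Negz n) = 0. Proof. by case: i. Qed.
Let bvec_out := (bvec_Negz1, bvec_Negz2).

Lemma bvecP i j : bvec (Posz i) (Posz j) = (i`!%:R * j`!%:R)^-1 *: fvec i j.
Proof. by []. Qed.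

Lemma bvec_f1 i j : f 1 (bvec i j) = (i%:~R + 1) *: bvec (i + 1) j.
Proof.
case: j => j; last by rewrite !bvec_out linear0 scaler0.
case: i => [i|[|i]]; rewrite ?(PoszD1, NegzD1) ?bvec_out ?linear0 ?scaler0//; last first.
  by rewrite (_ : (Negz 0)%:~R = -1 :> K)// addNr scale0r.
rewrite !bvecP linearZ /= fvecS1 scalerA factS natrM; congr (_ *: _).
have nz : (i.+1%:R : K) != 0 by rewrite natr0E.
rewrite -[i%:~R]/(i%:R : K) natr1.
by move: i.+1%:R nz => N nz; field; rewrite nz !fact_neq0.
Qed.

Lemma bvec_f2 i j : f 2%:R (bvec i j) = (j%:~R + 1) *: bvec i (j + 1).
Proof.
case: i => i; last by rewrite !bvec_out linear0 scaler0.
case: j => [j|[|j]]; rewrite ?(PoszD1, NegzD1) ?bvec_out ?linear0 ?scaler0//; last first.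
  by rewrite (_ : (Negz 0)%:~R = -1 :> K)// addNr scale0r.
rewrite !bvecP linearZ /= fvecS2 scalerA factS natrM; congr (_ *: _).
have nz : (j.+1%:R : K) != 0 by rewrite natr0E.
rewrite -[j%:~R]/(j%:R : K) natr1.
by move: j.+1%:R nz => N nz; field; rewrite nz !fact_neq0.
Qed.

Lemma bvec_e1 i j : e 1 (bvec i j) = ((m 1)%:R - i%:~R + 1) *: bvec (i - 1) j.
Proof.
case: j => j; last by rewrite !bvec_out linear0 scaler0.
case: i => [[|i]|i]; rewrite ?(PoszD1, NegzD1) ?bvec_out ?linear0 ?scaler0//.
  by rewrite bvecP linearZ /= fvec_e1 scaler0.
rewrite !bvecP linearZ /= fvec_e1S !scalerA factS natrM; congr (_ *: _).
have nz : (i.+1%:R : K) != 0 by rewrite natr0E.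
rewrite -[i.+1%:~R]/(i.+1%:R : K) -[i%:R](addrK 1) natr1.
by move: i.+1%:R nz => N nz; field; rewrite nz !fact_neq0.
Qed.

Lemma bvec_e2 i j : e 2%:R (bvec i j) = ((m 2%:R)%:R - j%:~R + 1) *: bvec i (j - 1).
Proof.
case: i => i; last by rewrite !bvec_out linear0 scaler0.
case: j => [[|j]|j]; rewrite ?(PoszD1, NegzD1) ?bvec_out ?linear0 ?scaler0//.
  by rewrite bvecP linearZ /= fvec_e2 scaler0.
rewrite !bvecP linearZ /= fvec_e2S !scalerA factS natrM; congr (_ *: _).
have nz : (j.+1%:R : K) != 0 by rewrite natr0E.
rewrite -[j.+1%:~R]/(j.+1%:R : K) -[j%:R](addrK 1) natr1.
by move: j.+1%:R nz => N nz; field; rewrite nz !fact_neq0.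
Qed.

Definition Lsp : {pred V} := lspan (fun u => exists i j : int, u = bvec i j).

Lemma mem_Lsp i j : bvec i j \in Lsp.
Proof. by apply: lspan_gen; exists i, j. Qed.

Lemma Lsp_eq (g k : 'End(V)) : (forall i j, g (bvec i j) = k (bvec i j)) -> {in Lsp, g =1 k}.
Proof.
move=> gk x /asboolP[n [c [u [ub ->]]]]; rewrite !linear_sum; apply: eq_bigr => i _.
by rewrite !linearZ /=; have [i' [j ->]] := ub i; rewrite gk.
Qed.

Lemma Lsp_stable (g : 'End(V)) : (forall i j, g (bvec i j) \in Lsp) -> {in Lsp, forall x, g x \in Lsp}.
Proof. by move=> gb; apply: (@lspan_sub _ _ (lspan _) g) => _ [i [j ->]]; exact: gb. Qed.

Lemma Lsp_e1 : {in Lsp, forall x, e 1 x \in Lsp}.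
Proof. by apply: Lsp_stable => i j; rewrite bvec_e1 rpredZ// mem_Lsp. Qed.
Lemma Lsp_e2 : {in Lsp, forall x, e 2%:R x \in Lsp}.
Proof. by apply: Lsp_stable => i j; rewrite bvec_e2 rpredZ// mem_Lsp. Qed.

Lemma Lsp_H x : x \in Lsp -> H x = (m 0)%:R *: x.
Proof.
move=> xL; rewrite (@Lsp_eq H ((m 0)%:R *: \1%VF) _ x xL); first by rewrite !lfunE /= id_lfunE.
by move=> i j; rewrite bvec_H !lfunE /= id_lfunE.
Qed.

Lemma zyE_rep c d c' d' x : z c d (y c' d' x) =
  ((1 + al) * (om K c c' * om K d d')) *: H x
  + om K d d' *: sl2_vec (e 1) (f 1) (h 1) c c' x
  + (al * om K c c') *: sl2_vec (e 2%:R) (f 2%:R) (h 2%:R) d d' x - y c' d' (z c d x).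
Proof.
rewrite (rep_oo rep) /= {1}/sl2_vec /= opp_lfunE scalerN mulNr scaleNr opprK.
by rewrite (_ : om K false true = 1) ?mul1r// /om subr0.
Qed.

Lemma yyE_rep c d c' d' x : y c d (y c' d' x) =
  (2 * (1 + al) * (om K c c' * om K d d')) *: F x - y c' d' (y c d x).
Proof.
rewrite (rep_oo rep) /= {1}/sl2_vec /= (_ : om K true true = 0); last by rewrite /om subrr.
rewrite !(mul0r, mulr0) !scale0r !addr0 lfunE /= scalerA; congr (_ *: _ - _); ring.
Qed.

Lemma zF_rep c d x : z c d (F x) = F (z c d x) - y c d x.
Proof. by rewrite (rep_fo0 rep) scale1r addrK. Qed.
Lemma Ey_rep c d x : E (y c d x) = y c d (E x) + z c d x.
Proof. by rewrite (rep_eo0 rep) scale1r. Qed.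
Lemma Fy_rep c d x : F (y c d x) = y c d (F x).
Proof. by rewrite (rep_fo0 rep) scale0r addr0. Qed.
Lemma Hy_rep c d x : H (y c d x) = y c d (H x) - y c d x.
Proof. by rewrite (rep_ho0 rep) expr1 scaleN1r. Qed.

Lemma two_neq0_K : 2 != 0 :> K.
Proof. by rewrite natr0E. Qed.

Definition rep_typ : K := typ al (m 0)%:R (m 1)%:R (m 2%:R)%:R.

Lemma top_pairing : exists P : 'End(V), {in Lsp, forall l,
  [/\ P (y00 (y01 (y10 l))) = (((m 0)%:R - 2) * rep_typ) *: l,
      P (y00 (y01 (y11 l))) = 0, P (y00 (y10 (y11 l))) = 0, P (y01 (y10 (y11 l))) = 0 &
      forall b c, P (F (y b c l)) = 0]}.
Proof.
have [P PP] := core_top_pairing zyE_rep yyE_rep two_neq0_K zF_rep (@ef_same 0) Ey_rep Hy_rep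
  (rep_ho1 rep true) (rep_ho2 rep true) (rep_eo1 rep true) (rep_eo2 rep true) (rep_fo1 rep true)
  (rep_fo2 rep true) bvec_z bvec_E bvec_H bvec_h1 bvec_h2 bvec_e1 bvec_e2 bvec_f1 bvec_f2.
exists P => l lL.
(* To extend the identities from the [bvec] to their span, both sides must be single endomorphisms
   applied to l. *)
have comp3 (Q s t u : 'End(V)) w : Q (s (t (u w))) = (Q \o (s \o (t \o u)))%VF w.
  by rewrite !comp_lfunE.
have comp2 (Q s t : 'End(V)) w : Q (s (t w)) = (Q \o (s \o t))%VF w by rewrite !comp_lfunE.
have zl w : 0 = (0 : 'End(V)) w :> V by rewrite zero_lfunE.
have Zl k (w : V) : k *: w = (k *: \1%VF : 'End(V)) w by rewrite lfunE /= id_lfunE.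
split; [rewrite Zl| | | |move=> b c]; rewrite ?comp3 ?comp2 ?[RHS](zl l);
  apply: Lsp_eq lL => i j; rewrite -?Zl -?zl !comp_lfunE; by have [] := PP i j.
Qed.

Let e1_y0 c x : e 1 (y false c x) = y false c (e 1 x).
Proof. by rewrite (rep_eo1 rep) scale0r addr0. Qed.
Let e1_y1 c x : e 1 (y true c x) = y true c (e 1 x) + y false c x.
Proof. by rewrite (rep_eo1 rep) scale1r. Qed.
Let e2_y0 b x : e 2%:R (y b false x) = y b false (e 2%:R x).
Proof. by rewrite (rep_eo2 rep) scale0r addr0. Qed.
Let e2_y1 b x : e 2%:R (y b true x) = y b true (e 2%:R x) + y b false x.
Proof. by rewrite (rep_eo2 rep) scale1r. Qed.

Lemma y_sq_rep b c x : y b c (y b c x) = 0.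
Proof. exact: (y_sq yyE_rep two_neq0_K). Qed.

Lemma y_swap x :
  (y01 (y00 x) = - y00 (y01 x)) * (y10 (y00 x) = - y00 (y10 x)) *
  (y11 (y01 x) = - y01 (y11 x)) * (y11 (y10 x) = - y10 (y11 x)) *
  (y11 (y00 x) = (2 * (1 + al)) *: F x - y00 (y11 x)) *
  (y10 (y01 x) = (- (2 * (1 + al))) *: F x - y01 (y10 x)).
Proof. exact: (yyE yyE_rep). Qed.

Let e1_F x : e 1 (F x) = F (e 1 x). Proof. by rewrite ef_diff// neq. Qed.
Let e2_F x : e 2%:R (F x) = F (e 2%:R x). Proof. by rewrite ef_diff// neq. Qed.
Let raise := (e1_y0, e1_y1, e2_y0, e2_y1, e1_F, e2_F).

Hypothesis m0_ge3 : (3 <= m 0%R)%N.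
Hypothesis typical : rep_typ != 0.

(** * Relations between products of the y of each degree *)

Section Cubic.
Variables l012 l013 l023 l123 l0 l1 l2 l3 : V.
Hypotheses (L012 : l012 \in Lsp) (L013 : l013 \in Lsp) (L023 : l023 \in Lsp) (L123 : l123 \in Lsp).
Hypotheses (L0 : l0 \in Lsp) (L1 : l1 \in Lsp) (L2 : l2 \in Lsp) (L3 : l3 \in Lsp).

Lemma cubic_eq0 :
  y00 (y01 (y10 l012)) + y00 (y01 (y11 l013)) + y00 (y10 (y11 l023)) + y01 (y10 (y11 l123))
  + F (y00 l0 + y01 l1 + y10 l2 + y11 l3) = 0 ->
  [/\ l012 = 0, l013 = 0, l023 = 0 & l123 = 0].
Proof.
have [P PL] := top_pairing.
have P012 l : l \in Lsp -> P (y00 (y01 (y10 l))) = (((m 0)%:R - 2) * rep_typ) *: l by case/PL.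
have P013 l : l \in Lsp -> P (y00 (y01 (y11 l))) = 0 by case/PL.
have P023 l : l \in Lsp -> P (y00 (y10 (y11 l))) = 0 by case/PL.
have P123 l : l \in Lsp -> P (y01 (y10 (y11 l))) = 0 by case/PL.
have PF b c l : l \in Lsp -> P (F (y b c l)) = 0 by case/PL.
have D_neq0 : (((m 0)%:R - 2) * rep_typ) != 0.
  by rewrite mulf_neq0// -natrB ?natr0E ?subn_eq0 -?ltnNge// ltnW.
have D0 (l : V) : (((m 0)%:R - 2) * rep_typ) *: l = 0 -> l = 0.
  by move/eqP; rewrite scaler_eq0 (negPf D_neq0) => /eqP.
set u := (X in X = 0 -> _) => u0.
have u012 : l012 = 0.
  have := congr1 P u0; rewrite /u !linearD /= P012 ?P013 ?P023 ?P123 ?PF//.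
  by rewrite linear0 !addr0 => /D0.
have Ls := (Lsp_e1, Lsp_e2, L012, L013, L023, L123, L0, L1, L2, L3).
have sort_y := (y_swap, =^~ Fy_rep, lfunD, lfunN, lfunZ, y_sq_rep, linear0).
have Pval := (PF, P013, P023, P123, P012, Ls).
have simp := (linear0, scaler0, oppr0, addr0, add0r).
(* Raising by [e 2%:R] sends y11 to y10, so y00 y01 y11 gives y00 y01 y10; P kills everything that
   the other terms produce. *)
have u013 : l013 = 0.
  have := congr1 (P \o e 2%:R)%VF u0; rewrite comp_lfunE /u u012 !(linear0, add0r) !linearD /=.
  by rewrite !(raise, lfunD, y_sq_rep, linear0, addr0, add0r) /= ?Pval// !simp => /D0.
(* Here [e 1] sends y11 to y01, and y00 y10 y01 is - y00 y01 y10 modulo F y L, whence the sign. *)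
have u023 : l023 = 0.
  have := congr1 (P \o e 1)%VF u0; rewrite comp_lfunE /u u012 u013 !(linear0, add0r) !linearD /=.
  rewrite !(raise, lfunD) !sort_y ?Pval// !simp.
  by rewrite -scalerN => /D0/eqP; rewrite oppr_eq0 => /eqP.
(* The monomial without y00 needs both raisings. It produces y00 y01 y10 twice with sign - and once
   with sign +, so the total is again - 1 modulo vectors killed by P. *)
have u123 : l123 = 0.
  have := congr1 (P \o (e 2%:R \o e 1))%VF u0.
  rewrite !comp_lfunE /u u012 u013 u023 !(linear0, add0r) !linearD /=.
  rewrite !(raise, lfunD) !sort_y ?opprK ?Pval// !simp.
  by rewrite subrr sub0r -scalerN => /D0/eqP; rewrite oppr_eq0 => /eqP.
by split.
Qed.
End Cubic.

Lemma H_y (k : nat) b c x : H x = k.+1%:R *: x -> H (y b c x) = k%:R *: y b c x.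
Proof. by move=> Hx; rewrite Hy_rep Hx linearZ /= -[X in _ - X]scale1r -scalerBl -natr1 addrK. Qed.

Lemma H_F (k : nat) x : H x = k.+2%:R *: x -> H (F x) = k%:R *: F x.
Proof.
by move=> Hx; rewrite hf_same Hx linearZ /= -scalerBl -!natr1; congr (_ *: _); ring.
Qed.

Lemma H_D (k : K) x w : H x = k *: x -> H w = k *: w -> H (x + w) = k *: (x + w).
Proof. by move=> Hx Hw; rewrite linearD /= Hx Hw scalerDr. Qed.

Lemma F_inj (k : nat) x : H x = k.+1%:R *: x -> F x = 0 -> x = 0.
Proof. exact: (@iter_f_inj_le _ _ _ _ _ K_char0 (@ef_same 0) (@he_same 0) (@hf_same 0) _ 1). Qed.

Lemma Lsp0 : 0 \in Lsp. Proof. exact: rpred0. Qed.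

Lemma LspZ a x : x \in Lsp -> a *: x \in Lsp. Proof. exact: rpredZ. Qed.

Lemma m0E : exists k, m 0 = k.+3.
Proof. by case: (m 0) m0_ge3 => [|[|[|k]]]//; exists k. Qed.

(** Multiplication by y00 y01 kills the first two terms and makes the two others cubic; then y10 y11
    does the same for the first two. *)
Lemma linear_eq0 l0 l1 l2 l3 :
  l0 \in Lsp -> l1 \in Lsp -> l2 \in Lsp -> l3 \in Lsp ->
  y00 l0 + y01 l1 + y10 l2 + y11 l3 = 0 -> [/\ l0 = 0, l1 = 0, l2 = 0 & l3 = 0].
Proof.
move=> L0 L1 L2 L3 u0; have Z := Lsp0.
have [l20 l30 _ _] : [/\ l2 = 0, l3 = 0, 0 = 0 :> V & 0 = 0 :> V].
  apply: (@cubic_eq0 l2 l3 0 0 0 0 0 0) => //.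
  have E : y00 (y01 (y00 l0 + y01 l1 + y10 l2 + y11 l3)) = 0 by rewrite u0 !linear0.
  by rewrite -[RHS]E !linearD /= (y_swap l0) !linearN /= !y_sq_rep !(linear0, oppr0, addr0, add0r).
move: u0; rewrite l20 l30 !linear0 !addr0 => u0.
have [_ _ -> ->] // : [/\ 0 = 0 :> V, 0 = 0 :> V, l0 = 0 & l1 = 0].
(* Moving y11 past y00 and y10 past y01 leaves multiples of F y10 l0 and F y11 l1; these fill the
   last two places. *)
apply: (@cubic_eq0 0 0 l0 l1 0 0 ((2 * (1 + al)) *: l0) ((2 * (1 + al)) *: l1)); rewrite ?LspZ//.
have E : y10 (y11 (y00 l0 + y01 l1)) = 0 by rewrite u0 !linear0.
rewrite -[RHS]E.
rewrite !linearD /=.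
rewrite !(y_swap, lfunD, lfunN, lfunZ) !(linear0, add0r) ?opprD ?scaleNr ?opprK.
by rewrite addrACA !Fy_rep; congr (_ + _); exact: addrC.
Qed.

Lemma H_Lsp_y (k : nat) b c l : m 0 = k.+1 -> l \in Lsp -> H (y b c l) = k%:R *: y b c l.
Proof. by move=> mk lL; apply: H_y; rewrite Lsp_H// mk. Qed.

Lemma cubic_full l012 l013 l023 l123 l0 l1 l2 l3 :
  l012 \in Lsp -> l013 \in Lsp -> l023 \in Lsp -> l123 \in Lsp ->
  l0 \in Lsp -> l1 \in Lsp -> l2 \in Lsp -> l3 \in Lsp ->
  y00 (y01 (y10 l012)) + y00 (y01 (y11 l013)) + y00 (y10 (y11 l023)) + y01 (y10 (y11 l123))
  + F (y00 l0 + y01 l1 + y10 l2 + y11 l3) = 0 ->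
  [/\ l012 = 0, l013 = 0, l023 = 0 & l123 = 0] /\ [/\ l0 = 0, l1 = 0, l2 = 0 & l3 = 0].
Proof.
move=> L012 L013 L023 L123 L0 L1 L2 L3 u0.
have lA0 := cubic_eq0 L012 L013 L023 L123 L0 L1 L2 L3 u0; split=> //.
have [k mk] := m0E; apply: linear_eq0 => //; apply: (@F_inj k.+1).
  by do ![apply: H_D]; exact: H_Lsp_y.
by move: u0; case: lA0 => -> -> -> ->; rewrite !linear0 !add0r.
Qed.

Hypothesis al_neqN1 : 1 + al != 0.

Section Quadratic.
Variables x0 x01 x02 x03 x12 x13 x23 xP : V.
Hypotheses (X0 : x0 \in Lsp) (X01 : x01 \in Lsp) (X02 : x02 \in Lsp) (X03 : x03 \in Lsp).
Hypotheses (X12 : x12 \in Lsp) (X13 : x13 \in Lsp) (X23 : x23 \in Lsp) (XP : xP \in Lsp).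
Let u2 := F x0 + (y00 (y01 x01) + y00 (y10 x02) + y00 (y11 x03)
  + y01 (y10 x12) + y01 (y11 x13) + y10 (y11 x23)).
Let k := 2 * (1 + al).
Let all0 := [/\ x0 = 0, x01 = 0, x02 = 0, x03 = 0 & [/\ x12 = 0, x13 = 0, x23 = 0 & xP = 0]].

(** Multiplying by y00 keeps exactly x0 and the terms without y00; multiplying by y11 then detects
    the rest. As y11 y00 y11 = k F y11, the vector x03 is found only through k, and this is where
    alpha <> -1 enters. The summand with xP serves the quartic case, since y11 y00 y01 y10 y11 = k F
    y01 y10 y11. *)
Lemma quadratic_aux : y00 u2 = 0 -> y11 u2 + k *: y01 (y10 (y11 xP)) = 0 -> all0.
Proof.
move=> u0 u3; have Z := Lsp0.
have [[x120 x130 x230 _] [x00 _ _ _]] :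
    [/\ x12 = 0, x13 = 0, x23 = 0 & 0 = 0 :> V] /\ [/\ x0 = 0, 0 = 0 :> V, 0 = 0 :> V & 0 = 0 :> V].
  apply: cubic_full => //; rewrite -[RHS]u0 /u2 !linearD /= -Fy_rep !y_sq_rep.
  by rewrite !(linear0, addr0, add0r) addrC.
have k0 : k != 0 by rewrite mulf_neq0// two_neq0_K.
have [[_ x010 x020 kxP] [_ _ _ kx3]] :
    [/\ 0 = 0 :> V, x01 = 0, x02 = 0 & k *: xP = 0] /\
    [/\ 0 = 0 :> V, k *: x01 = 0, k *: x02 = 0 & k *: x03 = 0].
  apply: cubic_full; rewrite ?LspZ// -[RHS]u3 /u2 x00 x120 x130 x230 !(linear0, addr0, add0r).
  rewrite !(y_swap, lfunD, lfunN, lfunZ, y_sq_rep, linear0, oppr0, addr0) !opprK.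
  rewrite -/k [X in _ = X + _ + _]addrACA [X in _ = X + _]addrAC -[RHS]addrA.
  by rewrite addrC.
have kK (x : V) : k *: x = 0 -> x = 0 by move/eqP; rewrite scaler_eq0 (negPf k0) => /eqP.
by split=> //; [exact: kK|split=> //; exact: kK].
Qed.

Lemma quadratic_eq0 : xP = 0 -> u2 = 0 -> all0.
Proof.
by move=> xP0 u0; apply: quadratic_aux; rewrite u0 ?xP0 !linear0 ?scaler0 ?addr0.
Qed.

(** Multiplied by y00 or by y11, the relation takes the form F w = 0 with w of H-weight m 0 - 3.
    This weight is positive, so F cancels and the two premises of [quadratic_aux] appear. *)
Lemma quartic_eq0 : (4 <= m 0%R)%N -> F u2 + y00 (y01 (y10 (y11 xP))) = 0 -> all0.
Proof.
move=> m0_ge4 u4.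
have [n mn] : exists n, m 0 = n.+4.
  by case: (m 0) m0_ge4 => [|[|[|[|n]]]]//; exists n.
have Hu2 : H u2 = n.+2%:R *: u2.
  apply: H_D; first by apply: H_F; rewrite Lsp_H// mn.
  by do ![apply: H_D]; apply: H_y; apply: H_Lsp_y.
have Hy c d : H (y c d u2) = n.+1%:R *: y c d u2 by exact: H_y.
apply: quadratic_aux.
  apply: F_inj (Hy _ _) _; rewrite Fy_rep.
  have : y00 (F u2 + y00 (y01 (y10 (y11 xP)))) = 0 by rewrite u4 linear0.
  by rewrite linearD /= y_sq_rep addr0.
apply: (@F_inj n); last first.
  have : y11 (F u2 + y00 (y01 (y10 (y11 xP)))) = 0 by rewrite u4 linear0.
  have -> : F (y11 u2 + k *: y01 (y10 (y11 xP))) = y11 (F u2) + k *: F (y01 (y10 (y11 xP))).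
    by rewrite lfunD lfunZ Fy_rep.
  rewrite lfunD => <-; congr (_ + _).
  by rewrite !(y_swap, lfunN, y_sq_rep, linear0, oppr0, addr0).
apply: H_D; first exact: Hy.
rewrite linearZ /= (_ : H _ = n.+1%:R *: y01 (y10 (y11 xP))).
  by rewrite !scalerA mulrC.
by do 2! apply: H_y; apply: H_Lsp_y.
Qed.
End Quadratic.

Lemma iter_lfunD (g : 'End(V)) n x w : iter n g (x + w) = iter n g x + iter n g w.
Proof. by elim: n => //= n ->; rewrite linearD. Qed.

Lemma iter_F_inj (k n : nat) x : (n <= k)%N -> H x = k%:R *: x -> iter n F x = 0 -> x = 0.
Proof. exact: (iter_f_inj_le K_char0 (@ef_same 0) (@he_same 0) (@hf_same 0)). Qed.

(** * Relations in a fixed weight of H *)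

Section Levels.
Variable d : nat.

(** This is a relation in H-weight m 0 - 2 (d + 1). The premises on x0, on the quadratic
    coefficients and on xP state that coefficients outside [Slambda] vanish. If quadratic terms are
    allowed, then m 0 - 2 >= d and F^d cancels; if xP is allowed, then m 0 - 4 >= d - 1 and F^(d-1)
    cancels. For d = 0 the meaningless exponent [d.-1] does no harm, since xP is 0 there. *)
Lemma even_level x0 x01 x02 x03 x12 x13 x23 xP :
  x0 \in Lsp -> x01 \in Lsp -> x02 \in Lsp -> x03 \in Lsp ->
  x12 \in Lsp -> x13 \in Lsp -> x23 \in Lsp -> xP \in Lsp ->
  ((m 0%R < d.+1)%N -> x0 = 0) ->
  ((m 0%R < d.+2)%N -> [/\ x01 = 0, x02 = 0, x03 = 0, x12 = 0 & x13 = 0 /\ x23 = 0]) ->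
  ((d == 0)%N || (m 0%R < d.+3)%N -> xP = 0) ->
  iter d.+1 F x0 + iter d F (y00 (y01 x01) + y00 (y10 x02) + y00 (y11 x03)
    + y01 (y10 x12) + y01 (y11 x13) + y10 (y11 x23)) + iter d.-1 F (y00 (y01 (y10 (y11 xP)))) = 0 ->
  [/\ x0 = 0, x01 = 0, x02 = 0, x03 = 0 & [/\ x12 = 0, x13 = 0, x23 = 0 & xP = 0]].
Proof.
move=> X0 X01 X02 X03 X12 X13 X23 XP s0 s2 sP.
set q := (X in iter d F X) => u0.
have [me|me] := ltnP (m 0) d.+2.
  have [x010 x020 x030 x120 [x130 x230]] := s2 me.
  have xP0 : xP = 0 by apply: sP; rewrite (ltnW _) ?orbT.
  suff -> : x0 = 0 by [].
  have [em|em] := ltnP (m 0) d.+1; first exact: s0.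
  apply: (iter_F_inj em); first exact: Lsp_H.
  by move: u0; rewrite /q x010 x020 x030 x120 x130 x230 xP0 !(linear0, iter_f0, addr0).
have [n mn] : exists n, m 0 = (d + n).+2 by exists (m 0%R - d.+2)%N; lia.
have Hu2 : H (F x0 + q) = (d + n)%:R *: (F x0 + q).
  apply: H_D; first by apply: H_F; rewrite Lsp_H// mn.
  by do ![apply: H_D]; apply: H_y; apply: H_Lsp_y.
case: (boolP ((d == 0)%N || (m 0%R < d.+3)%N)) => [eP|].
  have xP0 := sP eP; apply: quadratic_eq0 => //; apply: (iter_F_inj _ Hu2).
    exact: leq_addr.
  by move: u0; rewrite iter_lfunD -iterSr xP0 !linear0 iter_f0 addr0.
rewrite negb_or -leqNgt => /andP[d_neq0 em].
case: d d_neq0 em u0 {s0 s2 sP Hu2 mn me} => // d' _ em u0.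
apply: quartic_eq0 => //; first lia.
have [n' mn'] : exists n', m 0 = (d' + n').+4 by exists (m 0%R - d'.+4)%N; lia.
apply: (@iter_F_inj (d' + n') d'); first exact: leq_addr.
  apply: H_D; last by do 3! apply: H_y; apply: H_Lsp_y.
  apply: H_F; apply: H_D; first by apply: H_F; rewrite Lsp_H// mn'.
  by do ![apply: H_D]; apply: H_y; apply: H_Lsp_y.
by rewrite -[RHS]u0 iter_lfunD -iterSr iter_lfunD -iterSr.
Qed.

(** Here the H-weight is m 0 - 2 d - 3. If cubic terms are allowed, then m 0 - 3 >= d and F^d
    cancels; otherwise only the linear part is left, where F^(d+1) cancels as long as m 0 - 1 >= d +
    1. *)
Lemma odd_level x0 x1 x2 x3 x012 x013 x023 x123 :
  x0 \in Lsp -> x1 \in Lsp -> x2 \in Lsp -> x3 \in Lsp ->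
  x012 \in Lsp -> x013 \in Lsp -> x023 \in Lsp -> x123 \in Lsp ->
  ((m 0%R < d.+2)%N -> [/\ x0 = 0, x1 = 0, x2 = 0 & x3 = 0]) ->
  ((m 0%R < d.+3)%N -> [/\ x012 = 0, x013 = 0, x023 = 0 & x123 = 0]) ->
  iter d.+1 F (y00 x0 + y01 x1 + y10 x2 + y11 x3) + iter d F (y00 (y01 (y10 x012))
    + y00 (y01 (y11 x013)) + y00 (y10 (y11 x023)) + y01 (y10 (y11 x123))) = 0 ->
  [/\ x012 = 0, x013 = 0, x023 = 0 & x123 = 0] /\ [/\ x0 = 0, x1 = 0, x2 = 0 & x3 = 0].
Proof.
move=> X0 X1 X2 X3 X012 X013 X023 X123 s1 s3 u0.
have [em|em] := ltnP (m 0) d.+3.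
  have x30 := s3 em; split=> //.
  have [me|me] := ltnP (m 0) d.+2; first exact: s1.
  apply: linear_eq0 => //; apply: (@iter_F_inj d.+1 d.+1) => //.
    by do ![apply: H_D]; apply: H_Lsp_y => //; lia.
  by move: u0; case: x30 => -> -> -> ->; rewrite !(linear0, addr0) iter_f0 addr0.
have [n mn] : exists n, m 0 = (d + n).+3 by exists (m 0%R - d.+3)%N; lia.
apply: cubic_full => //; apply: (@iter_F_inj (d + n) d); first exact: leq_addr.
  apply: H_D; first by do ![apply: H_D]; do 2! apply: H_y; apply: H_Lsp_y.
  by apply: H_F; do ![apply: H_D]; apply: H_Lsp_y.
by rewrite -[RHS]u0 iter_lfunD -iterSr addrC.
Qed.
End Levels.

(** A pair in [proot] records the signs of a positive odd root, and a boolean of [o] is true for a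
    minus sign; passing to the negative root flips all three. *)
Definition low (t : proot) : 'End(V) :=
  match t with inl i => f i | inr p => o true (~~ p.1) (~~ p.2) end.

(** In this order F stands in front and f_2, f_3 act on v first, so that a monomial is F^p times a
    product of the y applied to a vector of [Lsp]. *)
Definition std_roots : seq proot :=
  [:: inl 0; inr (true, true); inr (true, false); inr (false, true); inr (false, false);
      inl 1; inl 2%:R].

Definition pbw (s : {ffun proot -> nat}) : V :=
  foldr (fun t => iter (s t) (low t)) v std_roots.

Lemma iter_linear (g : 'End(V)) n : linear (iter n g).
Proof. by elim: n => [|n IH] a x w //=; rewrite IH linearP. Qed.

Definition ymon (a : bool * bool * bool * bool) (x : V) : V :=
  iter a.1.1.1 y00 (iter a.1.1.2 y01 (iter a.1.2 y10 (iter a.2 y11 x))).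

Definition ycount (a : bool * bool * bool * bool) : nat := (a.1.1.1 + a.1.1.2 + a.1.2 + a.2)%N.

Lemma Fymon_linear p a : linear (fun x => iter p F (ymon a x)).
Proof. by move=> k x w; rewrite /ymon !iter_linear. Qed.

Lemma H_iter_F (k : K) n x : H x = k *: x -> H (iter n F x) = (k - 2 * n%:R) *: iter n F x.
Proof. exact: (weight_iter_f (@hf_same 0)). Qed.

Lemma H_iter_y (k : K) b c n x : H x = k *: x ->
  H (iter n (y b c) x) = (k - n%:R) *: iter n (y b c) x.
Proof.
move=> Hx; elim: n => [|n IH] /=; first by rewrite subr0.
by rewrite Hy_rep IH linearZ /= -[X in _ - X]scale1r -scalerBl -natr1 opprD addrA.
Qed.

Lemma H_Fymon (k : K) p a x : H x = k *: x ->
  H (iter p F (ymon a x)) = (k - (2 * p + ycount a)%N%:R) *: iter p F (ymon a x).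
Proof.
move=> Hx; rewrite /ymon (H_iter_F p (H_iter_y _ _ _ (H_iter_y _ _ _ (H_iter_y _ _ _ (H_iter_y _ _ _ Hx))))).
by congr (_ *: _); rewrite natrD natrM /ycount !natrD; ring.
Qed.

Lemma fvec_Lsp i j : fvec i j \in Lsp.
Proof.
have -> : fvec i j = (i`!%:R * j`!%:R) *: bvec (Posz i) (Posz j).
  by rewrite bvecP scalerA mulfV ?scale1r// mulf_neq0// fact_neq0.
by rewrite LspZ// mem_Lsp.
Qed.

Lemma sum_pair_bool (T : finType) (W : nmodType) (G : T * bool -> W) :
  \sum_a G a = \sum_(x : T) (G (x, true) + G (x, false)).
Proof.
rewrite (eq_bigr (fun a => G (a.1, a.2))) => [|[]//].
rewrite -(pair_bigA _ (fun x b => G (x, b))) /=; apply: eq_bigr => x _.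
by rewrite big_bool.
Qed.

Definition yset (s : {ffun proot -> nat}) : bool * bool * bool * bool :=
  (s (inr (true, true)) == 1%N, s (inr (true, false)) == 1%N,
   s (inr (false, true)) == 1%N, s (inr (false, false)) == 1%N).

Lemma Slambda_yset s : s \in Slambda (m 0) (m 1) (m 2%:R) ->
  [/\ s (inr (true, true)) = (yset s).1.1.1, s (inr (true, false)) = (yset s).1.1.2,
   s (inr (false, true)) = (yset s).1.2, s (inr (false, false)) = (yset s).2 &
   (s (inl 0%R) + ycount (yset s) <= m 0%R)%N].
Proof.
move=> /and4P[sm _ _ /forallP s1].
have s01 p : s (inr p) = (s (inr p) == 1%N) by have := s1 p; case: (s _) => [|[|]].
split; try exact: s01.
apply: leq_trans sm; rewrite addnC leq_add2r /ycount /= -!s01.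
suff -> : (\sum_p s (inr p) = s (inr (true, true)) + s (inr (true, false))
  + s (inr (false, true)) + s (inr (false, false)))%N by [].
have -> : (\sum_(p : bool * bool) s (inr p) = \sum_(p : bool * bool) s (inr (p.1, p.2)))%N.
  by apply: eq_bigr => -[].
by rewrite -(pair_bigA _ (fun b c => s (inr (b, c)))) /= !big_bool /= addnA.
Qed.

Lemma pbwE s : s \in Slambda (m 0) (m 1) (m 2%:R) ->
  pbw s = iter (s (inl 0)) F (ymon (yset s) (fvec (s (inl 1)) (s (inl 2%:R)))).
Proof.
by move=> /Slambda_yset[e0 e1 e2 e3 _]; rewrite /pbw /= e0 e1 e2 e3.
Qed.

Section Independence.
Variables (r : seq {ffun proot -> nat}) (c : {ffun proot -> nat} -> K).
Hypothesis r_uniq : uniq r.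
Hypothesis r_sub : {subset r <= Slambda (m 0) (m 1) (m 2%:R)}.
Hypothesis sum0 : \sum_(s <- r) c s *: pbw s = 0.

(** The H-weight of [pbw s] is m 0 - deg s. The vector [l a p] is the total coefficient in [Lsp] of
    F^p y_a in the relation. Since a and the degree determine p, the part [T k a] of the relation is
    F^p y_a applied to one such vector. *)
Let deg (s : {ffun proot -> nat}) : nat := (2 * s (inl 0%R) + ycount (yset s))%N.
Let l a p := \sum_(s <- r | (yset s == a) && (s (inl 0) == p)) c s *: fvec (s (inl 1)) (s (inl 2%:R)).
Let T k a := \sum_(s <- r | (deg s == k) && (yset s == a)) c s *: pbw s.

Let l_Lsp a p : l a p \in Lsp.
Proof. by rewrite rpred_sum// => s _; rewrite LspZ// fvec_Lsp. Qed.

Let l_out a p : (m 0%R < p + ycount a)%N -> l a p = 0.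
Proof.
move=> mp; rewrite /l big_seq_cond big1// => s /and3P[sr /eqP sa /eqP sp].
have [_ _ _ _] := Slambda_yset (r_sub sr).
by rewrite sa sp leqNgt mp.
Qed.

Let T_eval p a k : k = (2 * p + ycount a)%N -> T k a = iter p F (ymon a (l a p)).
Proof.
pose g := GRing.isLinear.Build _ _ _ _ _ (Fymon_linear p a).
pose L : {linear V -> V} := HB.pack (fun x => iter p F (ymon a x)) g.
move=> ->; rewrite -[RHS]/(L _) /T /l linear_sum big_seq_cond [RHS]big_seq_cond /=.
apply: eq_big => [s|s /and3P[sr /eqP sd /eqP sa]]; last first.
  rewrite pbwE ?r_sub// -[RHS]/(L _) linearZ /= sa; congr (_ *: iter _ _ _).
  by apply/eqP; move: sd; rewrite /deg sa => /eqP; rewrite eqn_add2r eqn_pmul2l.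
case: (s \in r) => //=; rewrite andbC; case: eqP => //= <-.
by rewrite /deg eqn_add2r eqn_pmul2l.
Qed.

Let T_zero k a : (forall p, k != 2 * p + ycount a)%N -> T k a = 0.
Proof.
move=> kp; rewrite /T big1// => s /andP[/eqP sk /eqP sa].
by have := kp (s (inl 0)); rewrite -sk /deg sa eqxx.
Qed.

Let T_sum k : \sum_a T k a = 0.
Proof.
have dk : \sum_(s <- r | deg s == k) c s *: pbw s = 0.
  have := @eigen_sum_part _ _ H _ r (fun s => c s *: pbw s) (fun s => (m 0)%:R - (deg s)%:R) _ sum0
    ((m 0)%:R - k%:R).
  rewrite (eq_bigl (fun s => deg s == k)) => [->// s sr|s]; last first.
    by rewrite (inj_eq (addrI _)) (inj_eq oppr_inj) (inj_eq (natr_inj K_char0)).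
  by rewrite linearZ /= pbwE ?r_sub// (H_Fymon _ _ (fvec_h0 _ _)) !scalerA mulrC.
by rewrite -[RHS]dk (partition_big yset predT)//=.
Qed.

(** The eight subsets of even size come first, then the eight of odd size: by [T_parity] one of
    these halves vanishes for each k. *)
Let T_sum16 k :
  T k (true, true, true, true) +
  (T k (true, true, false, false) + T k (true, false, true, false) + T k (true, false, false, true)
   + T k (false, true, true, false) + T k (false, true, false, true) + T k (false, false, true, true))
  + T k (false, false, false, false) + (
  T k (true, true, true, false) + T k (true, true, false, true) + T k (true, false, true, true) +
  T k (false, true, true, true) + (T k (true, false, false, false) + T k (false, true, false, false)
   + T k (false, false, true, false) + T k (false, false, false, true))) = 0.
Proof.
rewrite -[RHS](T_sum k) !sum_pair_bool big_bool /= !addrA.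
by rewrite [RHS](ACl (1*4*6*7*10*11*13*16*2*3*5*9*8*12*14*15)).
Qed.

Local Notation a0 := (false, false, false, false).
Let T_parity k a : odd k != odd (ycount a) -> T k a = 0.
Proof.
move=> ka; apply: T_zero => p; apply: contraNneq ka => ->.
by rewrite ssrnat.oddD ssrnat.oddM /=.
Qed.

Let l_even d (xP := if d is d'.+1 then l (true, true, true, true) d' else 0) :
  [/\ l a0 d.+1 = 0, l (true, true, false, false) d = 0, l (true, false, true, false) d = 0,
   l (true, false, false, true) d = 0 & [/\ l (false, true, true, false) d = 0,
   l (false, true, false, true) d = 0, l (false, false, true, true) d = 0 & xP = 0]].
Proof.
have odd0 (b : bool) : (b == false) || (b == true) by case: b.
apply: (@even_level d) => //.
- by rewrite /xP; case: (d) => [|d']; [exact: Lsp0|].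
- by move=> md; apply: l_out; rewrite addn0.
- by move=> md; split; [..|split]; apply: l_out; rewrite addn2.
- rewrite /xP; case: (d) => //= d' md; apply: l_out.
  by rewrite addnC.
have := T_sum16 (2 * d.+1)%N.
have -> : T (2 * d.+1)%N (true, true, true, true) = iter d.-1 F (y00 (y01 (y10 (y11 xP)))).
  rewrite /xP; case: (d) => [|d']; last by rewrite (@T_eval d')// /ycount /=; lia.
  by rewrite T_zero ?linear0// => p; rewrite /ycount /=; lia.
have Z a : odd (ycount a) -> T (2 * d.+1)%N a = 0.
  by move=> a_odd; rewrite T_parity// ssrnat.oddM a_odd.
have Y a : ycount a = 2%N -> T (2 * d.+1)%N a = iter d F (ymon a (l a d)).
  by move=> a2; apply: T_eval; rewrite a2; lia.
rewrite (@T_eval d.+1 a0) ?addn0//.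
rewrite (Y (true, true, false, false))// (Y (true, false, true, false))// (Y (true, false, false, true))//
  (Y (false, true, true, false))// (Y (false, true, false, true))// (Y (false, false, true, true))//.
rewrite (Z (true, true, true, false))// (Z (true, true, false, true))// (Z (true, false, true, true))//
  (Z (true, false, false, false))// (Z (false, true, true, true))// (Z (false, true, false, false))//
  (Z (false, false, true, false))// (Z (false, false, false, true))// !addr0.
rewrite /ymon /= => E; rewrite -[RHS]E.
by rewrite !iter_lfunD !addrA [RHS](ACl (8*2*3*4*5*6*7*1)).
Qed.

Let l_odd d :
  [/\ l (true, true, true, false) d = 0, l (true, true, false, true) d = 0,
   l (true, false, true, true) d = 0 & l (false, true, true, true) d = 0] /\
  [/\ l (true, false, false, false) d.+1 = 0, l (false, true, false, false) d.+1 = 0,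
   l (false, false, true, false) d.+1 = 0 & l (false, false, false, true) d.+1 = 0].
Proof.
apply: (@odd_level d) => //.
- by move=> md; split; apply: l_out; rewrite addn1.
- by move=> md; split; apply: l_out; rewrite addn3.
have := T_sum16 (2 * d.+1).+1%N.
have Z a : ~~ odd (ycount a) -> T (2 * d.+1).+1%N a = 0.
  by move=> a_even; rewrite T_parity// ssrnat.oddS ssrnat.oddM (negPf a_even).
have Y3 a : ycount a = 3%N -> T (2 * d.+1).+1%N a = iter d F (ymon a (l a d)).
  by move=> a3; apply: T_eval; rewrite a3; lia.
have Y1 a : ycount a = 1%N -> T (2 * d.+1).+1%N a = iter d.+1 F (ymon a (l a d.+1)).
  by move=> a1; apply: T_eval; rewrite a1; lia.
rewrite (Y3 (true, true, true, false))// (Y3 (true, true, false, true))// (Y3 (true, false, true, true))//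
  (Y3 (false, true, true, true))//.
rewrite (Y1 (true, false, false, false))// (Y1 (false, true, false, false))// (Y1 (false, false, true, false))//
  (Y1 (false, false, false, true))//.
rewrite (Z (true, true, true, true))// (Z (true, true, false, false))// (Z (true, false, true, false))//
  (Z (true, false, false, true))// (Z (false, true, true, false))// (Z (false, true, false, true))//
  (Z (false, false, true, true))// (Z (false, false, false, false))// !(addr0, add0r).
rewrite /ymon /= => E; rewrite -[RHS]E.
by rewrite !iter_lfunD !lfunD !addrA [RHS](ACl (5*6*7*8*1*2*3*4)).
Qed.

(** Degrees 0 and 1 have to be treated apart, because [l_even] starts at degree 2 and [l_odd] at
    degree 3. *)
Let l_bottom : l a0 0 = 0 /\
  [/\ l (true, false, false, false) 0 = 0, l (false, true, false, false) 0 = 0,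
   l (false, false, true, false) 0 = 0 & l (false, false, false, true) 0 = 0].
Proof.
have Z k a : (k < ycount a)%N -> T k a = 0 by move=> ka; apply: T_zero => p; lia.
split.
  have := T_sum16 0; rewrite (@T_eval 0 a0)// /ymon /=.
  rewrite (Z 0 (true, true, true, true))// (Z 0 (true, true, true, false))// (Z 0 (true, true, false, true))//
    (Z 0 (true, true, false, false))// (Z 0 (true, false, true, true))// (Z 0 (true, false, true, false))//
    (Z 0 (true, false, false, true))// (Z 0 (true, false, false, false))// (Z 0 (false, true, true, true))//
    (Z 0 (false, true, true, false))// (Z 0 (false, true, false, true))// (Z 0 (false, true, false, false))//
    (Z 0 (false, false, true, true))// (Z 0 (false, false, true, false))// (Z 0 (false, false, false, true))// !addr0 !add0r.
  by [].
apply: linear_eq0 => //; have := T_sum16 1.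
rewrite (@T_parity 1 a0)// (@T_eval 0 (true, false, false, false))// (@T_eval 0 (false, true, false, false))//
  (@T_eval 0 (false, false, true, false))// (@T_eval 0 (false, false, false, true))// /ymon /= => E.
rewrite -[RHS]E (Z 1 (true, true, true, true))// (Z 1 (true, true, true, false))//
  (Z 1 (true, true, false, true))// (Z 1 (true, true, false, false))//
  (Z 1 (true, false, true, true))// (Z 1 (true, false, true, false))//
  (Z 1 (true, false, false, true))// (Z 1 (false, true, true, true))//
  (Z 1 (false, true, true, false))// (Z 1 (false, true, false, true))//
  (Z 1 (false, false, true, true))//.
by rewrite !(addr0, add0r).
Qed.

Let l_eq0 a p : l a p = 0.
Proof.
have [lb [lb1 lb2 lb3 lb4]] := l_bottom.
(* At level d the coefficients have F-exponent d for quadratic and cubic monomials, d + 1 for those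
   with at most one y, and d - 1 for the quartic one; hence the shifts of p. *)
case: a => [[[[] []] []] []]; case: p => [|p];
  do ? [exact: lb | by have [? ? ? ? [? ? ? ?]] := l_even p | by have [? ? ? ? [? ? ? ?]] := l_even 0
   | by have [? ? ? ? [? ? ? ?]] := l_even p.+1 | by have [? ? ? ? [? ? ? ?]] := l_even 1
   | by have [? ? ? ? [? ? ? ?]] := l_even p.+2
   | by have [[? ? ? ?] [? ? ? ?]] := l_odd p | by have [[? ? ? ?] [? ? ? ?]] := l_odd 0
   | by have [[? ? ? ?] [? ? ? ?]] := l_odd p.+1 ].
Qed.

(** Within [l a p] the vectors [fvec i j] have different pairs of weights for h 1 and h 2.
    Separating first by h 1 and then by h 2 isolates the term of s0, and its [fvec] is nonzero by
    the bounds in [Slambda]. *)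
Lemma pbw_independent : {in r, forall s, c s = 0}.
Proof.
move=> s0 s0r; have [/and4P[_ s1 s2 _]] := (r_sub s0r, l_eq0 (yset s0) (s0 (inl 0))).
rewrite /l -big_filter; set r0 := filter _ _ => sum_r0.
have h1f s : s \in r0 -> h 1 (c s *: fvec (s (inl 1)) (s (inl 2%:R))) =
    ((m 1)%:R - 2 * (s (inl 1))%:R) *: (c s *: fvec (s (inl 1)) (s (inl 2%:R))).
  by move=> _; rewrite linearZ /= fvec_h1 !scalerA mulrC.
have h2f s : s \in r0 -> h 2%:R (c s *: fvec (s (inl 1)) (s (inl 2%:R))) =
    ((m 2%:R)%:R - 2 * (s (inl 2%:R))%:R) *: (c s *: fvec (s (inl 1)) (s (inl 2%:R))).
  by move=> _; rewrite linearZ /= fvec_h2 !scalerA mulrC.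
have := eigen_sum_part h1f sum_r0 ((m 1)%:R - 2 * (s0 (inl 1))%:R).
rewrite -big_filter; set r1 := filter _ r0 => sum_r1.
have h2r1 s (sr1 : s \in r1) := h2f s (mem_subseq (filter_subseq _ _) sr1).
have := eigen_sum_part h2r1 sum_r1 ((m 2%:R)%:R - 2 * (s0 (inl 2%:R))%:R).
rewrite -big_filter /r1 /r0 -!filter_predI (eq_in_filter (a2 := pred1 s0)) => [|s sr].
  rewrite filter_pred1_uniq// big_seq1 => /eqP; rewrite scaler_eq0.
  by rewrite (negPf (fvec_neq0 s1 s2)) orbF => /eqP.
have two0 : (2 : K) != 0 by rewrite natr0E.
rewrite /= !(inj_eq (addrI _)) !(inj_eq oppr_inj) !(inj_eq (mulfI two0)) !(inj_eq (natr_inj K_char0)).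
apply/idP/eqP => [/and4P[/eqP e2 /eqP e1 /eqP ea /eqP e0]|->]; last by rewrite !eqxx.
have [t0 t1 t2 t3 _] := Slambda_yset (r_sub sr).
have [u0 u1 u2 u3 _] := Slambda_yset (r_sub s0r).
apply/ffunP => -[i|[[] []]]; last 4 first.
- by rewrite t0 u0 ea.
- by rewrite t1 u1 ea.
- by rewrite t2 u2 ea.
- by rewrite t3 u3 ea.
by move: i; apply: ord3P.
Qed.
End Independence.
End HighestWeight.

(** * Spanning *)

Section Words.
Variables (K : fieldType) (V : vectType K) (g : proot -> 'End(V)) (v : V).

Definition word (q : seq proot) : V := foldr (fun t u => g t u) v q.

Definition exps (r : seq proot) (s : proot -> nat) : seq proot := flatten [seq nseq (s t) t | t <- r].

Lemma word_cat q1 q2 : word (q1 ++ q2) = foldr (fun t u => g t u) (word q2) q1.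
Proof. by rewrite /word foldr_cat. Qed.

Lemma foldr_nseq n t u : foldr (fun t u => g t u) u (nseq n t) = iter n (g t) u.
Proof. by elim: n => //= n ->. Qed.

Lemma word_exps r s : word (exps r s) = foldr (fun t => iter (s t) (g t)) v r.
Proof. by elim: r => //= t r IH; rewrite /exps /= word_cat foldr_nseq -IH. Qed.

Lemma count_exps r s t : uniq r -> count_mem t (exps r s) = if t \in r then s t else 0%N.
Proof.
elim: r => //= u r IH /andP[ur r_uniq]; rewrite /exps /= count_cat -/(exps r s) IH// count_nseq /=.
rewrite inE eq_sym; have [->|_] := eqVneq t u; last by rewrite mul0n.
by rewrite mul1n (negPf ur) addn0.
Qed.

Lemma size_exps r s : size (exps r s) = (\sum_(t <- r) s t)%N.
Proof.
rewrite /exps size_flatten /shape -map_comp sumnE big_map.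
by apply: eq_bigr => t _ /=; rewrite size_nseq.
Qed.

Lemma exps_count_perm r q : perm_eq r (enum {: proot}) ->
  perm_eq q (exps r (fun t => count_mem t q)).
Proof.
move=> r_enum; apply/allP => t _ /=; rewrite count_exps ?(perm_uniq r_enum) ?enum_uniq//.
by rewrite (perm_mem r_enum) mem_enum.
Qed.

(* Strict bound on the length, so that Fil k.+1 is the k-th term of the PBW filtration and
   Fil 0 = 0. *)
Definition Fil (k : nat) : submodClosed V := lspan (fun w => exists2 q, (size q < k)%N & w = word q).

Lemma word_Fil q k : (size q < k)%N -> word q \in Fil k.
Proof. by move=> qk; apply: lspan_gen; exists q. Qed.

Lemma FilS j k : (j <= k)%N -> {subset Fil j <= Fil k}.
Proof.
by move=> jk; apply: lspan_le => x [q qj ->]; apply: word_Fil; apply: leq_trans jk.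
Qed.

Lemma Fil_low t k x : x \in Fil k -> g t x \in Fil k.+1.
Proof. by apply: (@lspan_sub _ _ (Fil k.+1) (g t)) => w [q qk ->]; apply: (@word_Fil (t :: q)). Qed.

Lemma Fil0 x : x \in Fil 0 -> x = 0.
Proof.
move=> /asboolP[n [c [u [u0 ->]]]]; apply: big1 => i _.
by have [q] := u0 i.
Qed.

Hypothesis low_swap : forall t u, exists2 a : K, a != 0 & forall k x, x \in Fil k ->
  g t (g u x) - a *: g u (g t x) \in Fil k.+1.

Lemma word_move t q1 q2 : exists2 a : K, a != 0 &
  word (t :: q1 ++ q2) - a *: word (q1 ++ t :: q2) \in Fil (size (q1 ++ q2)).+1.
Proof.
elim: q1 => [|u q1 [a a0 IH]] /=; first by exists 1; rewrite ?oner_neq0// scale1r subrr rpred0.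
have [b b0 tu] := low_swap t u; exists (b * a); first by rewrite mulf_neq0.
rewrite -(subrK (b *: g u (g t (word (q1 ++ q2)))) (g t _)) -addrA rpredD//.
  exact: tu (word_Fil (ltnSn _)).
by rewrite -scalerA -scalerBr -linearZ -linearB rpredZ//= Fil_low.
Qed.

Lemma word_perm q1 q2 : perm_eq q1 q2 -> exists2 a : K, a != 0 & word q1 - a *: word q2 \in Fil (size q1).
Proof.
elim: q1 q2 => [|t q1 IH] q2.
  by rewrite perm_sym => /perm_nilP ->; exists 1; rewrite ?oner_neq0// scale1r subrr rpred0.
move=> tq; have /splitPr q2t : t \in q2 by rewrite -(perm_mem tq) mem_head.
case: q2t tq => l1 l2; rewrite perm_sym perm_catC /= perm_cons perm_catC perm_sym => q1l.
have [a a0 Ha] := IH _ q1l; have [b b0 Hb] := word_move t l1 l2.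
exists (a * b); first by rewrite mulf_neq0.
have -> : word (t :: q1) - (a * b) *: word (l1 ++ t :: l2) = g t (word q1 - a *: word (l1 ++ l2))
    + a *: (word (t :: l1 ++ l2) - b *: word (l1 ++ t :: l2)).
  by rewrite lfunD lfunN lfunZ scalerBr scalerA addrA subrK.
rewrite -(perm_size q1l) in Hb; by rewrite rpredD ?rpredZ ?Fil_low.
Qed.
End Words.

(** * Rewriting words into the monomials of S(lambda) *)

Section Spanning.
Variables (K : fieldType) (al : K) (V : vectType K).
Variables (e f h : 'I_3 -> 'End(V)) (o : bool -> bool -> bool -> 'End(V)) (v : V).
Variables (m : 'I_3 -> nat).
Hypothesis K_char0 : [pchar K] =i pred0.
Hypothesis rep : d21_rep al e f h o.
Hypothesis ev : forall i, e i v = 0.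
Hypothesis zv : forall b c, o false b c v = 0.
Hypothesis hv : forall i, h i v = (m i)%:R *: v.
Hypothesis m0_ge3 : (3 <= m 0%R)%N.

Local Notation F := (f 0).
Local Notation y := (o true).
Local Notation z := (o false).
Local Notation low := (low f o).
Local Notation word := (word low v).
Local Notation Fil := (Fil low v).

Let natr0E n : ((n%:R : K) == 0) = (n == 0%N).
Proof. by move/pcharf0P: K_char0 => ->. Qed.

Lemma low_f i x k : x \in Fil k -> f i x \in Fil k.+1.
Proof. exact: (@Fil_low _ _ low v (inl i)). Qed.

Lemma low_y b c x k : x \in Fil k -> y b c x \in Fil k.+1.
Proof. by have := @Fil_low _ _ low v (inr (~~ b, ~~ c)) k x; rewrite /= !negbK. Qed.

Lemma fy_swap i b c k x : x \in Fil k -> f i (y b c x) - y b c (f i x) \in Fil k.+1.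
Proof.
move=> xk; move: i; apply: ord3P; rewrite (rep_fo0 rep, rep_fo1 rep, rep_fo2 rep) addrC addrA addNr add0r;
  by rewrite rpredZ ?low_y.
Qed.

(** The scalar is -1 for two odd vectors and 1 otherwise. The bracket of two negative root vectors
    is a multiple of a single one or zero, so the error is shorter by one factor. *)
Lemma low_swap t u : exists2 a : K, a != 0 & forall k x, x \in Fil k ->
  low t (low u x) - a *: low u (low t x) \in Fil k.+1.
Proof.
case: t u => [i|p] [j|p'] /=.
- by exists 1 => [|k x xk]; rewrite ?oner_neq0// scale1r (rep_ff rep) subrr rpred0.
- by exists 1 => [|k x xk]; rewrite ?oner_neq0// scale1r fy_swap.
- exists 1 => [|k x xk]; rewrite ?oner_neq0// scale1r -opprB rpredN; exact: fy_swap.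
- exists (-1) => [|k x xk]; first by rewrite oppr_eq0 oner_neq0.
  by rewrite scaleN1r opprK (yyE_rep rep) addrNK rpredZ ?low_f.
Qed.

Let word_perm := word_perm low_swap.

Inductive bop : 'End(V) -> Prop :=
  | bop_e i : bop (e i)
  | bop_h i : bop (h i)
  | bop_z b c : bop (z b c).

(** The operators of [bop] come from the Borel subalgebra, which acts on v by scalars. Move X to the
    right through the word: its bracket with a letter has a Borel part, covered by induction on the
    rest of the word, and a negative part, which merely replaces that letter. *)
Lemma bop_Fil X : bop X -> forall k, {in Fil k, forall x, X x \in Fil k}.
Proof.
move=> bX k; apply: (lspan_sub (N := Fil k) (g := X)) => _ [q qk ->].
elim: q X bX k qk => [|t q IH] X bX k qk.
  by case: bX => [i|i|b c]; rewrite /= ?ev ?hv ?zv ?rpred0// rpredZ// (@word_Fil _ _ _ _ [::]).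
case: k qk => // k qk; have wk : word q \in Fil k by exact: word_Fil.
have {}IH Y : bop Y -> Y (word q) \in Fil k by move=> bY; exact: IH.
have up x : x \in Fil k -> x \in Fil k.+1 by exact: FilS.
have IHe i : e i (word q) \in Fil k by apply: IH; constructor.
have IHh i : h i (word q) \in Fil k by apply: IH; constructor.
have IHz b c : z b c (word q) \in Fil k by apply: IH; constructor.
have IHv (e' f' h' : 'End(V)) a b : e' (word q) \in Fil k.+1 -> f' (word q) \in Fil k.+1 ->
    h' (word q) \in Fil k.+1 -> sl2_vec e' f' h' a b (word q) \in Fil k.+1.
  by move=> eq fq hq; rewrite /sl2_vec; case: ifP => _; [case: ifP => _|]; rewrite lfunE /= ?rpredZ ?rpredN.
clear qk; case: bX t => [i|i|b c] [j|[b' c']] /=.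
- by rewrite (rep_ef rep) rpredD ?rpredZ ?low_f ?up.
- by move: i; apply: ord3P; rewrite (rep_eo0 rep, rep_eo1 rep, rep_eo2 rep); apply: rpredD;
    rewrite ?low_y//; apply: rpredZ; (exact: low_y || exact: up).
- by rewrite (rep_hf rep) rpredB ?rpredZ ?low_f.
- by move: i; apply: ord3P; rewrite (rep_ho0 rep, rep_ho1 rep, rep_ho2 rep) rpredD ?rpredZ//;
    rewrite ?low_y.
- have -> : z b c (f j (word q)) = f j (z b c (word q)) - (f j (z b c (word q)) - z b c (f j (word q))).
    by rewrite opprB addrCA subrr addr0.
  rewrite rpredB ?low_f//; move: j; apply: ord3P.
  + by rewrite (rep_fo0 rep) addrAC subrr add0r rpredZ ?low_y.
  + by rewrite (rep_fo1 rep) addrAC subrr add0r rpredZ ?up.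
  + by rewrite (rep_fo2 rep) addrAC subrr add0r rpredZ ?up.
- rewrite (zyE_rep rep); apply: rpredB; last exact: low_y.
  apply: rpredD; [apply: rpredD|]; apply: rpredZ; first exact: up.
    by apply: IHv; [exact: up|exact: low_f wk|exact: up].
  by apply: IHv; [exact: up|exact: low_f wk|exact: up].
Qed.

(* The number of factors F and y c d. *)
Definition cnt (q : seq proot) : nat :=
  count (fun t => if t is inl i then i == 0%R else true) q.

(** Membership says that a vector can be rewritten with at most c factors F or y, modulo shorter
    words. A word with c + 1 such factors that lies in this space is what the induction on [cnt]
    needs. *)
Definition Good (k c : nat) : submodClosed V :=
  lspan (fun w => w \in Fil k \/ exists q, [/\ size q = k, (cnt q <= c)%N & w = word q]).

Lemma Fil_Good k c x : x \in Fil k -> x \in Good k c.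
Proof. by move=> xk; apply: lspan_gen; left. Qed.

Lemma word_Good q k c : size q = k -> (cnt q <= c)%N -> word q \in Good k c.
Proof. by move=> qk qc; apply: lspan_gen; right; exists q. Qed.

Lemma GoodS k c c' : (c <= c')%N -> {subset Good k c <= Good k c'}.
Proof.
move=> cc'; apply: lspan_le => x [xk|[q [qk qc ->]]]; first exact: Fil_Good.
by apply: word_Good => //; apply: leq_trans cc'.
Qed.

Lemma Good_low t k c x : x \in Good k c -> low t x \in Good k.+1 (cnt [:: t] + c).
Proof.
apply: (@lspan_sub _ _ (Good k.+1 _) (low t)) => w [xk|[q [qk qc ->]]].
  exact: Fil_Good (Fil_low _ xk).
by apply: (@word_Good (t :: q)); rewrite /= ?qk// /cnt /= addn0 leq_add2l.
Qed.

Lemma Good_f0 k c x : x \in Good k c -> F x \in Good k.+1 c.+1.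
Proof. exact: (@Good_low (inl 0)). Qed.
Lemma Good_f i k c x : i != 0 -> x \in Good k c -> f i x \in Good k.+1 c.
Proof. by move=> i0 /(@Good_low (inl i)); rewrite /= (negPf i0). Qed.
Lemma Good_y b d k c x : x \in Good k c -> y b d x \in Good k.+1 c.+1.
Proof. by move=> /(@Good_low (inr (~~ b, ~~ d))); rewrite /= !negbK. Qed.

Lemma sl2_vec_Good i a b q : i != 0 ->
  sl2_vec (e i) (f i) (h i) a b (word q) \in Good (size q).+1 (cnt q).
Proof.
move=> i0; rewrite /sl2_vec; case: ifP => _; [case: ifP => _|]; rewrite lfunE /= ?rpredZ ?rpredN//.
- by apply: Good_f => //; exact: word_Good.
- by apply: Fil_Good; apply: bop_Fil (word_Fil _ _ (ltnSn _)); constructor.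
- by apply: Fil_Good; apply: bop_Fil (word_Fil _ _ (ltnSn _)); constructor.
Qed.

(** The anticommutator of z and y lies in the span of H and the other two copies of sl_2. Only f_2
    and f_3 lengthen the word, and [cnt] does not see them. *)
Lemma zy_Good b c b' c' q :
  z b c (y b' c' (word q)) + y b' c' (z b c (word q)) \in Good (size q).+1 (cnt q).
Proof.
rewrite (zyE_rep rep) addrNK !rpredD ?rpredZ ?sl2_vec_Good//.
by apply: Fil_Good; apply: bop_Fil (word_Fil _ _ (ltnSn _)); constructor.
Qed.

(** Moving z past F replaces F by a y, which counts the same; moving it past f_2 or f_3 yields
    another z, which does not lengthen the word; and its anticommutator with a y is controlled by
    [zy_Good]. *)
Lemma z_Good b c k d : {in Good k d, forall x, z b c x \in Good k d}.
Proof.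
have zF : bop (z b c) by constructor.
apply: (lspan_sub (N := Good k d) (g := z b c)) => w [xk|[q [<- qd ->]]].
  by apply: Fil_Good; apply: bop_Fil xk.
apply: (GoodS qd); elim: q b c zF {qd} => [|t q IH] b c zF; first by rewrite /= zv rpred0.
case: t => [i|[b' c']] /=.
  have -> : z b c (f i (word q)) = f i (z b c (word q)) - (f i (z b c (word q)) - z b c (f i (word q))).
    by rewrite opprB addrCA subrr addr0.
  have zq : z b c (word q) \in Good (size q) (cnt q) by apply: IH; constructor.
  rewrite rpredB//; first by have := @Good_low (inl i) _ _ _ zq; rewrite /cnt /= addn0.
  have wq b1 c1 : z b1 c1 (word q) \in Fil (size q).+1.
    by apply: bop_Fil (word_Fil _ _ (ltnSn _)); constructor.
  move: i; apply: ord3P.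
  - by rewrite (rep_fo0 rep) addrAC subrr add0r rpredZ ?Good_y ?word_Good.
  - by rewrite (rep_fo1 rep) addrAC subrr add0r rpredZ ?Fil_Good.
  - by rewrite (rep_fo2 rep) addrAC subrr add0r rpredZ ?Fil_Good.
have zyD : z b c (y (~~ b') (~~ c') (word q)) = z b c (y (~~ b') (~~ c') (word q))
    + y (~~ b') (~~ c') (z b c (word q)) - y (~~ b') (~~ c') (z b c (word q)) by rewrite addrK.
rewrite zyD rpredB//.
  by apply: (GoodS _ (zy_Good _ _ _ _ _)); rewrite /cnt /= leqnSn.
by apply: Good_y; apply: IH; constructor.
Qed.

(** Contracting z with a factor y uses up this factor and creates at most an f_2 or f_3; hence the
    count drops by one. For empty A the vector is 0, as z kills v. *)
Lemma z_odd_word b c (A : seq (bool * bool)) :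
  z b c (word (map inr A)) \in Good (size A) (size A).-1.
Proof.
have cntA B : cnt (map inr B) = size B by rewrite /cnt count_map (eq_count (a2 := predT)) ?count_predT.
elim: A => [|p A IH] /=; first by rewrite zv rpred0.
set w := word _.
have zyD : z b c (y (~~ p.1) (~~ p.2) w) = z b c (y (~~ p.1) (~~ p.2) w)
    + y (~~ p.1) (~~ p.2) (z b c w) - y (~~ p.1) (~~ p.2) (z b c w) by rewrite addrK.
rewrite zyD rpredB//.
  by have := zy_Good b c (~~ p.1) (~~ p.2) (map inr A); rewrite size_map cntA.
rewrite /w; case: A IH {w zyD} => [|p' A] IH; first by rewrite /= zv linear0 rpred0.
exact: Good_y IH.
Qed.

Lemma iter_F_Good n k c x : x \in Good k c -> iter n F x \in Good (n + k) (n + c).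
Proof. by move=> xk; elim: n => //= n; exact: Good_f0. Qed.

(* Apply z_p to F^(n+1) y_A v, which lies in Good by induction: it produces F^n y_p y_A v. *)
Lemma top_word_Good (A : seq (bool * bool)) : (size A <= (m 0%R).+1)%N ->
  word (nseq ((m 0%R).+1 - size A) (inl 0) ++ map inr A) \in Good (m 0%R).+1 (m 0%R).
Proof.
elim: A => [|p A IH] Am.
  rewrite subn0 cats0 -[word _]/(foldr _ _ _) foldr_nseq.
  by rewrite (iter_f_top K_char0 (ef_same rep 0) (hf_same rep 0) (ev 0) (hv 0)) rpred0.
set n := ((m 0%R).+1 - size (p :: A))%N.
have nE : ((m 0%R).+1 - size A = n.+1)%N by rewrite /n /= subSS subSn.
set w := word (map inr A).
have W k : word (nseq k (inl 0) ++ map inr A) = iter k F w by rewrite word_cat foldr_nseq.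
rewrite /= in Am; have {IH} := IH (ltnW Am); rewrite nE W => IH.
have zF k : z (~~ p.1) (~~ p.2) (iter k F w) =
    iter k F (z (~~ p.1) (~~ p.2) w) - k%:R *: iter k.-1 F (y (~~ p.1) (~~ p.2) w).
  elim: k => [|k IHk] /=; first by rewrite scale0r subr0.
  rewrite (zF_rep rep) IHk linearB linearZ /=.
  have yF : y (~~ p.1) (~~ p.2) (iter k F w) = iter k F (y (~~ p.1) (~~ p.2) w).
    by rewrite (sl2_commute_iter (g := y _ _))// => x; rewrite (Fy_rep rep).
  rewrite yF -addrA -opprD; congr (_ - _).
  case: k {IHk yF} => [|k] /=; first by rewrite scale0r add0r scale1r.
  by rewrite -[in RHS]natr1 scalerDl scale1r.
have Fz : iter n.+1 F (z (~~ p.1) (~~ p.2) w) \in Good (m 0%R).+1 (m 0%R).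
  have := iter_F_Good n.+1 (z_odd_word (~~ p.1) (~~ p.2) A).
  rewrite (_ : n.+1 + size A = (m 0%R).+1)%N; last by rewrite -nE subnK// ltnW.
  case: (A) Am nE @w {W zF IH} => [|p' A'] Am nE w; last by apply: GoodS; rewrite /= in nE *; lia.
  by move=> _; rewrite /w /= zv iter_f0 linear0 rpred0.
have := rpredB Fz (z_Good (~~ p.1) (~~ p.2) IH); rewrite zF opprB addrCA subrr addr0 /= => nX.
have n0 : (n.+1%:R : K) != 0 by rewrite natr0E.
have := rpredZ n.+1%:R^-1 nX; rewrite scalerA mulVf// scale1r.
by move=> X; rewrite word_cat foldr_nseq; exact: X.
Qed.

Definition Std (k : nat) : submodClosed V := lspan (fun w => exists s : {ffun proot -> nat},
  [/\ s \in Slambda (m 0) (m 1) (m 2%:R), (\sum_t s t < k)%N & w = pbw f o v s]).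

Lemma StdS k : {subset Std k <= Std k.+1}.
Proof.
by apply: lspan_le => _ [s [sS sk ->]]; apply: lspan_gen; exists s; split=> //; exact: leqW.
Qed.

Lemma std_roots_perm : perm_eq std_roots (enum {: proot}).
Proof.
apply: uniq_perm; rewrite ?enum_uniq// => t; rewrite mem_enum inE.
by case: t => [i|[[] []]] //; move: i; apply: ord3P.
Qed.

Lemma pbw_word (s : {ffun proot -> nat}) : pbw f o v s = word (exps std_roots s).
Proof. by rewrite word_exps. Qed.

Let fvec_zero i j : (m 1%R < i)%N || (m 2%:R%R < j)%N -> fvec f v i j = 0.
Proof.
case/orP => [mi|mj]; first exact: (fvec_top1 K_char0 rep ev hv).
exact: (fvec_top2 K_char0 rep ev hv).
Qed.

Let y_sq b c x : y b c (y b c x) = 0. Proof. exact: (y_sq_rep K_char0 rep). Qed.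

Lemma iter_y_eq0 n b c x : (1 < n)%N -> iter n (y b c) x = 0.
Proof. by case: n => [|[|n]] //= _; rewrite y_sq. Qed.

Lemma pbw_eq0 (s : {ffun proot -> nat}) :
  [|| [exists p : bool * bool, 1 < s (inr p)], m 1%R < s (inl 1%R) | m 2%:R%R < s (inl 2%:R%R)]%N ->
  pbw f o v s = 0.
Proof.
rewrite /pbw /= -/(fvec f v _ _); case/orP => [/existsP[[[] []] s2]|/fvec_zero ->].
- by rewrite (iter_y_eq0 _ _ _ s2) !iter_f0.
- by rewrite (iter_y_eq0 _ _ _ s2) !iter_f0.
- by rewrite (iter_y_eq0 _ _ _ s2) !iter_f0.
- by rewrite (iter_y_eq0 _ _ _ s2) !iter_f0.
- by rewrite !iter_f0.
Qed.

Lemma sum_bool2 (G : bool * bool -> nat) :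
  (\sum_p G p = G (true, true) + G (true, false) + G (false, true) + G (false, false))%N.
Proof.
rewrite (eq_bigr (fun p => G (p.1, p.2))) => [|[]//].
by rewrite -(pair_bigA _ (fun b c => G (b, c))) /= !big_bool /= addnA.
Qed.

Lemma cnt_exps (s : proot -> nat) : cnt (exps std_roots s) = (\sum_p s (inr p) + s (inl 0%R))%N.
Proof. by rewrite sum_bool2 /cnt /exps /= !count_cat !count_nseq /= !mul1n !mul0n !addn0 addnC !addnA. Qed.

Lemma size_exps_std (s : proot -> nat) : size (exps std_roots s) = (\sum_t s t)%N.
Proof. by rewrite size_exps (perm_big _ std_roots_perm) big_enum. Qed.

Definition mult (q : seq proot) : {ffun proot -> nat} := [ffun t => count_mem t q].

Lemma mult_perm q : perm_eq q (exps std_roots (mult q)).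
Proof.
have := exps_count_perm q std_roots_perm; congr (perm_eq _ (flatten _)).
by apply: eq_map => t; rewrite ffunE.
Qed.

Lemma cnt_mult q : cnt q = (\sum_p mult q (inr p) + mult q (inl 0%R))%N.
Proof. by rewrite -cnt_exps /cnt; apply/permP; exact: mult_perm. Qed.

Lemma word_pbw q : exists2 a : K, a != 0 & word q - a *: pbw f o v (mult q) \in Fil (size q).
Proof. by rewrite pbw_word; apply: word_perm; exact: mult_perm. Qed.

Lemma Good_cat q k c x : x \in Good k c ->
  foldr (fun t u => low t u) x q \in Good (size q + k) (cnt q + c).
Proof.
by move=> xk; elim: q => //= t q /(@Good_low t); rewrite /cnt /= addn0 addnA.
Qed.

Lemma dup_word k q (N : submodClosed V) : {subset Fil k <= N} -> size q = k ->
  pbw f o v (mult q) \in N -> word q \in N.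
Proof.
move=> FN qk pN; have [a _] := word_pbw q; rewrite qk => /FN qN.
by rewrite -(subrK (a *: pbw f o v (mult q)) (word q)) rpredD ?rpredZ.
Qed.

(** Inside the induction on the length there is one on the bound c for [cnt]. A word with [cnt] at
    most m 0 is, modulo shorter ones, a multiple of a monomial that either lies in [Slambda] or
    vanishes, because y^2 = 0 or a power of f_2 or f_3 is too high. A word with larger [cnt] and no
    repeated y contains, up to order, a word of [top_word_Good], and loses at least one counted
    factor. *)
Lemma Fil_Std k : {subset Fil k <= Std k}.
Proof.
elim: k => [|k IH]; first by move=> x /Fil0 ->; rewrite rpred0.
have FS : {subset Fil k <= Std k.+1} by move=> x /IH /StdS.
have small q : (cnt q <= m 0%R)%N -> size q = k -> word q \in Std k.+1.
  move=> qm qk; apply: (dup_word FS qk).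
  have [bad|] := boolP [|| [exists p : bool * bool, 1 < mult q (inr p)],
    m 1%R < mult q (inl 1%R) | m 2%:R%R < mult q (inl 2%:R%R)]%N; first by rewrite pbw_eq0// rpred0.
  rewrite !negb_or -!leqNgt negb_exists => /and3P[/forallP q1 qm1 qm2].
  apply: lspan_gen; exists (mult q); split=> //.
    apply/and4P; split=> //; first by rewrite -cnt_mult.
    by apply/forallP => p; rewrite leqNgt q1.
  by rewrite -size_exps_std -(perm_size (mult_perm q)) qk.
have big c q : (cnt q <= c)%N -> size q = k -> word q \in Std k.+1.
  elim: c q => [|c IHc] q qc qk; first by apply: small => //; apply: leq_trans qc _.
  have [/small->//|mq] := leqP (cnt q) (m 0).
  have [dup|] := boolP [exists p : bool * bool, 1 < mult q (inr p)]%N.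
    by apply: (dup_word FS qk); rewrite pbw_eq0 ?dup// rpred0.
  rewrite negb_exists => /forallP q1.
  pose A := [seq p <- enum {: bool * bool} | mult q (inr p) == 1%N].
  have cA p : count_mem p A = mult q (inr p).
    rewrite count_uniq_mem; last by rewrite filter_uniq ?enum_uniq.
    rewrite /A seq.mem_filter mem_enum andbT.
    by have := q1 p; case: (mult q _) => [|[|]].
  have sA : size A = (\sum_p mult q (inr p))%N.
    rewrite -sum1_size big_filter big_enum_cond /= big_mkcond /=; apply: eq_bigr => p _.
    by have := q1 p; case: (mult q _) => [|[|]].
  (* There are only four odd roots, and m 0 + 1 is at least 4. *)
  have A4 : (size A <= (m 0%R).+1)%N.
    have Q p : (mult q (inr p) <= 1)%N by rewrite leqNgt.
    rewrite sA sum_bool2; apply: (@leq_trans 4); last exact: m0_ge3.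
    by apply: (@leq_trans (1 + 1 + 1 + 1)) => //; rewrite !leq_add.
  pose n := ((m 0%R).+1 - size A)%N.
  have nF : (n <= mult q (inl 0%R))%N by move: mq; rewrite cnt_mult -sA /n; lia.
  (* The factors outside the chosen word with m 0 + 1 counted letters. Rewriting that word with m 0
     of them brings the total from at most c + 1 down to at most c. *)
  pose q2 := nseq (mult q (inl 1)) (inl 1 : proot) ++ nseq (mult q (inl 2%:R)) (inl 2%:R)
     ++ nseq (mult q (inl 0) - n) (inl 0).
  have qp : perm_eq q (q2 ++ (nseq n (inl 0) ++ map inr A)).
    apply/allP => t _ /=; rewrite -[count_mem t q](ffunE (fun t => count_mem t q)) -/(mult q).
    rewrite !count_cat !count_nseq count_map.
    case: t => [i|p]; last first.
      rewrite (eq_count (a2 := pred1 p)) => [|p' /=]; last by rewrite (inj_eq (@inr_inj _ _)).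
      by rewrite cA /= !mul0n !add0n.
    rewrite (eq_count (a2 := pred0)) ?count_pred0 ?addn0; last by [].
    move: i; apply: ord3P => /=; rewrite ?mul1n ?mul0n ?addn0 ?add0n //.
    by rewrite subnK.
  have [a _] := word_perm qp; rewrite qk => qa.
  rewrite -(subrK (a *: word (q2 ++ (nseq n (inl 0) ++ map inr A))) (word q)).
  apply: rpredD; first exact: FS; apply: rpredZ.
  have := Good_cat q2 (top_word_Good A4); rewrite -word_cat.
  have size2 : (size q2 + (m 0%R).+1 = k)%N.
    have sq : size (nseq n (inl 0 : proot) ++ map inr A) = (m 0%R).+1.
      by rewrite size_cat size_nseq size_map subnK.
    by rewrite -qk (perm_size qp) [RHS]size_cat sq.
  have cnt2 : (cnt q2 + m 0%R <= c)%N.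
    have -> : cnt q2 = (mult q (inl 0%R) - n)%N.
      by rewrite /q2 /cnt !count_cat !count_nseq /= !mul0n mul1n !add0n.
    have := cnt_mult q; rewrite -sA => cq; move: mq qc nF; rewrite cq /n; lia.
  rewrite size2 => /(GoodS cnt2); apply: lspan_le => x [/FS//|[q' [q'k q'c ->]]].
  exact: IHc.
by apply: lspan_le => x [q qk ->]; move: qk; rewrite ltnS leq_eqVlt => /predU1P[qk|/word_Fil/FS//]; exact: big qk.
Qed.
End Spanning.

(** * Root vectors of D(2,1;alpha) *)

Section RootVectors.
Variables (K : fieldType) (al : K).
Local Notation sl2 := (sl2 K).
Local Notation br := (D21_br al).

Definition even_elt (i : 'I_3) (A : 'M[K]_2) : even_part K :=
  [ffun j => if j == i then vsproj sl2 A else 0].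
Definition odd_elt (a b c : bool) : odd_part K :=
  [ffun d => (d == odd_mk (inord a) (inord b) (inord c))%:R].

Definition even_e i : even_part K := even_elt i (delta_mx 0 1).
Definition even_f i : even_part K := even_elt i (delta_mx 1 0).
Definition even_h i : even_part K := even_elt i (delta_mx 0 0 - delta_mx 1 1).

Definition d21_e i : D21 K := (even_e i, 0).
Definition d21_f i : D21 K := (even_f i, 0).
Definition d21_h i : D21 K := (even_h i, 0).
Definition d21_o a b c : D21 K := (0, odd_elt a b c).

Lemma even_elt_entry i A j r s : \tr A = 0 -> vsval (even_elt i A j) r s = (j == i)%:R * A r s.
Proof.
move=> trA; rewrite ffunE; case: eqP => _; last by rewrite linear0 mxE mul0r.
by rewrite vsprojK ?mul1r// mem_sl2 trA.
Qed.

Let tr_e : \tr (delta_mx 0 1 : 'M[K]_2) = 0. Proof. by rewrite /mxtrace sum2 !mxE /= addr0. Qed.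
Let tr_f : \tr (delta_mx 1 0 : 'M[K]_2) = 0. Proof. by rewrite /mxtrace sum2 !mxE /= addr0. Qed.
Let tr_h : \tr (delta_mx 0 0 - delta_mx 1 1 : 'M[K]_2) = 0.
Proof. by rewrite /mxtrace sum2 !mxE /= subr0 sub0r subrr. Qed.

Lemma e_entry i j : (vsval (even_e i j) 0 1 = (j == i)%:R) *
  (vsval (even_e i j) 1 0 = 0) * (vsval (even_e i j) 0 0 = 0).
Proof. by rewrite !even_elt_entry ?tr_e// !mxE /= mulr1 mulr0. Qed.
Lemma f_entry i j : (vsval (even_f i j) 0 1 = 0) *
  (vsval (even_f i j) 1 0 = (j == i)%:R) * (vsval (even_f i j) 0 0 = 0).
Proof. by rewrite !even_elt_entry ?tr_f// !mxE /= mulr1 mulr0. Qed.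
Lemma h_entry i j : (vsval (even_h i j) 0 1 = 0) *
  (vsval (even_h i j) 1 0 = 0) * (vsval (even_h i j) 0 0 = (j == i)%:R).
Proof. by rewrite !even_elt_entry ?tr_h// !mxE /= !subr0 mulr1 !mulr0. Qed.

Lemma odd_elt_entry a b c a' b' c' : odd_elt a b c (odd_mk a' b' c') =
  (if a' == 0 then (~~ a)%:R else a%:R) * (if b' == 0 then (~~ b)%:R else b%:R)
  * (if c' == 0 then (~~ c)%:R else c%:R).
Proof.
have E (x : bool) (t : 'I_2) : (t == inord x)%:R = (if t == 0 then (~~ x)%:R else x%:R) :> K.
  by elim/ord2P: t; case: x; rewrite -val_eqE /= inordK.
rewrite ffunE -!E -!mulrA -!natrM !mulnb; congr (nat_of_bool _)%:R.
apply/eqP/and3P => [/ffunP o|[/eqP-> /eqP-> /eqP->]//].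
by have := (o 0, o 1, o 2%:R); rewrite !odd_mk_val => -[[-> ->] ->]; rewrite !eqxx.
Qed.

Lemma D21_eqP (x x' : D21 K) : x.1 = x'.1 -> x.2 = x'.2 -> x = x'.
Proof. by case: x x' => [? ?] [? ?] /= -> ->. Qed.

Lemma even0_entry j r s : vsval ((0 : even_part K) j) r s = 0.
Proof. by rewrite ffunE linear0 mxE. Qed.

Definition entries := (e_entry, f_entry, h_entry).

Lemma br_even (X Y : even_part K) : br (X, 0) (Y, 0) = (evbr X Y, 0).
Proof. by rewrite D21_brE /= !D21z. Qed.
Lemma br_even_odd (X : even_part K) u : br (X, 0) (0, u) = (0, tensor_act X u).
Proof. by rewrite D21_brE /= !D21z. Qed.
Lemma br_odd (u w : odd_part K) : br (0, u) (0, w) = (odd_br al u w, 0).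
Proof. by rewrite D21_brE /= !D21z. Qed.

Lemma even_eq1P (X Y : even_part K) : (forall j, (vsval (X j) 0 1 = vsval (Y j) 0 1) *
  (vsval (X j) 1 0 = vsval (Y j) 1 0) * (vsval (X j) 0 0 = vsval (Y j) 0 0)) -> X = Y.
Proof. by move=> XY; apply: even_eqP => j; rewrite XY. Qed.

Let eqCE (i j k : 'I_3) : ((k == i)%:R * (k == j)%:R = (i == j)%:R * (k == i)%:R :> K).
Proof.
rewrite -!natrM !mulnb; congr (nat_of_bool _)%:R.
by have [->|] := eqVneq k i; rewrite ?andbT ?andbF.
Qed.

Let eqCE' (i j k : 'I_3) : ((k == i)%:R * (k == j)%:R = (i == j)%:R * (k == j)%:R :> K).
Proof. by rewrite mulrC eqCE [j == i]eq_sym. Qed.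

Lemma br_ef i j : br (d21_e i) (d21_f j) = (i == j)%:R *: d21_h i.
Proof.
rewrite br_even; apply: D21_eqP => /=; last by rewrite scaler0.
apply: even_eq1P => k; rewrite !evbrE !sl2_br_entry !evenZ !entries.
by do ![split]; rewrite ?eqCE; ring.
Qed.
Lemma br_he i j : br (d21_h i) (d21_e j) = (2 * (i == j)%:R) *: d21_e j.
Proof.
rewrite br_even; apply: D21_eqP => /=; last by rewrite scaler0.
apply: even_eq1P => k; rewrite !evbrE !sl2_br_entry !evenZ !entries.
by do ![split]; rewrite -?mulrA -?eqCE'; ring.
Qed.
Lemma br_hf i j : br (d21_h i) (d21_f j) = (- 2 * (i == j)%:R) *: d21_f j.
Proof.
rewrite br_even; apply: D21_eqP => /=; last by rewrite scaler0.
apply: even_eq1P => k; rewrite !evbrE !sl2_br_entry !evenZ !entries.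
by do ![split]; rewrite -?mulrA -?eqCE'; ring.
Qed.
Lemma br_ff i j : br (d21_f i) (d21_f j) = 0.
Proof.
rewrite br_even; apply: D21_eqP => //=.
apply: even_eq1P => k; rewrite !evbrE !sl2_br_entry !even0_entry !entries.
by do ![split]; ring.
Qed.
Lemma D21_odd_eqP (X : even_part K) (u w : odd_part K) : (forall a b c, u (odd_mk a b c) = w (odd_mk a b c)) ->
  (X, u) = (X, w) :> D21 K.
Proof. by move=> uw; apply: D21_eqP => //=; exact: odd_part_eqP. Qed.

Let oddE := (tensor_actE, oddZ, odd_elt_entry).
Let zeroZ k u : k *: ((0 : even_part K), u) = (0, k *: u) :> D21 K.
Proof. by apply: D21_eqP; rewrite //= scaler0. Qed.
Local Ltac act_odd a := rewrite br_even_odd /d21_o ?zeroZ; apply: D21_odd_eqP;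
  elim/ord2P; elim/ord2P; elim/ord2P; rewrite !oddE /= ?sl2_tr ?entries /=; case: a; rewrite /=; ring.

Lemma br_eo0 a b c : br (d21_e 0) (d21_o a b c) = a%:R *: d21_o false b c.
Proof. act_odd a. Qed.
Lemma br_eo1 a b c : br (d21_e 1) (d21_o a b c) = b%:R *: d21_o a false c.
Proof. act_odd b. Qed.
Lemma br_eo2 a b c : br (d21_e 2%:R) (d21_o a b c) = c%:R *: d21_o a b false.
Proof. act_odd c. Qed.
Lemma br_fo0 a b c : br (d21_f 0) (d21_o a b c) = (~~ a)%:R *: d21_o true b c.
Proof. act_odd a. Qed.
Lemma br_fo1 a b c : br (d21_f 1) (d21_o a b c) = (~~ b)%:R *: d21_o a true c.
Proof. act_odd b. Qed.
Lemma br_fo2 a b c : br (d21_f 2%:R) (d21_o a b c) = (~~ c)%:R *: d21_o a b true.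
Proof. act_odd c. Qed.
Lemma br_ho0 a b c : br (d21_h 0) (d21_o a b c) = (-1) ^+ a *: d21_o a b c.
Proof. act_odd a. Qed.
Lemma br_ho1 a b c : br (d21_h 1) (d21_o a b c) = (-1) ^+ b *: d21_o a b c.
Proof. act_odd b. Qed.
Lemma br_ho2 a b c : br (d21_h 2%:R) (d21_o a b c) = (-1) ^+ c *: d21_o a b c.
Proof. act_odd c. Qed.

Lemma omE b b' : om K b b' = (~~ b)%:R * b'%:R - b%:R * (~~ b')%:R.
Proof. by rewrite /om -!natrM !mulnb. Qed.

(** The element that acts as [sl2_vec]. It is polynomial in the truth values, not defined by cases,
    so that [br_oo] becomes a ring identity in them. *)
Definition sl2_elt (i : 'I_3) (a b : bool) : D21 K :=
  (2 * (~~ a)%:R * (~~ b)%:R) *: d21_e i - (2 * a%:R * b%:R) *: d21_f i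
  - ((~~ a)%:R * b%:R + a%:R * (~~ b)%:R) *: d21_h i.

Lemma even_lin3_entry (x y z : K) (X Y Z : even_part K) k r s :
  vsval ((x *: X + y *: Y + z *: Z) k) r s
  = x * vsval (X k) r s + y * vsval (Y k) r s + z * vsval (Z k) r s.
Proof. by rewrite !(evenD, evenZ). Qed.

Definition sl2_even (i : 'I_3) (a b : bool) : even_part K :=
  (2 * (~~ a)%:R * (~~ b)%:R) *: even_e i + (- (2 * a%:R * b%:R)) *: even_f i
  + (- ((~~ a)%:R * b%:R + a%:R * (~~ b)%:R)) *: even_h i.

Lemma sl2_eltE i a b : sl2_elt i a b = (sl2_even i a b, 0).
Proof. by apply: D21_eqP => /=; rewrite ?scaler0 ?subr0 // /sl2_even !scaleNr. Qed.

Lemma sl2_even_entry i a b k :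
  (vsval (sl2_even i a b k) 0 1 = (k == i)%:R * (2 * (~~ a)%:R * (~~ b)%:R)) *
  (vsval (sl2_even i a b k) 1 0 = - (k == i)%:R * (2 * a%:R * b%:R)) *
  (vsval (sl2_even i a b k) 0 0 = - (k == i)%:R * ((~~ a)%:R * b%:R + a%:R * (~~ b)%:R)).
Proof. by do ![split]; rewrite even_lin3_entry !entries; ring. Qed.

Hypothesis two_neq0 : 2 != 0 :> K.

Lemma br_oo a b c a' b' c' : br (d21_o a b c) (d21_o a' b' c') =
  (- (1 + al) * (om K b b' * om K c c')) *: sl2_elt 0 a a'
  + (om K a a' * om K c c') *: sl2_elt 1 b b'
  + (al * (om K a a' * om K b b')) *: sl2_elt 2%:R c c'.
Proof.
have e0 : 2 * eps_norm al 0 = - (1 + al) by rewrite /eps_norm /=; field.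
have e1 : 2 * eps_norm al 1 = 1 by rewrite /eps_norm /=; field.
have e2 : 2 * eps_norm al 2%:R = al by rewrite /eps_norm /=; field.
rewrite br_odd !sl2_eltE; apply: D21_eqP; last by rewrite /= !(scaler0, addr0).
apply: even_eqP; apply: ord3P; rewrite ?odd_br0 ?odd_br1 ?odd_br2 /= even_lin3_entry;
  by rewrite !sl2_even_entry ?e0 ?e1 ?e2 !odd_elt_entry /= !omE; ring.
Qed.
End RootVectors.

Section RootSpaces.
Variables (K : fieldType) (al : K).
Hypothesis K_char0 : [pchar K] =i pred0.
Local Notation br := (D21_br al).

Let natr0E n : ((n%:R : K) == 0) = (n == 0%N).
Proof. by move/pcharf0P: K_char0 => ->. Qed.
Let two_neq0 : 2 != 0 :> K. Proof. by rewrite natr0E. Qed.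

Lemma cartan_h i : d21_h K i \in cartan (K := K).
Proof.
apply/andP; split=> //; apply/forallP => j; apply/is_diag_mxP => r s.
by elim/ord2P: r; elim/ord2P: s => //; rewrite /= h_entry.
Qed.

Lemma cartan_sum (x : D21 K) : x \in cartan (K := K) -> x = \sum_i vsval (x.1 i) 0 0 *: d21_h K i.
Proof.
case: x => X u /andP[/eqP /= -> /forallP Xd]; rewrite sum3; apply: D21_eqP; last first.
  by rewrite /= !scaler0 !addr0.
rewrite /=; apply: even_eqP => k; rewrite even_lin3_entry !entries ?mulr0 ?addr0.
- by have /is_diag_mxP -> := Xd k.
- by have /is_diag_mxP -> := Xd k.
by move: k {Xd}; apply: ord3P; rewrite /= ?mulr0 ?mulr1 ?addr0 ?add0r.
Qed.

Lemma wt_eval_h (l : weight K) i : wt_eval l (d21_h K i) = l 0 i.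
Proof.
rewrite /wt_eval (bigD1 i) //= h_entry eqxx mulr1 big1 ?addr0// => j /negPf ji.
by rewrite h_entry ji mulr0.
Qed.

Lemma root_spaceP (l : weight K) (x : D21 K) :
  root_space al l x <-> forall i, br (d21_h K i) x = l 0 i *: x.
Proof.
split=> [xl i|xl H Hc]; first by rewrite xl ?cartan_h// wt_eval_h.
have br_sum (c : 'I_3 -> K) : br (\sum_i c i *: d21_h K i) x = \sum_i c i *: br (d21_h K i) x.
  have lin := D21_br_linl al x.
  have br0 : br 0 x = 0 by have := lin (-1) 0 0; rewrite scaler0 addr0 scaleN1r addNr.
  apply: (big_rec2 (fun a b => br a x = b)) => // i a b _ ab.
  by rewrite lin ab.
rewrite {1}(cartan_sum Hc) br_sum /wt_eval scaler_suml; apply: eq_bigr => i _.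
by rewrite xl scalerA mulrC.
Qed.

Definition lowel (t : proot) : D21 K :=
  match t with inl i => d21_f K i | inr p => d21_o K true (~~ p.1) (~~ p.2) end.

Lemma root_wtE (t : proot) j : root_wt K t 0 j =
  match t with inl i => 2 * (i == j)%:R
  | inr p => (j == 0)%:R + (-1) ^+ p.1 * (j == 1)%:R + (-1) ^+ p.2 * (j == 2%:R)%:R end.
Proof.
by case: t => [i|p]; rewrite /root_wt /eps !mxE eqxx /= ?[j == i]eq_sym.
Qed.

Lemma br_h_even j (X : even_part K) (u : odd_part K) k :
  (vsval ((br (d21_h K j) (X, u)).1 k) 0 1 = 2 * (k == j)%:R * vsval (X k) 0 1) *
  (vsval ((br (d21_h K j) (X, u)).1 k) 1 0 = - (2 * (k == j)%:R) * vsval (X k) 1 0) *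
  (vsval ((br (d21_h K j) (X, u)).1 k) 0 0 = 0).
Proof.
rewrite D21_brE /= odd_br0l addr0 evbrE !sl2_br_entry !entries.
by do ![split]; ring.
Qed.

Lemma br_h_odd j (X : even_part K) (u : odd_part K) a b c :
  (br (d21_h K j) (X, u)).2 (odd_mk a b c) =
  (if odd_mk a b c j == 0 then 1 else -1) * u (odd_mk a b c).
Proof.
rewrite D21_brE /= tensor_act0 subr0.
move: j; apply: ord3P; elim/ord2P: a; elim/ord2P: b; elim/ord2P: c;
  rewrite tensor_actE ?sl2_tr !entries !odd_mk_val /=; ring.
Qed.

Lemma lowel_root t : root_space al (- root_wt K t) (lowel t).
Proof.
apply/root_spaceP => j; rewrite mxE root_wtE; case: t => [i|p] /=.
  by rewrite br_hf mulNr [j == i]eq_sym.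
move: j; apply: ord3P; rewrite /= ?br_ho0 ?br_ho1 ?br_ho2 ?mulr0 ?mulr1 ?addr0 ?add0r.
- by [].
- by case: p.1; rewrite /= ?expr0 ?expr1 ?opprK.
- by case: p.2; rewrite /= ?expr0 ?expr1 ?opprK.
Qed.

Let half0 (a : K) : 2 * a = 0 -> a = 0.
Proof. by move/eqP; rewrite mulf_eq0 (negPf two_neq0) => /eqP. Qed.

(** Each coordinate of x belongs to a fixed weight, so its product with the difference between that
    weight and the given one is 0. Except for the coordinate of [lowel t], some such difference is
    an integer between 1 and 4 up to sign, which is invertible in characteristic zero. *)
Lemma root_space_low t (x : D21 K) : root_space al (- root_wt K t) x -> exists c, x = c *: lowel t.
Proof.
move=> /root_spaceP; case: x => X u xt.
have ev j k := (br_h_even j X u k); have od j a b c := (br_h_odd j X u a b c).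
have nz n : (n.+1%:R : K) != 0 by rewrite natr0E.
have wt j : - root_wt K t 0 j = (- root_wt K t) 0 j by rewrite mxE.
have X01 k : (2 + root_wt K t 0 k) * vsval (X k) 0 1 = 0.
  have := (ev k k).1.1; rewrite xt /= evenZ eqxx mulr1 -wt => E.
  by rewrite mulrDl -E mulNr addNr.
have X10 k : (root_wt K t 0 k - 2) * vsval (X k) 1 0 = 0.
  have := (ev k k).1.2; rewrite xt /= evenZ eqxx mulr1 -wt => E.
  by apply/eqP; rewrite mulrBl subr_eq0 -eqr_opp -!mulNr E.
have X00 j k : root_wt K t 0 j * vsval (X k) 0 0 = 0.
  have := (ev j k).2; rewrite xt /= evenZ -wt => /eqP.
  by rewrite mulNr oppr_eq0 => /eqP.
have U j a b c : (root_wt K t 0 j + (if odd_mk a b c j == 0 then 1 else -1)) * u (odd_mk a b c) = 0.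
  have := od j a b c; rewrite xt /= oddZ -wt => E.
  by rewrite mulrDl -E mulNr addrN.
case: t {wt xt ev od} X01 X10 X00 U => [i|[s t]] X01 X10 X00 U.
  exists (vsval (X i) 1 0); apply: D21_eqP => /=; last first.
    apply: odd_part_eqP => a b c; rewrite scaler0 [RHS]ffunE; apply/eqP.
    have /eqP := U i a b c; rewrite root_wtE eqxx mulr1 mulf_eq0 => /orP[|//].
    case: ifP => _; first by rewrite natr1 natr0E.
    by rewrite (_ : 2 - 1 = 1) ?oner_eq0//; ring.
  apply: even_eqP => k; rewrite evenZ !entries ?mulr0.
  - apply/eqP; have /eqP := X01 k; rewrite root_wtE mulf_eq0 => /orP[|//].
    case: (i == k) => /=; last by rewrite mulr0 addr0 natr0E.
    by rewrite mulr1 (_ : 2 + 2 = 4%:R :> K) ?natr0E//; ring.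
  - have [->|ki] := eqVneq k i; rewrite ?mulr1 ?mulr0//; apply/eqP.
    have /eqP := X10 k; rewrite root_wtE [i == k]eq_sym (negPf ki) mulr0 sub0r mulf_eq0 => /orP[|//].
    by rewrite oppr_eq0 (negPf two_neq0).
  - apply/eqP; have /eqP := X00 i k; rewrite root_wtE eqxx mulr1 mulf_eq0 => /orP[|//].
    by rewrite (negPf two_neq0).
have r0 : root_wt K (inr (s, t)) 0 0 = 1 by rewrite root_wtE /= !mulr0 !addr0.
have r1 : root_wt K (inr (s, t)) 0 1 = (-1) ^+ s by rewrite root_wtE /= mulr0 addr0 add0r mulr1.
have r2 : root_wt K (inr (s, t)) 0 2%:R = (-1) ^+ t by rewrite root_wtE /= mulr0 addr0 add0r mulr1.
have three0 : 3 != 0 :> K by rewrite natr0E.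
have sgn (b : bool) : (2 + (-1) ^+ b != 0 :> K) * ((-1) ^+ b - 2 != 0 :> K).
  case: b; rewrite ?expr0 ?expr1.
    have -> : 2 + -1 = 1 :> K by ring.
    have -> : -1 - 2 = - 3 :> K by ring.
    by rewrite oppr_eq0 oner_eq0 three0.
  have -> : 2 + 1 = 3 :> K by ring.
  have -> : 1 - 2 = - 1 :> K by ring.
  by rewrite oppr_eq0 oner_eq0 three0.
have rk k : (2 + root_wt K (inr (s, t)) 0 k != 0) * (root_wt K (inr (s, t)) 0 k - 2 != 0).
  by move: k; apply: ord3P; rewrite ?r0 ?r1 ?r2 ?sgn//; exact: (sgn false).
exists (u (odd_mk 1 (inord (~~ s)) (inord (~~ t)))); apply: D21_eqP => /=.
  rewrite scaler0; apply: even_eqP => k; rewrite even0_entry; apply/eqP.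
  - by have /eqP := X01 k; rewrite mulf_eq0 (negPf (rk k).1).
  - by have /eqP := X10 k; rewrite mulf_eq0 (negPf (rk k).2).
  - by have /eqP := X00 0 k; rewrite r0 mul1r.
apply: odd_part_eqP => a b c; rewrite oddZ odd_elt_entry.
have i0 : inord 0 = 0 :> 'I_2 by apply/val_inj; rewrite /= inordK.
have i1 : inord 1 = 1 :> 'I_2 by apply/val_inj; rewrite /= inordK.
have := (U 0 a b c, U 1 a b c, U 2%:R a b c); rewrite r0 r1 r2 !odd_mk_val /=.
have onetwo : 1 + 1 = 2 :> K by [].
have Nonetwo : -1 + -1 = - 2 :> K by rewrite -opprD.
have nhalf0 (k : K) : - (2 * k) = 0 -> k = 0 by move/eqP; rewrite oppr_eq0 => /eqP/half0.
move=> [[]]; elim/ord2P: a; elim/ord2P: b; elim/ord2P: c; case: s {U r1 rk X01 X10 X00 r0 r2};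
  case: t => /=; rewrite ?i0 ?i1 ?expr0 ?expr1 ?addrN ?addNr ?onetwo ?Nonetwo ?mulNr ?mul0r;
  rewrite ?mulr0 ?mulr1 ?mul1r // => u0 u1 u2; rewrite ?mulr0; do ?[exact: half0 | exact: nhalf0].
Qed.

Lemma nminus_low (x : D21 K) : nminus al x <-> exists c, x = \sum_t c t *: lowel t.
Proof.
split=> [[w [wr ->]]|[c ->]].
  have [c cE] := choice (fun t => root_space_low (wr t)).
  by exists c; apply: eq_bigr => t _.
exists (fun t => c t *: lowel t); split=> // t; apply/root_spaceP => i.
have lin := D21_br_linr al (d21_h K i).
have br0 : br (d21_h K i) 0 = 0 by have := lin (-1) 0 0; rewrite scaler0 addr0 scaleN1r addNr.
have /root_spaceP/(_ i) lt := lowel_root t.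
by have := lin (c t) (lowel t) 0; rewrite !addr0 lt br0 addr0 => ->; rewrite !scalerA mulrC.
Qed.

Lemma nplus_e i : nplus al (d21_e K i).
Proof.
exists (fun t => if t == inl i then d21_e K i else 0); split=> [t|]; last by rewrite -big_mkcond big_pred1_eq.
have lin j := D21_br_linr al (d21_h K j).
have br0 j : br (d21_h K j) 0 = 0 by have := lin j (-1) 0 0; rewrite scaler0 addr0 scaleN1r addNr.
apply/root_spaceP => j; case: eqP => [->|_]; last by rewrite br0 scaler0.
by rewrite br_he root_wtE [j == i]eq_sym.
Qed.

Lemma nplus_z b c : nplus al (d21_o K false b c).
Proof.
exists (fun t => if t == inr (b, c) then d21_o K false b c else 0); split=> [t|]; last first.
  by rewrite -big_mkcond big_pred1_eq.
have lin j := D21_br_linr al (d21_h K j).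
have br0 j : br (d21_h K j) 0 = 0 by have := lin j (-1) 0 0; rewrite scaler0 addr0 scaleN1r addNr.
apply/root_spaceP => j; case: eqP => [->|_]; last by rewrite br0 scaler0.
move: j; apply: ord3P; rewrite root_wtE ?br_ho0 ?br_ho1 ?br_ho2 /= ?mulr0 ?mulr1 ?addr0 ?add0r //.
Qed.
End RootSpaces.

(** * From supermodules to operators satisfying the relations *)

Section Module.
Variables (K : fieldType) (al : K).
Hypothesis K_char0 : [pchar K] =i pred0.
Variables (V : vectType K) (Vpar : bool -> {vspace V}) (act : 'Hom(D21 K, 'End(V))).
Hypothesis mod : is_supermodule (D21_par (K := K)) (D21_br al) Vpar act.

Definition op_e i : 'End(V) := act (d21_e K i).
Definition op_f i : 'End(V) := act (d21_f K i).
Definition op_h i : 'End(V) := act (d21_h K i).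
Definition op_o a b c : 'End(V) := act (d21_o K a b c).

Let act_even (X : even_part K) (x : D21 K) j w : x \in D21_par j ->
  act (X, 0) (act x w) = act x (act (X, 0) w) + act (D21_br al (X, 0) x) w.
Proof.
move=> xj; rewrite (smod_br mod (i := false) (j := j))//; last by rewrite D21_par0.
by rewrite expr0 scale1r addrC subrK.
Qed.

Let par_even (X : even_part K) : (X, 0) \in D21_par false. Proof. by rewrite D21_par0. Qed.
Let par_odd (u : odd_part K) : (0, u) \in D21_par true. Proof. by rewrite D21_par1. Qed.
Let actZ k x w : act (k *: x) w = k *: act x w. Proof. by rewrite linearZ lfunE. Qed.
Let actD x x' w : act (x + x') w = act x w + act x' w. Proof. by rewrite linearD lfunE. Qed.
Let actN x w : act (- x) w = - act x w. Proof. by rewrite linearN lfunE. Qed.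

Lemma act_sl2_elt i a b w :
  act (sl2_elt K i a b) w = sl2_vec (op_e i) (op_f i) (op_h i) a b w.
Proof.
rewrite /sl2_elt !(actD, actN, actZ) /sl2_vec; case: a; case: b;
  rewrite /= ?(mulr0, mul0r, mulr1, mul1r, addr0, add0r) !lfunE /=;
  rewrite ?scale0r ?scale1r ?subr0 ?sub0r ?scaleNr ?addr0 //.
Qed.

Lemma module_rep : d21_rep al op_e op_f op_h op_o.
Proof.
have two0 : 2 != 0 :> K by move/pcharf0P: K_char0 => ->.
split; last 1 first.
  move=> a b c a' b' c' w.
  have := smod_br mod w (par_odd (d21_o K a b c).2) (par_odd (d21_o K a' b' c').2).
  rewrite expr1 scaleN1r opprK (br_oo al two0) => E.
  apply/eqP; rewrite eq_sym subr_eq -[X in _ == X]E.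
  by rewrite !actD !actZ !act_sl2_elt.
all: move=> *; rewrite /op_e /op_f /op_h /op_o.
- by rewrite (act_even _ _ (par_even _)) br_ef actZ.
- by rewrite (act_even _ _ (par_even _)) br_he actZ.
- by rewrite (act_even _ _ (par_even _)) br_hf actZ mulNr scaleNr.
- by rewrite (act_even _ _ (par_even _)) br_ff linear0 lfunE /= addr0.
- by rewrite (act_even _ _ (par_odd _)) br_eo0 actZ.
- by rewrite (act_even _ _ (par_odd _)) br_eo1 actZ.
- by rewrite (act_even _ _ (par_odd _)) br_eo2 actZ.
- by rewrite (act_even _ _ (par_odd _)) br_fo0 actZ.
- by rewrite (act_even _ _ (par_odd _)) br_fo1 actZ.
- by rewrite (act_even _ _ (par_odd _)) br_fo2 actZ.
- by rewrite (act_even _ _ (par_odd _)) br_ho0 actZ.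
- by rewrite (act_even _ _ (par_odd _)) br_ho1 actZ.
- by rewrite (act_even _ _ (par_odd _)) br_ho2 actZ.
Qed.

Lemma op_lowE t w : low op_f op_o t w = act (lowel K t) w.
Proof. by case: t. Qed.

(** An element of n^- is a combination of the vectors [lowel], so expanding a product of such
    elements gives words in the root vectors of the same length. *)
Lemma pbw_fil_Fil v k w : (w \in pbw_fil al act v k) = (w \in Fil (low op_f op_o) v k.+1).
Proof.
apply/idP/idP.
  apply: lspan_le => x [xs [xsk xsN ->]]; apply: FilS (_ : (size xs).+1 <= _)%N _ _ => //.
  elim: xs {xsk} xsN => [|x' xs IH] xsN /=; first exact: (@word_Fil _ _ _ _ [::]).
  have /(nminus_low al K_char0)[c ->] := xsN _ (mem_head _ _).
  rewrite linear_sum sum_lfunE rpred_sum // => t _.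
  rewrite linearZ lfunE rpredZ//= -op_lowE Fil_low//; apply: IH => u uxs.
  by apply: xsN; rewrite inE uxs orbT.
apply: lspan_le => x [q qk ->]; apply: lspan_gen; exists [seq lowel K t | t <- q].
split; first by rewrite size_map.
  move=> u /mapP[t _ ->]; apply/(nminus_low al K_char0); exists (fun t' => (t' == t)%:R).
  rewrite (bigD1 t) //= eqxx scale1r big1 ?addr0// => t' /negPf ->.
  by rewrite scale0r.
by rewrite /word; elim: q {qk} => //= t q ->; rewrite op_lowE.
Qed.

Section HighestWeightVector.
Variables (l : weight K) (v : V) (m : 'I_3 -> nat).
Hypothesis hwm : is_irr_hw_module al l Vpar act v.
Hypothesis lE : forall i, l 0 i = (m i)%:R.

Lemma hw_e i : op_e i v = 0.
Proof. by apply: (hw_nplus hwm); apply: nplus_e. Qed.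

Lemma hw_z b c : op_o false b c v = 0.
Proof. by apply: (hw_nplus hwm); apply: nplus_z. Qed.

Lemma hw_h i : op_h i v = (m i)%:R *: v.
Proof. by rewrite (hw_weight hwm) ?cartan_h// wt_eval_h lE. Qed.
End HighestWeightVector.

End Module.

Section Typical.
Variables (K : fieldType) (al : K) (l : weight K) (m : 'I_3 -> nat).
Hypothesis K_char0 : [pchar K] =i pred0.
Hypothesis lE : forall i, l 0 i = (m i)%:R.

Lemma rhoE i : rho K 0 i = if i == 0 then -1 else 1.
Proof.
have two0 : 2 != 0 :> K by move/pcharf0P: K_char0 => ->.
have pE (G : bool * bool -> K) : \sum_p G p = G (true, true) + G (true, false) + G (false, true) + G (false, false).
  have -> : \sum_p G p = \sum_a \sum_b G (a, b) by rewrite pair_bigA; apply: eq_bigr => -[].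
  by rewrite !big_bool /= !addrA.
rewrite /rho !mxE !summxE sum3 pE !root_wtE /= !expr0 !expr1.
by move: i; apply: ord3P => /=; field.
Qed.

(** Each of the four factors of [typ] is -2 (lambda + rho, beta) for one positive odd root beta. *)
Lemma typical_rep_typ : typical al l -> rep_typ al m != 0.
Proof.
have two0 : 2 != 0 :> K by move/pcharf0P: K_char0 => ->.
move=> ty; have t p : wt_form al (l + rho K) (root_wt K (inr p)) =
    - 2^-1 * ((1 + al) * ((m 0)%:R - 1) - (-1) ^+ p.1 * ((m 1)%:R + 1) - (-1) ^+ p.2 * (al * ((m 2%:R)%:R + 1))).
  have lr i : (l + rho K) 0 i = (m i)%:R + (if i == 0 then -1 else 1) by rewrite [LHS]mxE lE rhoE.
  rewrite /wt_form sum3 !root_wtE !lr /= /eps_norm /=; field.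
  exact: two0.
have nz (p : bool * bool) : (1 + al) * ((m 0)%:R - 1) - (-1) ^+ p.1 * ((m 1)%:R + 1) - (-1) ^+ p.2 * (al * ((m 2%:R)%:R + 1)) != 0.
  by apply/eqP => E; apply: (ty p); rewrite t E mulr0.
have := (nz (true, true), nz (true, false), nz (false, true), nz (false, false)).
rewrite /= !expr0 !expr1 !mulN1r !mul1r !opprK => -[[[a b] c] d].
by rewrite /rep_typ /typ /= !mulf_neq0.
Qed.
End Typical.


(** * The associated graded space *)

Lemma lspan_uniq (K : fieldType) (M : lmodType K) (I : eqType) (P : I -> Prop) (p : I -> M) w :
  w \in lspan (fun x => exists2 s, P s & x = p s) ->
  exists (r : seq I) (c : I -> K),
    [/\ uniq r, {in r, forall s, P s} & w = \sum_(s <- r) c s *: p s].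
Proof.
move=> /asboolP[n [c [u [uP ->]]]].
have [s sP us] : exists2 s : 'I_n -> I, forall i, P (s i) & forall i, u i = p (s i).
  have [s sP] := choice (fun i => let: ex_intro2 s Ps us := uP i in ex_intro (fun s => P s /\ u i = p s) s (conj Ps us)).
  by exists s => i; case: (sP i).
exists (undup (codom s)), (fun t => \sum_(i | s i == t) c i); split.
- exact: undup_uniq.
- by move=> t; rewrite mem_undup => /codomP[i ->].
under [RHS]eq_bigr do rewrite scaler_suml big_mkcond.
rewrite exchange_big /=; apply: eq_bigr => i _.
rewrite -big_mkcond (eq_bigl (fun t => t == s i)) => [|t]; last exact: eq_sym.
by rewrite -big_filter filter_pred1_uniq ?undup_uniq ?mem_undup ?codom_f// big_seq1 us.
Qed.

Section GradedBasis.
Local Open Scope quotient_scope.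
Variables (K : fieldType) (V : lmodType K) (F : nat -> submodClosed V).

Let comp k w : fil_dsum F := insubd 0 (fun j => if j == k then w else 0).

Lemma fil_dsum_sum (I : Type) (r : seq I) (G : I -> fil_dsum F) k :
  (\sum_(i <- r) G i : fil_dsum F) k = \sum_(i <- r) G i k.
Proof. by apply: (big_morph (fun f : fil_dsum F => f k)). Qed.

Lemma lquot_pi_sum (I : Type) (r : seq I) (G : I -> fil_dsum F) :
  \pi_(lquot (fil_null (F := F))) (\sum_(i <- r) G i) =
  \sum_(i <- r) \pi_(lquot (fil_null (F := F))) (G i).
Proof.
apply: (big_morph (fun f => \pi_(lquot (fil_null (F := F))) f)); last exact: lquot_pi0.
by move=> f g; exact: lquot_piD.
Qed.

Lemma gr_class_lin k a u w : u \in F k -> w \in F k ->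
  gr_class F k (a *: u + w) = a *: gr_class F k u + gr_class F k w.
Proof.
move=> uF wF; have piZ : a *: gr_class F k u = \pi_(lquot (fil_null (F := F))) (a *: comp k u).
  exact: lquot_scale_pi.
rewrite piZ -[RHS]lquot_piD; congr (\pi_(_) _).
apply: val_inj; apply/funext => j.
have -> : \val (a *: comp k u + comp k w) j = a *: (comp k u : fil_dsum F) j + (comp k w : fil_dsum F) j by [].
rewrite -[\val _ j]/(fil_dsum_val _ j) !gr_class_val ?rpredD ?rpredZ//.
by case: eqP => // _; rewrite scaler0 addr0.
Qed.

Lemma gr_class0 k : gr_class F k 0 = 0.
Proof. by apply/gr_class_eq0; rewrite ?rpred0//; case: k => [|k] /=; rewrite ?rpred0 ?inE. Qed.

Lemma gr_classZ k a u : u \in F k -> gr_class F k (a *: u) = a *: gr_class F k u.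
Proof. by move=> uF; have := gr_class_lin a uF (rpred0 _); rewrite gr_class0 !addr0; apply. Qed.

Lemma gr_class_sum k (I : eqType) (r : seq I) (c : I -> K) (u : I -> V) : {in r, forall i, u i \in F k} ->
  gr_class F k (\sum_(i <- r) c i *: u i) = \sum_(i <- r) c i *: gr_class F k (u i).
Proof.
move=> rF; suff [] : \sum_(i <- r) c i *: u i \in F k /\
    gr_class F k (\sum_(i <- r) c i *: u i) = \sum_(i <- r) c i *: gr_class F k (u i) by [].
rewrite big_seq [X in _ = X]big_seq; apply: (big_rec2 (fun x y => x \in F k /\ gr_class F k x = y)).
  by rewrite rpred0 gr_class0.
by move=> i x y /rF iF [xF <-]; rewrite gr_class_lin// rpredD ?rpredZ.
Qed.

Lemma gr_class_decomp (f : fil_dsum F) n : (forall k, (n <= k)%N -> f k = 0) ->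
  \pi_(lquot (fil_null (F := F))) f = \sum_(k < n) gr_class F k (f k).
Proof.
move=> fn; have fF k : f k \in F k by have /asboolP[_ /(_ k)] := valP f.
rewrite -(lquot_pi_sum _ (fun k : 'I_n => comp k (f k))).
congr (\pi_(_) _); apply: val_inj; apply/funext => j.
rewrite -[LHS]/(fil_dsum_val f j) -[RHS]/((\sum_(k < n) comp k (f k) : fil_dsum F) j).
rewrite fil_dsum_sum.
under eq_bigr do rewrite gr_class_val//.
rewrite -big_mkcond; have [jn|nj] := ltnP j n; first by rewrite (big_pred1 (Ordinal jn)).
by rewrite fn// big_pred0// => k; apply/negbTE; rewrite neq_ltn (leq_trans (ltn_ord k) nj) orbT.
Qed.

Variables (I : eqType) (S : {pred I}) (d : I -> nat) (p : I -> V).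
Hypothesis p_span : forall k, {subset F k <= lspan (fun w => exists2 s, s \in S /\ (d s <= k)%N & w = p s)}.
Hypothesis p_fil : forall s, p s \in F (d s).
Hypothesis F_incr : forall k, {subset F k <= F k.+1}.
Hypothesis p_indep : forall (r : seq I) (c : I -> K), uniq r -> {subset r <= S} ->
  \sum_(s <- r) c s *: p s = 0 -> {in r, forall s, c s = 0}.

Let F_le j k : (j <= k)%N -> {subset F j <= F k}.
Proof.
by move=> /subnK <-; elim: (k - j)%N => // n IH w /IH /F_incr.
Qed.

Lemma gr_class_span k w : w \in F k ->
  gr_class F k w \in lspan (fun x => exists2 s, s \in S & x = gr_class F (d s) (p s)).
Proof.
move=> /p_span /lspan_uniq[r [c [_ rS ->]]].
rewrite gr_class_sum => [|s /rS[_ sk]]; last exact: F_le sk _ (p_fil s).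
rewrite big_seq rpred_sum// => s /rS[sS] sk; rewrite rpredZ//; move: sk; rewrite leq_eqVlt => /predU1P[<-|sk].
  by apply: lspan_gen; exists s.
rewrite (gr_class_eq0 (F_le (ltnW sk) (p_fil s))).2 ?rpred0//.
by case: k sk {rS} => // k; rewrite ltnS => /F_le/(_ _ (p_fil s)).
Qed.

Lemma fil_prev_uniq k w : w \in fil_prev F k -> exists (r : seq I) (c : I -> K),
  [/\ uniq r, {in r, forall s, s \in S /\ (d s < k)%N} & w = \sum_(s <- r) c s *: p s].
Proof.
case: k => [|k] /=; last by move=> /p_span /lspan_uniq[r [c [rU rS ->]]]; exists r, c.
by rewrite inE => /eqP ->; exists [::], (fun=> 0); rewrite big_nil.
Qed.

(** Read in degree d s0, a vanishing combination says that the p s of this degree combine to a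
    vector of the previous filtration term, hence to a combination of p s of smaller degree;
    independence in V ends the argument. For spanning, the p s with d s < k have class 0 in degree
    k. *)
Lemma gr_class_basis : is_basis S (fun s => gr_class F (d s) (p s)).
Proof.
split=> [r c r_uniq rS sum_r s0 s0r|w].
  pose G s := comp (d s) (p s).
  have : \pi_(lquot (fil_null (F := F))) (\sum_(s <- r) c s *: G s) = \pi_(_) 0.
    rewrite lquot_pi0 -[RHS]sum_r lquot_pi_sum; apply: eq_bigr => s _.
    by apply/esym/lquot_scale_pi.
  move=> /lquot_pi_eq; rewrite subr0 => /asboolP/(_ (d s0)).
  rewrite fil_dsum_sum => /fil_prev_uniq[r1 [c1 [r1_uniq r1S]]].
  pose r0 := [seq s <- r | d s == d s0].
  have -> : \sum_(s <- r) (c s *: G s : fil_dsum F) (d s0) = \sum_(s <- r0) c s *: p s.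
    rewrite big_filter [RHS]big_mkcond; apply: eq_bigr => s _.
    rewrite -[LHS]/(c s *: (G s : fil_dsum F) (d s0)) gr_class_val// [d s0 == _]eq_sym.
    by case: eqP; rewrite ?scaler0.
  move=> /eqP; rewrite -subr_eq0 => /eqP E.
  have r01 s : s \in r1 -> s \in r0 = false.
    by move=> /r1S[_ sk]; rewrite mem_filter ltn_eqF.
  have := @p_indep (r0 ++ r1) (fun s => if s \in r0 then c s else - c1 s).
  rewrite cat_uniq filter_uniq// r1_uniq andbT.
  rewrite -all_predC (introT allP) => [|s /r01 /= -> //].
  move=> /(_ isT) H; have /H : {subset r0 ++ r1 <= S}.
    by move=> s; rewrite mem_cat mem_filter => /orP[/andP[_ /rS]|/r1S[]].
  rewrite big_cat /= => {}H; have /H /(_ s0) : 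
      \sum_(s <- r0) (if s \in r0 then c s else - c1 s) *: p s +
      \sum_(s <- r1) (if s \in r0 then c s else - c1 s) *: p s = 0.
    rewrite -[RHS]E -sumrN; congr (_ + _); rewrite !big_seq; apply: eq_bigr => s.
      by move=> ->.
    by move=> /r01 ->; rewrite scaleNr.
  by rewrite mem_cat mem_filter eqxx s0r; apply.
have wS : w \in lspan (fun x => exists2 s, s \in S & x = gr_class F (d s) (p s)).
  have <- : \pi_(lquot (fil_null (F := F))) (repr w) = w by exact: (@reprK _ (lquot (fil_null (F := F)))).
  have /asboolP[[n fn] fF] := valP (repr w : fil_dsum F).
  rewrite (gr_class_decomp fn) rpred_sum// => k _; apply: gr_class_span; exact: fF.
by have [r [c [_ rS ->]]] := lspan_uniq wS; exists r, c.
Qed.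

Variables (q : I -> V) (a : I -> K).
Hypothesis a_neq0 : forall s, a s != 0.
Hypothesis q_class : forall s, q s - a s *: p s \in fil_prev F (d s).

Let fil_prevW k w : w \in fil_prev F k -> w \in F k.
Proof. by case: k => [|k /F_incr//]; rewrite inE => /eqP ->; rewrite rpred0. Qed.

Lemma gr_class_leading s : gr_class F (d s) (q s) = a s *: gr_class F (d s) (p s).
Proof.
have qp := fil_prevW (q_class s).
rewrite -[q s](subrK (a s *: p s)) -[q s - _]scale1r gr_class_lin ?rpredZ//.
by rewrite (gr_class_eq0 qp).2 ?q_class// scaler0 add0r gr_classZ.
Qed.

(** This permits a change of root vectors and of the order of the factors: both alter a monomial by
    a nonzero scalar and terms of lower degree. *)
Lemma gr_leading_basis : is_basis S (fun s => gr_class F (d s) (q s)).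
Proof.
have [ind spa] := gr_class_basis; split=> [r c r_uniq rS|w].
  under eq_bigr do rewrite gr_class_leading scalerA.
  move=> /ind H s sr; have /eqP := H r_uniq rS s sr.
  by rewrite mulf_eq0 (negPf (a_neq0 s)) orbF => /eqP.
have [r [c [rS ->]]] := spa w; exists r, (fun s => c s / a s); split=> //.
by apply: eq_bigr => s _; rewrite gr_class_leading scalerA divfK.
Qed.
End GradedBasis.

(** * Monomials in arbitrary root vectors and in arbitrary order *)

Section Monomials.
Variables (K : fieldType) (al : K).
Hypothesis K_char0 : [pchar K] =i pred0.
Variables (V : vectType K) (act : 'Hom(D21 K, 'End(V))) (v : V).
Variables (x : proot -> D21 K).
Hypothesis x_neq0 : forall t, x t <> 0.
Hypothesis x_root : forall t, root_space al (- root_wt K t) (x t).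

Local Notation F := (pbw_fil al act v).

Lemma nminus_root t : nminus al (x t).
Proof.
exists (fun u => if u == t then x t else 0); split=> [u|]; last by rewrite -big_mkcond big_pred1_eq.
case: eqP => [->|_] // h _.
by have := D21_br_linr al h (-1) 0 0; rewrite scaler0 addr0 scaleN1r addNr scaler0.
Qed.

Definition monomial (r : seq proot) (s : proot -> nat) : V :=
  foldr (fun t => iter (s t) (act (x t))) v r.

Lemma gr_monomialE r (s : {ffun proot -> nat}) : monomial r s \in F (\sum_(t <- r) s t) /\
  gr_monomial al act v x r s = gr_class F (\sum_(t <- r) s t) (monomial r s).
Proof.
have step t k w : w \in F k -> act (x t) w \in F k.+1 /\
    gr_op (act (x t)) (gr_class F k w) = gr_class F k.+1 (act (x t) w).
  have TF := pbw_filS (act := act) (v := v) (nminus_root t).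
  by move=> wF; split; [exact: TF | exact: (gr_opE TF)].
elim: r => [|t r [mF IH]]; rewrite ?big_nil ?big_cons.
  by split=> //; apply: lspan_gen; exists [::].
rewrite /gr_monomial /= -/(gr_monomial al act v x r s) -/(monomial r s) IH.
elim: (s t) => //= n [nF ->]; exact: step.
Qed.

Lemma monomial_word r s : exists2 c : K, c != 0 &
  monomial r s = c *: word (low (op_f act) (op_o act)) v (exps r s).
Proof.
have [c cE] := choice (fun t => root_space_low K_char0 (x_root t)).
have c0 t : c t != 0 by apply/eqP => ct; apply: (x_neq0 (t := t)); rewrite cE ct scale0r.
have xE t w : act (x t) w = c t *: low (op_f act) (op_o act) t w.
  by rewrite cE linearZ lfunE op_lowE.
exists (\prod_(t <- r) c t ^+ s t).
  by apply: (big_ind (fun c => c != 0)); rewrite ?oner_neq0 => // *; rewrite ?mulf_neq0 ?expf_neq0.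
rewrite word_exps; elim: r => [|t r IH] /=; first by rewrite big_nil scale1r.
rewrite big_cons -/(monomial r s) IH; elim: (s t) => [|n IHn] /=; first by rewrite expr0 mul1r.
by rewrite IHn linearZ /= xE scalerA exprSr mulrAC.
Qed.
End Monomials.

Section Main.
Variables (K : fieldType) (al : K).
Hypothesis K_char0 : [pchar K] =i pred0.
Variables (V : vectType K) (Vpar : bool -> {vspace V}) (act : 'Hom(D21 K, 'End(V))) (v : V).
Variables (l : weight K) (m : 'I_3 -> nat).
Hypothesis hwm : is_irr_hw_module al l Vpar act v.
Hypothesis lE : forall i, l 0 i = (m i)%:R.
Hypothesis m0_ge3 : (3 <= m 0%R)%N.
Hypothesis l_typical : typical al l.
Hypothesis al_neqN1 : 1 + al != 0.
Variables (x : proot -> D21 K).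
Hypothesis x_neq0 : forall t, x t <> 0.
Hypothesis x_root : forall t, root_space al (- root_wt K t) (x t).
Variable (r : seq proot).
Hypothesis r_enum : perm_eq r (enum {: proot}).

Let rep := module_rep K_char0 (hw_module hwm).
Let ev := hw_e hwm.
Let zv := hw_z hwm.
Let hv := hw_h hwm lE.
Local Notation F := (pbw_fil al act v).
Local Notation Fl := (Fil (low (op_f act) (op_o act)) v).
Local Notation pb := (pbw (op_f act) (op_o act) v).

Lemma fil_prev_Fil k w : w \in Fl k -> w \in fil_prev F k.
Proof.
by case: k => [/Fil0 ->|k wk]; rewrite ?inE//= pbw_fil_Fil.
Qed.

Lemma gr_monomial_basis :
  is_basis (Slambda (m 0) (m 1) (m 2%:R)) (gr_monomial al act v x r).
Proof.
pose d (s : {ffun proot -> nat}) := (\sum_t s t)%N.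
have dr (s : {ffun proot -> nat}) : (\sum_(t <- r) s t)%N = d s by rewrite (perm_big _ r_enum) big_enum.
have pF (s : {ffun proot -> nat}) : pb s \in F (d s).
  by rewrite pbw_fil_Fil// pbw_word word_Fil// size_exps_std.
have lead (s : {ffun proot -> nat}) : exists2 a : K, a != 0 & monomial act v x r s - a *: pb s \in fil_prev F (d s).
  have [c c0 ->] := monomial_word K_char0 act v x_neq0 x_root r s.
  have rs : perm_eq (exps r s) (exps std_roots s).
    apply/allP => t _ /=; rewrite !count_exps ?(perm_uniq r_enum) ?enum_uniq//.
    by rewrite (perm_mem r_enum) (perm_mem std_roots_perm).
  have [b b0 H] := word_perm (low_swap v rep) rs.
  (* The scalar c compares the given root vectors with the standard ones, and b comes from sorting
     the factors into the order [std_roots]. *)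
  exists (c * b); first by rewrite mulf_neq0.
  rewrite -scalerA -scalerBr pbw_word; apply: fil_prev_Fil; rewrite rpredZ//.
  by rewrite -dr -size_exps.
have [a a0 mE] : exists2 a : {ffun proot -> nat} -> K, forall s, a s != 0 &
    forall s : {ffun proot -> nat}, monomial act v x r s - a s *: pb s \in fil_prev F (d s).
  have [a aE] := choice (fun s => let: ex_intro2 a a0 H := lead s in
    ex_intro (fun a => a != 0 /\ monomial act v x r s - a *: pb s \in fil_prev F (d s)) a (conj a0 H)).
  by exists a => s; case: (aE s).
have grE : gr_monomial al act v x r = (fun s : {ffun proot -> nat} => gr_class F (d s) (monomial act v x r s)).
  by apply/funext => s; rewrite (gr_monomialE _ _ x_root _ _).2 ?dr.
rewrite grE; apply: (gr_leading_basis (p := pb)) a0 mE => //.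
- move=> k w; rewrite pbw_fil_Fil// => /(Fil_Std K_char0 rep ev zv hv m0_ge3).
  by move: w; apply: lspan_le => _ [s [sS sk ->]]; apply: lspan_gen; exists s.
- by move=> k w; rewrite !pbw_fil_Fil//; exact: FilS.
- move=> q c; apply: (pbw_independent K_char0 rep _ ev zv hv) => //.
    exact: hw_neq0 hwm.
  exact: typical_rep_typ.
Qed.
End Main.

Local Open Scope complex_scope.
Theorem mainTheorem4 (R : realType) (alpha : R[i])
  (alpha_neq0 : alpha <> 0) (alpha_neqN1 : alpha <> -1)
  (m1 m2 m3 : nat) (lambda : weight R[i])
  (lambdaE : lambda = m1%:R *: eps R[i] 0 + m2%:R *: eps R[i] 1
                      + m3%:R *: eps R[i] 2%:R)
  (V : vectType R[i]) (Vpar : bool -> {vspace V})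
  (act : 'Hom(D21 R[i], 'End(V))) (v : V)
  (V_lambda : is_irr_hw_module alpha lambda Vpar act v)
  (lambda_typical : typical alpha lambda)
  (m1_ge3 : (3 <= m1)%N)
  (x : proot -> D21 R[i])
  (x_neq0 : forall t, x t <> 0)
  (x_root : forall t, root_space alpha (- root_wt R[i] t) (x t))
  (r : seq proot) (r_enum : perm_eq r (enum {: proot})) :
  is_basis (Slambda m1 m2 m3) (gr_monomial alpha act v x r).
Proof.
pose m (i : 'I_3) := nth 0%N [:: m1; m2; m3] i.
apply: (gr_monomial_basis (m := m) _ V_lambda) => //.
- exact: Num.Theory.pchar_num.
- rewrite lambdaE => i; rewrite !mxE; move: i; apply: ord3P => /=;
    by rewrite ?mulr0 ?mulr1 ?addr0 ?add0r.
- by rewrite addrC addr_eq0; apply/eqP.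
Qed.
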